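(* For every constant $\alpha\in\mathbb N$ with $\alpha>1$, the following problem is $\mathrm{W}[1]$-hard when parameterized by $|\phi(X)|$: given a vertex-colored path $G$ and a $\mathrm{CMSO}_1[\lessgtr]$-query $(\phi(X),0)$ (with optimization target the constant $0$), compute an $\alpha$-approximate answer to $(\phi(X),0)$ on $G$. This holds even if $\phi(X)$ is required to have the form \[\forall Y_1\forall Y_2\bigl(|Y_1|>|Y_2|\cdot\alpha^2\ \vee\ |Y_2|>|Y_1|\cdot\alpha^2\ \vee\ \psi(XY_1Y_2)\bigr),\] where $\psi(XY_1Y_2)$ is an $\mathrm{MSO}_1$-formula.
   Context: $\mathrm{CMSO}_1$ (resp. $\mathrm{MSO}_1$) is (counting) monadic second-order logic over vertex-colored graphs with quantification over vertices and vertex sets, atoms $x\in X$, $x=y$, $E(x,y)$, color atoms, and (for the counting version) $\mathrm{card}_{a,r}(X)$ meaning $|X|\equiv a\bmod r$. A weight term is $a+\sum a_{ij}w_i(X_j)$ with real coefficients, where $w_i(X)$ sums a weight over $X$; $|X|$ denotes the term summing the constant weight $1$. $\mathrm{CMSO}_1[\lessgtr]$ extends $\mathrm{CMSO}_1$ with weight comparisons $t\le t',t<t',t\ge t',t>t'$ as atoms, formulas being negation normalized (no negation applied to a subformula containing a weight comparison). $|\phi|$ is the number of symbols of $\phi$, each coefficient counting as one symbol. For $\alpha\ge1$, the $\alpha$-loosening $\phi_\alpha$ replaces $t\le t'$ by $\frac1\alpha t\le\alpha t'$, $t<t'$ by $\frac1\alpha t<\alpha t'$, $t\ge t'$ by $\alpha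 t\ge\frac1\alpha t'$, $t>t'$ by $\alpha t>\frac1\alpha t'$; the $\alpha$-tightening $\phi^\alpha$ replaces $t\le t'$ by $\alpha t\le\frac1\alpha t'$, $t<t'$ by $\alpha t<\frac1\alpha t'$, $t\ge t'$ by $\frac1\alpha t\ge\alpha t'$, $t>t'$ by $\frac1\alpha t>\alpha t'$. For a query $(\phi,\hat t)$ and graph $G$, $\max(G,\phi,\hat t)$, $\mathrm{oversatisfy}(G,\phi,\hat t,\alpha)$, $\mathrm{undersatisfy}(G,\phi,\hat t,\alpha)$ are the maxima of $\hat t(\bar W)$ over assignments $\bar W$ with $G\models\phi(\bar W)$, $G\models\phi^\alpha(\bar W)$, $G\models\phi_\alpha(\bar W)$ respectively ($-\infty$ if none). An $\alpha$-approximate answer consists of $\max^-,\max^+\in\mathbb N\cup\{-\infty\}$ with $\mathrm{oversatisfy}\le\max^-\le\max\le\max^+\le\mathrm{undersatisfy}$, plus a witness $\bar W^-$ with $G\models\phi(\bar W^-)$, $\hat t(\bar W^-)=\max^-$ if $\max^-\ne-\infty$, and a witness $\bar W^+$ with $G\models\phi_\alpha(\bar W^+)$, $\hat t(\bar W^+)=\max^+$ if $\max^+\ne-\infty$. *)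

(* Defs.v *)
From HB Require Import structures.
From mathcomp Require Import all_boot all_order all_algebra all_fingroup.

Set Implicit Arguments.
Unset Strict Implicit.
Unset Printing Implicit Defensive.

Import Order.TTheory GRing.Theory Num.Theory.

(* Every [enc_*] below is injective and prefix-free.  Indices (variables,
    colours, wires, orders of graphs) are written in unary, which is
    polynomially equivalent to binary because the objects they index are listed
    explicitly; numerical values (coefficients, moduli, weights, optima) are
    written in binary. *)

Definition enc_unary (n : nat) : seq bool := rcons (nseq n true) false.

(* Self-delimiting form of a bit string: every bit is preceded by [true], and
   the end is marked by [false]. *)
Definition enc_bits (s : seq bool) : seq bool :=
  rcons (flatten [seq [:: true; b] | b <- s]) false.

(* Binary digits, least significant first. *)
Definition binary (n : nat) : seq bool :=
  [seq odd (n %/ 2 ^ i) | i <- iota 0 (trunc_log 2 n).+1].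

Definition enc_nat (n : nat) : seq bool := enc_bits (binary n).

Definition enc_rat (q : rat) : seq bool :=
  (numq q < 0)%R :: enc_nat `|numq q|%N ++ enc_nat `|denq q|%N.

Definition enc_seq (T : Type) (enc : T -> seq bool) (s : seq T) : seq bool :=
  enc_unary (size s) ++ flatten [seq enc x | x <- s].

Definition enc_opt (T : Type) (enc : T -> seq bool) (o : option T) : seq bool :=
  if o is Some x then true :: enc x else [:: false].

Definition enc_set (n : nat) (A : {set 'I_n}) : seq bool :=
  [seq v \in A | v <- enum 'I_n].

(* Structured programs over finitely many stacks of bits, with unit cost per
    elementary operation and an oracle.  This is the multitape Turing machine
    model up to a constant factor in time: a tape is a pair of stacks and the
    finite control is encoded in the program. *)

Inductive cmd : Type :=
| Skip
| Push of nat & bool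
| Pop of nat
| Seq of cmd & cmd
| Case of nat & cmd & cmd & cmd
    (* branch on the top of the stack: none, [false], [true] *)
| While of nat & cmd
    (* iterate as long as the stack is nonempty *)
| Query of nat
    (* replace the content of the stack by the answer of the oracle to it *).

Definition state := nat -> seq bool.

Definition upd (s : state) (r : nat) (v : seq bool) : state :=
  fun r' => if r' == r then v else s r'.

(* [exec O p s s' t qs]: with oracle [O], program [p] started in state [s]
   halts in state [s'] after [t] steps, having asked the queries [qs]. *)
Inductive exec (O : seq bool -> seq bool) :
  cmd -> state -> state -> nat -> seq (seq bool) -> Prop :=
| exec_skip s : exec O Skip s s 1 [::]
| exec_push r b s : exec O (Push r b) s (upd s r (b :: s r)) 1 [::]
| exec_pop r s : exec O (Pop r) s (upd s r (behead (s r))) 1 [::]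
| exec_seq p1 p2 s s1 s2 t1 t2 q1 q2 :
    exec O p1 s s1 t1 q1 -> exec O p2 s1 s2 t2 q2 ->
    exec O (Seq p1 p2) s s2 (t1 + t2) (q1 ++ q2)
| exec_case r p0 pF pT s s' t qs :
    exec O (match s r with
            | [::] => p0
            | false :: _ => pF
            | true :: _ => pT
            end) s s' t qs ->
    exec O (Case r p0 pF pT) s s' t.+1 qs
| exec_while_stop r p s :
    s r = [::] -> exec O (While r p) s s 1 [::]
| exec_while_loop r p s s1 s2 t1 t2 q1 q2 :
    s r <> [::] ->
    exec O p s s1 t1 q1 -> exec O (While r p) s1 s2 t2 q2 ->
    exec O (While r p) s s2 (t1 + t2).+1 (q1 ++ q2)
| exec_query r s : exec O (Query r) s (upd s r (O (s r))) 1 [:: s r].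

(* Input convention: the string in stack 0, the parameter in unary in stack 1.
   Output convention: the same. *)
Definition init (x : seq bool) (k : nat) : state :=
  fun r => if r == 0 then x else if r == 1 then nseq k true else [::].

(* Runs that ask no query do not depend on the oracle. *)
Definition run (p : cmd) (s s' : state) (t : nat) : Prop :=
  exec (fun=> [::]) p s s' t [::].

Definition computable (f : nat -> nat) : Prop :=
  exists p, forall k, exists s' t,
    run p (init [::] k) s' t /\ s' 1 = nseq (f k) true.

Definition plang := seq bool -> nat -> Prop.

(* A parameterized problem whose instances come from a specified class. *)
Record pproblem := PProblem {
  pinst : Type;
  penc : pinst -> seq bool;
  pparam : pinst -> nat;
  pyes : pinst -> Prop
}.

(* A search problem: [sans i a] means that the string [a] is a correct answer
   to the instance [i]. *)
Record sproblem := SProblem {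
  sinst : Type;
  senc : sinst -> seq bool;
  sparam : sinst -> nat;
  sans : sinst -> seq bool -> Prop
}.

Definition fpt_reducible (L : plang) (B : pproblem) : Prop :=
  exists (p : cmd) (f g : nat -> nat) (c : nat),
    [/\ computable f, computable g &
     forall x k, exists (j : pinst B) (s' : state) (t : nat),
       [/\ run p (init x k) s' t,
           t <= f k * (size x).+1 ^ c,
           s' 0 = penc j /\ s' 1 = nseq (pparam j) true,
           pparam j <= g k
         & L x k <-> pyes j]].

(* [O] is arbitrary on strings that are no instances and on instances without
   any correct answer. *)
Definition solves (S : sproblem) (O : seq bool -> seq bool) : Prop :=
  forall i : sinst S, (exists a, sans i a) -> sans i (O (senc i)).

(* Parameterized Turing reduction: an fpt-time oracle program that decides [L]
   with any solver of [S] as oracle, and only queries instances of [S] whose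
   parameter is bounded in terms of the original one. *)
Definition fpt_turing_reducible (L : plang) (S : sproblem) : Prop :=
  exists (p : cmd) (f h : nat -> nat) (c : nat),
    [/\ computable f, computable h &
     forall O, solves S O ->
     forall x k, exists (b : bool) (s' : state) (t : nat) (qs : seq (seq bool)),
       [/\ exec O p (init x k) s' t qs,
           t <= f k * (size x).+1 ^ c,
           s' 0 = [:: b],
           forall q, q \in qs ->
             exists2 j : sinst S, senc j = q & sparam j <= h k
         & b <-> L x k]].

(* In a circuit, nodes are numbered in topological order: the inputs are
    [0, ..., cinputs - 1], the following nodes are the gates in list order, and
    the last node is the output. *)

Inductive gate : Type := GNot of nat | GAnd of seq nat | GOr of seq nat.

Definition gate_preds (g : gate) : seq nat :=
  match g with GNot i => [:: i] | GAnd l => l | GOr l => l end.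

Definition gate_large (g : gate) : bool := 2 < size (gate_preds g).

Definition wf_gate (m : nat) (g : gate) : bool :=
  match g with
  | GNot i => i < m
  | GAnd l | GOr l => [&& 1 < size l, uniq l & all (fun i => i < m) l]
  end.

Record circuit := Circuit { cinputs : nat; cgates : seq gate }.

Definition wf_circuit (C : circuit) : bool :=
  (0 < cinputs C + size (cgates C)) &&
  [forall i : 'I_(size (cgates C)),
     wf_gate (cinputs C + i) (nth (GNot 0) (cgates C) i)].

(* Values of all nodes, computed along the topological order. *)
Definition node_values (T : Type) (step : seq T -> gate -> T)
    (inputs : seq T) (gs : seq gate) : seq T :=
  foldl (fun vs g => rcons vs (step vs g)) inputs gs.

Definition gate_val (vs : seq bool) (g : gate) : bool :=
  match g with
  | GNot i => ~~ nth false vs i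
  | GAnd l => all (nth false vs) l
  | GOr l => has (nth false vs) l
  end.

Definition circuit_val (C : circuit) (S : {set 'I_(cinputs C)}) : bool :=
  last false (node_values gate_val [seq i \in S | i <- enum 'I_(cinputs C)]
                          (cgates C)).

(* The maximum, over the paths from an input to the output, of the number of
   gates on the path that satisfy [a]. *)
Definition longest (a : pred gate) (C : circuit) : nat :=
  last 0 (node_values
            (fun ds g => a g + \max_(i <- gate_preds g) nth 0 ds i)
            (nseq (cinputs C) 0) (cgates C)).

Definition depth (C : circuit) : nat := longest xpredT C.

Definition weft (C : circuit) : nat := longest gate_large C.

Definition enc_gate (g : gate) : seq bool :=
  match g with
  | GNot i => enc_unary 0 ++ enc_unary i
  | GAnd l => enc_unary 1 ++ enc_seq enc_unary l
  | GOr l => enc_unary 2 ++ enc_seq enc_unary l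
  end.

Definition enc_circuit (C : circuit) : seq bool :=
  enc_unary (cinputs C) ++ enc_seq enc_gate (cgates C).

(* Weighted circuit satisfiability for circuits of weft at most [t] and depth
   at most [d]: is there a satisfying assignment with exactly [k] ones? *)
Definition WCS (t d : nat) : pproblem :=
  @PProblem {Ck : circuit * nat |
               [&& wf_circuit Ck.1, weft Ck.1 <= t & depth Ck.1 <= d]}
    (fun i => enc_circuit (sval i).1)
    (fun i => (sval i).2)
    (fun i => exists2 S : {set 'I_(cinputs (sval i).1)},
                #|S| = (sval i).2 & circuit_val S).

Definition in_W (t : nat) (L : plang) : Prop :=
  exists d, fpt_reducible L (WCS t d).

Definition W1_hard (S : sproblem) : Prop :=
  forall L, in_W 1 L -> fpt_turing_reducible L S.

(* The vertices are [0, ..., gpred], so that graphs are nonempty.  Colours are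
   unary predicates. *)
Record cgraph := CGraph {
  gpred : nat;
  gadj : 'M[bool]_gpred.+1;
  gcolors : seq {set 'I_gpred.+1};
  gweights : seq {ffun 'I_gpred.+1 -> nat}
}.

Definition vertex (G : cgraph) := 'I_(gpred G).+1.

Definition is_path (G : cgraph) : Prop :=
  exists p : {perm vertex G}, forall u v : vertex G,
    gadj G u v = ((p u).+1 == p v :> nat) || ((p v).+1 == p u :> nat).

Definition enc_graph (G : cgraph) : seq bool :=
  enc_unary (gpred G) ++
  [seq gadj G u v | u <- enum (vertex G), v <- enum (vertex G)] ++
  enc_seq (@enc_set _) (gcolors G) ++
  enc_seq (fun w : {ffun vertex G -> nat} =>
             flatten [seq enc_nat (w v) | v <- enum (vertex G)]) (gweights G).

(* Vertex variables and set variables are numbered separately. *)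

Section Logic.

Variable R : realFieldType.

(* [WTerm a s] is [a] plus the sum of [b * w(X)] over the triples [(b, w, X)]
   in [s]; the weight symbol [None] is the constant weight 1, so that it gives
   the term |X|, and [Some i] is the [i]-th weight of the graph. *)
Record wterm := WTerm {
  wt_const : R;
  wt_sum : seq (R * option nat * nat)
}.

Inductive comparison := Le | Lt | Ge | Gt.

Inductive formula : Type :=
| FMem of nat & nat
| FEq of nat & nat
| FAdj of nat & nat
| FColor of nat & nat                    (* x has colour c; [FColor c x] *)
| FCard of nat & nat & nat               (* card_{a,r}(X); [FCard a r X] *)
| FCmp of comparison & wterm & wterm
| FNot of formula
| FAnd of formula & formula
| FOr of formula & formula
| FExV of nat & formula
| FAllV of nat & formula
| FExS of nat & formula
| FAllS of nat & formula.

Fixpoint has_cmp (phi : formula) : bool :=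
  match phi with
  | FCmp _ _ _ => true
  | FMem _ _ | FEq _ _ | FAdj _ _ | FColor _ _ | FCard _ _ _ => false
  | FNot f | FExV _ f | FAllV _ f | FExS _ f | FAllS _ f => has_cmp f
  | FAnd f g | FOr f g => has_cmp f || has_cmp g
  end.

(* No negation is applied to a subformula containing a weight comparison. *)
Fixpoint neg_normal (phi : formula) : bool :=
  match phi with
  | FNot f => ~~ has_cmp f
  | FMem _ _ | FEq _ _ | FAdj _ _ | FColor _ _ | FCard _ _ _ | FCmp _ _ _ =>
      true
  | FExV _ f | FAllV _ f | FExS _ f | FAllS _ f => neg_normal f
  | FAnd f g | FOr f g => neg_normal f && neg_normal g
  end.

Fixpoint is_mso (phi : formula) : bool :=
  match phi with
  | FMem _ _ | FEq _ _ | FAdj _ _ | FColor _ _ => true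
  | FCard _ _ _ | FCmp _ _ _ => false
  | FNot f | FExV _ f | FAllV _ f | FExS _ f | FAllS _ f => is_mso f
  | FAnd f g | FOr f g => is_mso f && is_mso g
  end.

(* Well-formedness over [nc] colours and [nw] weights, all free variables being
   among the vertex variables [ve] and the set variables [vs]. *)
Definition wf_term (nw : nat) (vs : seq nat) (t : wterm) : bool :=
  all (fun m : R * option nat * nat =>
         (if m.1.2 is Some i then i < nw else true) && (m.2 \in vs)) (wt_sum t).

Fixpoint wf_formula (nc nw : nat) (ve vs : seq nat) (phi : formula) : bool :=
  match phi with
  | FMem x X => (x \in ve) && (X \in vs)
  | FEq x y | FAdj x y => (x \in ve) && (y \in ve)
  | FColor c x => (c < nc) && (x \in ve)
  | FCard _ r X => (0 < r) && (X \in vs)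
  | FCmp _ t t' => wf_term nw vs t && wf_term nw vs t'
  | FNot f => wf_formula nc nw ve vs f
  | FAnd f g | FOr f g => wf_formula nc nw ve vs f && wf_formula nc nw ve vs g
  | FExV x f | FAllV x f => wf_formula nc nw (x :: ve) vs f
  | FExS X f | FAllS X f => wf_formula nc nw ve (X :: vs) f
  end.

(* Number of symbols: a variable, a coefficient, a relation, colour or weight
   symbol, a connective and a quantifier count as one symbol each. *)
Definition term_symbols (t : wterm) : nat := 1 + 4 * size (wt_sum t).

Fixpoint symbols (phi : formula) : nat :=
  match phi with
  | FMem _ _ | FEq _ _ | FAdj _ _ => 3
  | FColor _ _ => 2
  | FCard _ _ _ => 4
  | FCmp _ t t' => 1 + term_symbols t + term_symbols t'
  | FNot f => 1 + symbols f
  | FAnd f g | FOr f g => 1 + symbols f + symbols g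
  | FExV _ f | FAllV _ f | FExS _ f | FAllS _ f => 2 + symbols f
  end.

Definition override (T : Type) (e : nat -> T) (x : nat) (v : T) : nat -> T :=
  fun y => if y == x then v else e y.

Section Semantics.

Variable G : cgraph.

Definition weight (w : option nat) (v : vertex G) : nat :=
  if w is Some i then nth [ffun=> 0] (gweights G) i v else 1.

Definition set_weight (w : option nat) (A : {set vertex G}) : nat :=
  \sum_(v in A) weight w v.

Definition tval (es : nat -> {set vertex G}) (t : wterm) : R :=
  (wt_const t + \sum_(m <- wt_sum t) m.1.1 * (set_weight m.1.2 (es m.2))%:R)%R.

Definition cmp_val (c : comparison) (x y : R) : bool :=
  match c with
  | Le => (x <= y)%R
  | Lt => (x < y)%R
  | Ge => (x >= y)%R
  | Gt => (x > y)%R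
  end.

Fixpoint sat (ev : nat -> vertex G) (es : nat -> {set vertex G})
    (phi : formula) : bool :=
  match phi with
  | FMem x X => ev x \in es X
  | FEq x y => ev x == ev y
  | FAdj x y => gadj G (ev x) (ev y)
  | FColor c x => ev x \in nth set0 (gcolors G) c
  | FCard a r X => #|es X| == a %[mod r]
  | FCmp c t t' => cmp_val c (tval es t) (tval es t')
  | FNot f => ~~ sat ev es f
  | FAnd f g => sat ev es f && sat ev es g
  | FOr f g => sat ev es f || sat ev es g
  | FExV x f => [exists v, sat (override ev x v) es f]
  | FAllV x f => [forall v, sat (override ev x v) es f]
  | FExS X f => [exists A, sat ev (override es X A) f]
  | FAllS X f => [forall A, sat ev (override es X A) f]
  end.

(* The free variables of a query with [k] free set variables are the set
   variables [0, ..., k - 1]; it has no free vertex variable, and the values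
   given here to the variables that are not free are irrelevant. *)
Definition assign (k : nat) (W : k.-tuple {set vertex G}) :
    nat -> {set vertex G} := nth set0 W.

Definition models (k : nat) (phi : formula) (W : k.-tuple {set vertex G}) :
    bool := sat (fun=> ord0) (assign W) phi.

End Semantics.

Definition scale (a : R) (t : wterm) : wterm :=
  WTerm (a * wt_const t)%R
        [seq ((a * m.1.1)%R, m.1.2, m.2) | m <- wt_sum t].

Fixpoint map_cmp (F : comparison -> wterm -> wterm -> formula)
    (phi : formula) : formula :=
  match phi with
  | FCmp c t t' => F c t t'
  | FMem _ _ | FEq _ _ | FAdj _ _ | FColor _ _ | FCard _ _ _ => phi
  | FNot f => FNot (map_cmp F f)
  | FAnd f g => FAnd (map_cmp F f) (map_cmp F g)
  | FOr f g => FOr (map_cmp F f) (map_cmp F g)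
  | FExV x f => FExV x (map_cmp F f)
  | FAllV x f => FAllV x (map_cmp F f)
  | FExS X f => FExS X (map_cmp F f)
  | FAllS X f => FAllS X (map_cmp F f)
  end.

Definition loosen (alpha : R) : formula -> formula :=
  map_cmp (fun c t t' =>
    match c with
    | Le | Lt => FCmp c (scale alpha^-1 t) (scale alpha t')
    | Ge | Gt => FCmp c (scale alpha t) (scale alpha^-1 t')
    end).

Definition tighten (alpha : R) : formula -> formula :=
  map_cmp (fun c t t' =>
    match c with
    | Le | Lt => FCmp c (scale alpha t) (scale alpha^-1 t')
    | Ge | Gt => FCmp c (scale alpha^-1 t) (scale alpha t')
    end).

(* [None] stands for minus infinity. *)
Definition ole (x y : option R) : bool :=
  match x, y with
  | None, _ => true
  | Some _, None => false
  | Some a, Some b => (a <= b)%R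
  end.

Definition omax (x y : option R) : option R := if ole x y then y else x.

Definition opt_max (G : cgraph) (k : nat) (phi : formula) (t : wterm) :
    option R :=
  \big[omax/None]_(W : k.-tuple {set vertex G} | models phi W)
    Some (tval (assign W) t).

Definition oversatisfy (G : cgraph) (k : nat) (phi : formula) (t : wterm)
  (alpha : R) := opt_max G k (tighten alpha phi) t.

Definition undersatisfy (G : cgraph) (k : nat) (phi : formula) (t : wterm)
  (alpha : R) := opt_max G k (loosen alpha phi) t.

(* A value in N together with a witness, or minus infinity. *)
Definition bound (G : cgraph) (k : nat) :=
  option (nat * k.-tuple {set vertex G}).

Definition bound_val (G : cgraph) (k : nat) (m : bound G k) : option R :=
  omap (fun p => p.1%:R%R) m.

Definition bound_wit (G : cgraph) (k : nat) (phi : formula) (t : wterm)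
    (m : bound G k) : bool :=
  if m is Some (v, W) then models phi W && (tval (assign W) t == v%:R)%R
  else true.

Definition approx_answer (G : cgraph) (k : nat) (phi : formula) (t : wterm)
    (alpha : R) (a : bound G k * bound G k) : Prop :=
  let: (lo, hi) := a in
  [/\ ole (oversatisfy G k phi t alpha) (bound_val lo),
      ole (bound_val lo) (opt_max G k phi t),
      ole (opt_max G k phi t) (bound_val hi),
      ole (bound_val hi) (undersatisfy G k phi t alpha)
    & bound_wit phi t lo /\ bound_wit (loosen alpha phi) t hi].

Definition tcard (X : nat) : wterm := WTerm 0%R [:: (1%R, None, X)].

(* With X, Y1, Y2 the set variables 0, 1, 2:
   forall Y1, forall Y2,
     |Y1| > |Y2| * alpha^2 \/ |Y2| > |Y1| * alpha^2 \/ psi(X, Y1, Y2). *)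
Definition hard_form (alpha : R) (psi : formula) : formula :=
  FAllS 1 (FAllS 2
    (FOr (FCmp Gt (tcard 1) (scale (alpha ^+ 2)%R (tcard 2)))
    (FOr (FCmp Gt (tcard 2) (scale (alpha ^+ 2)%R (tcard 1)))
         psi))).

End Logic.

(* Coefficients in inputs are rational, so that they have a finite
    representation. *)

Definition enc_term (t : wterm rat) : seq bool :=
  enc_rat (wt_const t) ++
  enc_seq (fun m : rat * option nat * nat =>
             enc_rat m.1.1 ++ enc_opt enc_unary m.1.2 ++ enc_unary m.2)
          (wt_sum t).

Definition enc_comparison (c : comparison) : seq bool :=
  enc_unary (match c with Le => 0 | Lt => 1 | Ge => 2 | Gt => 3 end).

Fixpoint enc_formula (phi : formula rat) : seq bool :=
  match phi with
  | FMem x X => enc_unary 0 ++ enc_unary x ++ enc_unary X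
  | FEq x y => enc_unary 1 ++ enc_unary x ++ enc_unary y
  | FAdj x y => enc_unary 2 ++ enc_unary x ++ enc_unary y
  | FColor c x => enc_unary 3 ++ enc_unary c ++ enc_unary x
  | FCard a r X => enc_unary 4 ++ enc_nat a ++ enc_nat r ++ enc_unary X
  | FCmp c t t' =>
      enc_unary 5 ++ enc_comparison c ++ enc_term t ++ enc_term t'
  | FNot f => enc_unary 6 ++ enc_formula f
  | FAnd f g => enc_unary 7 ++ enc_formula f ++ enc_formula g
  | FOr f g => enc_unary 8 ++ enc_formula f ++ enc_formula g
  | FExV x f => enc_unary 9 ++ enc_unary x ++ enc_formula f
  | FAllV x f => enc_unary 10 ++ enc_unary x ++ enc_formula f
  | FExS X f => enc_unary 11 ++ enc_unary X ++ enc_formula f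
  | FAllS X f => enc_unary 12 ++ enc_unary X ++ enc_formula f
  end.

Definition enc_bound (G : cgraph) (k : nat) : bound G k -> seq bool :=
  enc_opt (fun p : nat * k.-tuple {set vertex G} =>
             enc_nat p.1 ++ flatten [seq enc_set A | A <- p.2]).

(* A vertex-coloured path, without weights other than the constant 1, and a
   formula phi(X) whose only free variable is the set variable 0. *)
Record path_instance (P : formula rat -> Prop) := PathInstance {
  inst_graph : cgraph;
  inst_formula : formula rat;
  inst_path : is_path inst_graph;
  inst_unweighted : gweights inst_graph = [::];
  inst_wf : wf_formula (size (gcolors inst_graph)) 0 [::] [:: 0] inst_formula;
  inst_nnf : neg_normal inst_formula;
  inst_class : P inst_formula
}.

(* Given a path and a formula phi(X) in the class [P], compute an
   alpha-approximate answer to the query (phi(X), 0). *)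
Definition approx_path_query (alpha : nat) (P : formula rat -> Prop) :
    sproblem :=
  @SProblem (path_instance P)
    (fun i => enc_graph (inst_graph i) ++ enc_formula (inst_formula i))
    (fun i => symbols (inst_formula i))
    (fun i s =>
       exists2 a : bound (inst_graph i) 1 * bound (inst_graph i) 1,
         s = enc_bound a.1 ++ enc_bound a.2
       & approx_answer (inst_formula i) (WTerm 0%R [::]) alpha%:R%R a).

(* Main.v *)
(* A circuit of bounded depth is unfolded into a tree of polynomial size; its
   weft plays no role.  The k true inputs become k variables x_1, ..., x_k over
   {0, ..., n - 1}; that they are distinct and accepted by the circuit becomes a
   tree over the bits of the x_i.  The tree is written on a path, with separators
   marking its levels, so that an MSO formula of constant size
   evaluates it once X tells the values of the leaves.  An occurrence of bit p
   of x_i is a segment of length beta^p with beta > alpha^4, which is polynomial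
   because p is at most log n.  The formula must ensure that X gives the same
   value to all the occurrences of a bit: two segments of the same x_i whose
   lengths differ by a factor of at most alpha^4 carry the same bit, so this is
   a condition on all the pairs Y1, Y2 of approximately the same size.  As the
   lengths are powers of beta, the factor may be anything from 1 to alpha^4, and
   the tightened and the loosened formulas are equivalent to the original one. *)

Require Import Defs.
From mathcomp Require Import all_boot all_order all_algebra all_fingroup zify.
From Stdlib Require Import FunctionalExtensionality.

Set Implicit Arguments.
Unset Strict Implicit.
Unset Printing Implicit Defensive.

(** * Polynomial bounds and running times *)

(** The index [p] of a bit takes about $\log n$ values, too many to be named by colours in a formula
    whose size may depend on [k] only. Hence the length of a segment carries [p], and comparing
    sizes of sets is exactly what the two weight comparisons offer. The index [i] of a variable is a
    colour; the list of these [k] colours is the only part of the formula that is not constant,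
    because the height of the tree is fixed by the depth of the circuits. Since the target is the
    constant 0, an approximate answer only records satisfiability, and the bit telling whether
    $\max^-$ is finite decides the circuit after a single query. The reduction has to be an explicit
    program with a proved running time. Its instance generator is therefore obtained by closing the
    polynomial-time functions between coded types under composition, pairing, case analysis, lists
    and bounded iteration. Numbers are unary there, which is affordable as all the lengths are
    polynomial in [n]. *)

Lemma leq_expn m n e : m <= n -> m ^ e <= n ^ e.
Proof. by case: e => [|e] mn //; rewrite leq_exp2r. Qed.

(** The base is at least 2 even at [n = 0], so that constants and sums are absorbed by a larger
    exponent. *)
Definition pbound (f : nat -> nat) : Prop := exists c, forall n, f n <= n.+2 ^ c.

Lemma pbound_le f g : (forall n, f n <= g n) -> pbound g -> pbound f.
Proof. by move=> fg [c gc]; exists c => n; apply: leq_trans (fg n) (gc n). Qed.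

Lemma pbound_const a : pbound (fun=> a).
Proof.
exists a => n; apply: leq_trans (ltnW (ltn_expl a (ltnSn 1))) _.
exact: leq_expn.
Qed.

Lemma pbound_id : pbound id.
Proof. by exists 1 => n; rewrite expn1; lia. Qed.

Lemma pbound_exp c : pbound (fun n => n.+2 ^ c).
Proof. by exists c. Qed.

Lemma pbound_mul f g : pbound f -> pbound g -> pbound (fun n => f n * g n).
Proof. by move=> [a fa] [b gb]; exists (a + b) => n; rewrite expnD leq_mul. Qed.

Lemma pbound_add f g : pbound f -> pbound g -> pbound (fun n => f n + g n).
Proof.
move=> [a fa] [b gb]; exists (maxn a b).+1 => n.
have ha : n.+2 ^ a <= n.+2 ^ maxn a b by rewrite leq_exp2l // leq_maxl.
have hb : n.+2 ^ b <= n.+2 ^ maxn a b by rewrite leq_exp2l // leq_maxr.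
move: (fa n) (gb n); rewrite expnS; nia.
Qed.

Lemma pbound_succ f : pbound f -> pbound (fun n => (f n).+1).
Proof.
move=> hf; apply: pbound_le (pbound_add (pbound_const 1) hf) => n.
by rewrite add1n.
Qed.

Lemma pbound_pow f c : pbound f -> pbound (fun n => f n ^ c).
Proof.
by move=> [a fa]; exists (a * c) => n; rewrite expnM leq_expn.
Qed.

Ltac pbound_tac :=
  repeat first [ apply: pbound_const | apply: pbound_id | apply: pbound_exp
               | apply: pbound_add | apply: pbound_mul | apply: pbound_succ
               | apply: pbound_pow | assumption ].

Definition within (n : nat) (p : cmd) (s s' : state) : Prop :=
  exists2 t, t <= n & run p s s' t.

Lemma within_le m n p s s' : m <= n -> within m p s s' -> within n p s s'.
Proof. by move=> mn [t tm r]; exists t => //; apply: leq_trans mn. Qed.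

Lemma within_eq n p s s1 s2 : within n p s s1 -> s1 = s2 -> within n p s s2.
Proof. by move=> h <-. Qed.

Lemma within_skip s : within 1 Skip s s.
Proof. by exists 1 => //; apply: exec_skip. Qed.

Lemma within_push r b s : within 1 (Push r b) s (upd s r (b :: s r)).
Proof. by exists 1 => //; apply: exec_push. Qed.

Lemma within_pop r s : within 1 (Pop r) s (upd s r (behead (s r))).
Proof. by exists 1 => //; apply: exec_pop. Qed.

Lemma within_seq m n p q s s1 s2 :
  within m p s s1 -> within n q s1 s2 -> within (m + n) (Seq p q) s s2.
Proof.
move=> [t tm r1] [t' tn r2]; exists (t + t'); first exact: leq_add.
exact: (exec_seq r1 r2).
Qed.

Lemma within_case n r p0 pF pT s s' :
  within n (match s r with
            | [::] => p0 | false :: _ => pF | true :: _ => pT end) s s' ->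
  within n.+1 (Case r p0 pF pT) s s'.
Proof. by move=> [t tn h]; exists t.+1 => //; apply: exec_case. Qed.

(** [S j] is the state after [j] turns: a loop is verified by exhibiting its whole trajectory. Each
    turn costs one step more than its body, and the final test one step. *)
Lemma within_loop r p k n (S : nat -> state) :
  (forall j, j < k -> S j r <> [::] /\ within n p (S j) (S j.+1)) ->
  S k r = [::] -> within (k * n.+1).+1 (While r p) (S 0) (S k).
Proof.
elim: k S => [|k IH] S hS hk.
  by exists 1 => //; apply: exec_while_stop.
have [h0 [t tn h]] := hS 0 isT.
have [t' tn' h'] := IH (fun j => S j.+1) (fun j jk => hS j.+1 jk) hk.
exists (t + t').+1; first by rewrite mulSn; lia.
exact: (exec_while_loop h0 h h').
Qed.

Lemma upd_eq s r v : upd s r v r = v.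
Proof. by rewrite /upd eqxx. Qed.

Ltac upd_tac := rewrite /= /upd; repeat (case: eqP => ? //=); subst; try lia; eauto.

Definition move_stack (r1 r2 : nat) : cmd :=
  While r1 (Case r1 Skip (Seq (Pop r1) (Push r2 false))
                         (Seq (Pop r1) (Push r2 true))).

Lemma move_stackP r1 r2 s : r1 != r2 ->
  within (size (s r1) * 4).+1 (move_stack r1 r2) s
    (upd (upd s r1 [::]) r2 (rev (s r1) ++ s r2)).
Proof.
move=> /eqP ne; set x := s r1.
pose S j := upd (upd s r1 (drop j x)) r2 (rev (take j x) ++ s r2).
have -> : upd (upd s r1 [::]) r2 (rev x ++ s r2) = S (size x).
  by rewrite /S drop_size take_size.
have {1}-> : s = S 0.
  by apply: functional_extensionality => r; rewrite /S drop0 take0; upd_tac.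
apply: within_loop => [j jx|]; last by rewrite /S drop_size; upd_tac.
have Sj : S j r1 = nth false x j :: drop j.+1 x.
  by rewrite /S -drop_nth //; upd_tac.
split; first by rewrite Sj.
apply: within_case; rewrite Sj.
have -> : S j.+1 = upd (upd (S j) r1 (behead (S j r1))) r2
                       (nth false x j :: (upd (S j) r1 (behead (S j r1))) r2).
  apply: functional_extensionality => r; rewrite Sj /S /=.
  by rewrite (take_nth false) // rev_rcons; upd_tac.
by case: (nth false x j); apply: (within_seq (within_pop _ _) (within_push _ _ _)).
Qed.

(** The source is consumed and both copies are reversed; moving one of them back restores the
    source. *)
Definition copy_stack (r1 r2 r3 : nat) : cmd :=
  While r1 (Case r1 Skip
    (Seq (Pop r1) (Seq (Push r2 false) (Push r3 false)))
    (Seq (Pop r1) (Seq (Push r2 true) (Push r3 true)))).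

Lemma copy_stackP r1 r2 r3 s : r1 != r2 -> r1 != r3 -> r2 != r3 ->
  within (size (s r1) * 5).+1 (copy_stack r1 r2 r3) s
    (upd (upd (upd s r1 [::]) r2 (rev (s r1) ++ s r2)) r3 (rev (s r1) ++ s r3)).
Proof.
move=> /eqP ne /eqP ne' /eqP ne''; set x := s r1.
pose S j := upd (upd (upd s r1 (drop j x)) r2 (rev (take j x) ++ s r2)) r3
  (rev (take j x) ++ s r3).
have -> : upd (upd (upd s r1 [::]) r2 (rev x ++ s r2)) r3 (rev x ++ s r3) =
  S (size x) by rewrite /S drop_size take_size.
have {1}-> : s = S 0.
  by apply: functional_extensionality => r; rewrite /S drop0 take0; upd_tac.
apply: within_loop => [j jx|]; last by rewrite /S drop_size; upd_tac.
have Sj : S j r1 = nth false x j :: drop j.+1 x.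
  by rewrite /S -drop_nth //; upd_tac.
split; first by rewrite Sj.
apply: within_case; rewrite Sj.
case e : (nth false x j);
  (apply: within_eq; [apply: (within_seq (within_pop _ _));
     apply: (within_seq (within_push _ _ _) (within_push _ _ _))|]);
  apply: functional_extensionality => r; rewrite Sj /S (take_nth false) //;
  rewrite rev_rcons e; upd_tac.
Qed.

Definition clear_stack (r : nat) : cmd := While r (Pop r).

Lemma clear_stackP r s :
  within (size (s r) * 2).+1 (clear_stack r) s (upd s r [::]).
Proof.
set x := s r; pose S j := upd s r (drop j x).
have -> : upd s r [::] = S (size x) by rewrite /S drop_size.
have {1}-> : s = S 0.
  by apply: functional_extensionality => r'; rewrite /S drop0; upd_tac.
apply: within_loop => [j jx|]; last by rewrite /S drop_size upd_eq.
have Sj : S j r = nth false x j :: drop j.+1 x by rewrite /S -drop_nth // upd_eq.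
split; first by rewrite Sj.
apply: within_eq (within_pop _ _) _; rewrite Sj.
by apply: functional_extensionality => r'; rewrite /S; upd_tac.
Qed.

Lemma within_step m n p q s s1 s2 s3 :
  within m p s s1 -> s1 = s2 -> within n q s2 s3 ->
  within (m + n) (Seq p q) s s3.
Proof. by move=> h <-; apply: within_seq. Qed.

Lemma move_stackE r1 r2 s x y : r1 != r2 -> s r1 = x -> s r2 = y ->
  within (size x * 4).+1 (move_stack r1 r2) s
    (upd (upd s r1 [::]) r2 (rev x ++ y)).
Proof. by move=> ne <- <-; apply: move_stackP. Qed.

Lemma copy_stackE r1 r2 r3 s x y z : r1 != r2 -> r1 != r3 -> r2 != r3 ->
  s r1 = x -> s r2 = y -> s r3 = z ->
  within (size x * 5).+1 (copy_stack r1 r2 r3) s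
    (upd (upd (upd s r1 [::]) r2 (rev x ++ y)) r3 (rev x ++ z)).
Proof. by move=> ne1 ne2 ne3 <- <- <-; apply: copy_stackP. Qed.

Lemma clear_stackE r s x : s r = x ->
  within (size x * 2).+1 (clear_stack r) s (upd s r [::]).
Proof. by move=> <-; apply: clear_stackP. Qed.

(** * Codes of data types *)

Ltac state_tac := apply: functional_extensionality => ?; upd_tac.

(* Moves a unary number from stack 0 to stack 1, counting it on stack [c];
   stack [f] is a flag. *)
Definition move_unary (f c : nat) : cmd :=
  Seq (Push f true) (While f
    (Case 0 (Pop f)
       (Seq (Pop 0) (Seq (Push 1 false) (Pop f)))
       (Seq (Pop 0) (Seq (Push 1 true) (Push c true))))).

Lemma enc_unary_cat n s : enc_unary n ++ s = nseq n true ++ false :: s.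
Proof. by rewrite /enc_unary cat_rcons. Qed.

Lemma size_enc_unary n : size (enc_unary n) = n.+1.
Proof. by rewrite /enc_unary size_rcons size_nseq. Qed.

Lemma rev_enc_unary n : rev (enc_unary n) = false :: nseq n true.
Proof. by rewrite /enc_unary rev_rcons rev_nseq. Qed.

Lemma move_unaryP f c n rest s :
  1 < f -> 1 < c -> f != c -> s f = [::] -> s 0 = enc_unary n ++ rest ->
  within (n * 5 + 10) (move_unary f c) s
    (upd (upd (upd s 0 rest) 1 (rev (enc_unary n) ++ s 1)) c
         (nseq n true ++ s c)).
Proof.
move=> hf hc /eqP ne sf; rewrite enc_unary_cat rev_enc_unary => s0.
(* Stack 0 does not become empty at the end of the number, so the flag drives the loop. The last of
   the [n.+1] turns moves the final [false] and lowers the flag. *)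
pose S j := if j <= n then
    upd (upd (upd (upd s 0 (nseq (n - j) true ++ false :: rest)) 1
      (nseq j true ++ s 1)) c (nseq j true ++ s c)) f [:: true]
  else upd (upd (upd s 0 rest) 1 (false :: nseq n true ++ s 1)) c
         (nseq n true ++ s c).
have -> : upd (upd (upd s 0 rest) 1 ((false :: nseq n true) ++ s 1)) c
  (nseq n true ++ s c) = S n.+1 by rewrite /S ltnn.
apply: within_le (within_seq (within_push _ _ _) _); last first.
  have -> : upd s f (true :: s f) = S 0.
    by rewrite /S /= subn0 sf -s0; state_tac.
  apply: (@within_loop f _ n.+1 4) => [j jn|]; last first.
    by rewrite /S ltnn; upd_tac.
  have Sf : S j f = [:: true] by rewrite /S -ltnS jn; upd_tac.
  split; first by rewrite Sf.
  apply: within_case; have [jn'|jn'] := ltnP j n.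
    have S0 : S j 0 = true :: nseq (n - j.+1) true ++ false :: rest.
      by rewrite /S ltnW // -[n - j]prednK ?subn_gt0 //= -subnS; upd_tac.
    rewrite S0; apply: within_eq.
      apply: (within_seq (within_pop _ _)).
      by apply: (within_seq (within_push _ _ _) (within_push _ _ _)).
    apply: functional_extensionality => r; rewrite S0 /S jn' ltnW //=; upd_tac.
  have ej : j = n by lia.
  rewrite {}ej {jn jn' j} in Sf *.
  have S0 : S n 0 = false :: rest by rewrite /S leqnn subnn; upd_tac.
  rewrite S0; apply: within_eq.
    apply: (within_seq (within_pop _ _)).
    by apply: (within_seq (within_push _ _ _) (within_pop _ _)).
  by apply: functional_extensionality => r; rewrite S0 /S ltnn leqnn /=; upd_tac.
by lia.
Qed.

(* Codes are prefixes: the code of a value can be moved from stack 0 to stack 1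
   whatever follows it. *)
Definition movable (A : Type) (enc : A -> seq bool) : Prop :=
  exists p m c, forall (s : state) a rest,
    s 0 = enc a ++ rest -> (forall r, 1 < r < m -> s r = [::]) ->
    within ((size (enc a)).+2 ^ c) p s
      (upd (upd s 0 rest) 1 (rev (enc a) ++ s 1)).

(** Canonical instances let the code follow from the type, so that closure properties speak of plain
    functions. *)
Structure codeType := CodeType {
  code_sort :> Type;
  encode : code_sort -> seq bool;
  encode_movable : movable encode
}.
Arguments encode {c} x : simpl never.
Arguments CodeType {code_sort encode} encode_movable.

Lemma movableI (A : Type) (enc : A -> seq bool) T p m : pbound T ->
  (forall (s : state) a rest,
    s 0 = enc a ++ rest -> (forall r, 1 < r < m -> s r = [::]) ->
    within (T (size (enc a))) p s
      (upd (upd s 0 rest) 1 (rev (enc a) ++ s 1))) -> movable enc.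
Proof.
move=> [c hc] h; exists p, m, c => s a rest h0 h1.
exact: within_le (hc _) (h _ _ _ h0 h1).
Qed.

Lemma movable_unary : movable enc_unary.
Proof.
apply: (@movableI _ _ (fun n => n * 7 + 11) (Seq (move_unary 2 3) (clear_stack 3)) 4).
  by pbound_tac.
move=> s n rest s0 hs.
apply: within_le; last first.
  apply: within_eq.
    apply: (within_seq (move_unaryP _ _ _ _ s0)) => //; first exact: hs.
    exact: clear_stackP.
  state_tac; by rewrite hs.
by rewrite /= upd_eq size_cat size_nseq (hs 3) //= size_enc_unary; lia.
Qed.
Canonical nat_codeType := CodeType movable_unary.

Definition enc_unit (u : unit) : seq bool := [::].
Lemma movable_unit : movable enc_unit.
Proof.
apply: (@movableI _ _ (fun n => 1) Skip 0); first by pbound_tac.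
move=> s [] rest s0 _; apply: within_eq (within_skip _) _; state_tac.
Qed.
Canonical unit_codeType := CodeType movable_unit.

Definition enc_bool (b : bool) : seq bool := [:: b].
Lemma movable_bool : movable enc_bool.
Proof.
apply: (@movableI _ _ (fun n => 3) (Case 0 Skip (Seq (Pop 0) (Push 1 false))
  (Seq (Pop 0) (Push 1 true))) 0); first by pbound_tac.
move=> s b rest s0 _; apply: within_case; rewrite s0 /=.
case: b s0 => s0;
  apply: within_eq (within_seq (within_pop _ _) (within_push _ _ _)) _;
  rewrite s0; state_tac.
Qed.
Canonical bool_codeType := CodeType movable_bool.

Lemma within_movable (A : codeType) : exists p m c, forall (s : state) (a : A) rest,
    s 0 = encode a ++ rest -> (forall r, 1 < r < m -> s r = [::]) ->
    within ((size (encode a)).+2 ^ c) p s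
      (upd (upd s 0 rest) 1 (rev (encode a) ++ s 1)).
Proof. exact: encode_movable. Qed.

Definition enc_prod (A B : codeType) (x : A * B) : seq bool :=
  encode x.1 ++ encode x.2.
Lemma movable_prod (A B : codeType) : movable (@enc_prod A B).
Proof.
have [p [m [c hp]]] := within_movable A.
have [q [m' [c' hq]]] := within_movable B.
apply: (@movableI _ _ (fun n => n.+2 ^ c + n.+2 ^ c') (Seq p q) (maxn m m')).
  by pbound_tac.
move=> s [a b] rest; rewrite /enc_prod /= -catA => s0 hs.
apply: within_le; last first.
  apply: within_eq.
    apply: (within_seq (hp _ _ _ s0 _)) => [r hr|]; first by apply: hs; lia.
    apply: (hq _ b rest) => [|r hr]; first by upd_tac.
    by upd_tac; apply: hs; lia.
  state_tac; by rewrite rev_cat catA.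
by apply: leq_add; apply: leq_expn; rewrite size_cat; lia.
Qed.
Canonical prod_codeType (A B : codeType) := CodeType (@movable_prod A B).

Definition enc_sum (A B : codeType) (x : A + B) : seq bool :=
  match x with inl a => false :: encode a | inr b => true :: encode b end.
Lemma movable_sum (A B : codeType) : movable (@enc_sum A B).
Proof.
have [p [m [c hp]]] := within_movable A.
have [q [m' [c' hq]]] := within_movable B.
apply: (@movableI _ _ (fun n => n.+2 ^ c + n.+2 ^ c' + 4)
  (Case 0 Skip (Seq (Pop 0) (Seq (Push 1 false) p))
               (Seq (Pop 0) (Seq (Push 1 true) q))) (maxn m m')).
  by pbound_tac.
move=> s [a|b] rest; rewrite /= => s0 hs.
- apply: within_le; last first.
    apply: within_case; rewrite s0; apply: within_eq.
      apply: (within_seq (within_pop _ _) (within_seq (within_push _ _ _) _)).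
      apply: (hp _ a rest) => [|r hr]; first by rewrite s0; upd_tac.
      by upd_tac; apply: hs; lia.
    by state_tac; rewrite rev_cons cat_rcons.
  have : (size (encode a)).+2 ^ c <= (size (encode a)).+3 ^ c by apply: leq_expn.
  rewrite /=; lia.
- apply: within_le; last first.
    apply: within_case; rewrite s0; apply: within_eq.
      apply: (within_seq (within_pop _ _) (within_seq (within_push _ _ _) _)).
      apply: (hq _ b rest) => [|r hr]; first by rewrite s0; upd_tac.
      by upd_tac; apply: hs; lia.
    by state_tac; rewrite rev_cons cat_rcons.
  have : (size (encode b)).+2 ^ c' <= (size (encode b)).+3 ^ c' by apply: leq_expn.
  rewrite /=; lia.
Qed.
Canonical sum_codeType (A B : codeType) := CodeType (@movable_sum A B).

Lemma size_flatten_drop (A : codeType) (l : seq A) j :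
  size (flatten [seq encode x | x <- drop j l]) <=
  size (flatten [seq encode x | x <- l]).
Proof. by rewrite -{2}[l](cat_take_drop j) map_cat flatten_cat size_cat leq_addl. Qed.

(** The length prefix tells how many elements have to be moved. It is kept as a counter on stack
    [m.+2], above the scratch stacks of the element mover, which leaves it intact. *)
Lemma movable_seq (A : codeType) : movable (@enc_seq A encode).
Proof.
have [p [m [c hp]]] := within_movable A.
apply: (@movableI _ _ (fun n => (n * 5 + 10) + (n * (n.+2 ^ c).+2 ).+1)
  (Seq (move_unary m.+3 m.+2) (While m.+2 (Seq (Pop m.+2) p))) m.+4).
  by pbound_tac.
move=> s l rest; rewrite /enc_seq -catA => s0 hs.
set F := fun l : seq A => flatten [seq encode x | x <- l].
set n := size l; set N := size _.
have hF j : size (F (drop j l)) <= N.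
  rewrite /N size_cat; apply: leq_trans (size_flatten_drop _ _) _.
  by rewrite leq_addl.
have nN : n < N by rewrite /N size_cat size_enc_unary; lia.
pose s1 := upd (upd s 0 (F l ++ rest)) 1 (rev (enc_unary n) ++ s 1).
pose S j := upd (upd (upd s1 0 (F (drop j l) ++ rest)) 1
  (rev (F (take j l)) ++ s1 1)) m.+2 (nseq (n - j) true).
apply: within_le; last first.
  apply: within_eq.
    apply: (within_seq (move_unaryP _ _ _ _ s0)) => //.
    - by apply/eqP; lia.
    - by rewrite hs //; lia.
    have -> : upd (upd (upd s 0 (F l ++ rest)) 1 (rev (enc_unary (size l)) ++ s 1)) m.+2
     (nseq (size l) true ++ s m.+2) = S 0.
      rewrite (hs m.+2); last by lia.
      rewrite cats0 /S drop0 take0 subn0 /s1; state_tac.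
    apply: (@within_loop m.+2 _ n (N.+2 ^ c).+1) => [j jn|]; last first.
      by rewrite /S subnn upd_eq.
    have Sj : S j m.+2 = true :: nseq (n - j.+1) true.
      by rewrite /S upd_eq -[n - j]prednK ?subn_gt0 // -subnS.
    split; first by rewrite Sj.
    case el : (drop j l) => [|x r].
      by move: (size_drop j l); rewrite el /= -/n; lia.
    have er : r = drop j.+1 l by rewrite -add1n -drop_drop el /= drop0.
    have et : take j.+1 l = rcons (take j l) x.
      rewrite -{1}[l](cat_take_drop j) el take_cat size_takel ?(ltnW jn) //.
      by rewrite ltnNge leqnSn /= subSnn /= take0 cats1.
    apply: within_eq.
      apply: within_le (within_seq (within_pop _ _) _); last first.
        apply: (hp _ x (F r ++ rest)) => [|i hi].
          rewrite Sj /S el /F /=; upd_tac; by rewrite catA.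
        rewrite Sj /S /s1; upd_tac; apply: hs; lia.
      rewrite -/addn add1n ltnS; apply: leq_expn; rewrite !ltnS.
      apply: leq_trans (hF j); rewrite el /F /= size_cat; exact: leq_addr.
    rewrite /= Sj /S; apply: functional_extensionality => i.
    rewrite et -er /F map_rcons flatten_rcons rev_cat /=; upd_tac.
    by rewrite catA.
  rewrite /S /s1 drop_size take_size subnn; state_tac; try by rewrite hs //; lia.
  by rewrite rev_cat catA.
have hn : n * (N.+2 ^ c).+2 <= N * (N.+2 ^ c).+2 by rewrite leq_mul // ltnW.
rewrite -/n; lia.
Qed.
Canonical seq_codeType (A : codeType) := CodeType (@movable_seq A).

(** * Functions computable in polynomial time *)

(** A step lengthens a stack by at most one bit, as no query is asked. Time bounds thus bound the
    sizes of results. *)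
Lemma run_size p s s' t : run p s s' t ->
  forall r, size (s' r) <= size (s r) + t.
Proof.
rewrite /run; set O := (fun=> _); set qs := [::] => h.
have : qs = [::] by [].
elim: h => {p s s' t qs} //=.
- by move=> *; lia.
- by move=> r b s _ r'; upd_tac => /=; lia.
- by move=> r s _ r'; upd_tac; rewrite ?size_behead; lia.
- move=> p1 p2 s s1 s2 t1 t2 q1 q2 _ IH1 _ IH2.
  by case: q1 q2 IH1 IH2 => // -[] // IH1 IH2 _ r; move: (IH1 erefl r) (IH2 erefl r); lia.
- by move=> r p0 pF pT s s' t qs _ IH e r'; move: (IH e r'); lia.
- by move=> *; lia.
- move=> r p s s1 s2 t1 t2 q1 q2 _ _ IH1 _ IH2.
  by case: q1 q2 IH1 IH2 => // -[] // IH1 IH2 _ r'; move: (IH1 erefl r') (IH2 erefl r'); lia.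
Qed.

(** The scratch stacks below [m] are empty before and after, and all others but stack 0 are
    preserved; programs can be chained, and data kept at [m] or above survive. *)
Definition computes (A B : codeType) m (T : nat -> nat) (p : cmd) (f : A -> B) :=
  forall (s : state) x, s 0 = encode x -> (forall r, 0 < r < m -> s r = [::]) ->
    within (T (size (encode x))) p s (upd s 0 (encode (f x))).

Definition polytime (A B : codeType) (f : A -> B) : Prop :=
  exists p m c, computes m (fun n => n.+2 ^ c) p f.

Lemma polytimeI (A B : codeType) (f : A -> B) m T p :
  pbound T -> computes m T p f -> polytime f.
Proof.
by move=> [c hc] h; exists p, m, c => s x h0 h1; apply: within_le (hc _) (h _ _ h0 h1).
Qed.

Definition input (x : seq bool) : state := fun r => if r == 0 then x else [::].

Lemma polytime_size (A B : codeType) (f : A -> B) : polytime f ->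
  exists c, forall x, size (encode (f x)) <= (size (encode x)).+2 ^ c.
Proof.
move=> [p [m [c h]]]; have [c' hc'] : pbound (fun n => n + n.+2 ^ c) by pbound_tac.
exists c' => x; apply: leq_trans _ (hc' _).
have [||t tc r] := h (input (encode x)) x; first by [].
  by case.
by move: (run_size r 0) tc; rewrite upd_eq /input /=; lia.
Qed.

Lemma eq_polytime (A B : codeType) (f g : A -> B) :
  f =1 g -> polytime f -> polytime g.
Proof. by move=> fg; rewrite (functional_extensionality _ _ fg). Qed.

Lemma polytime_id (A : codeType) : polytime (fun x : A => x).
Proof.
apply: (@polytimeI _ _ _ 0 (fun=> 1) Skip); first by pbound_tac.
by move=> s x s0 _; apply: within_eq (within_skip _) _; state_tac.
Qed.

Lemma polytime_comp (A B C : codeType) (f : A -> B) (g : B -> C) :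
  polytime f -> polytime g -> polytime (fun x => g (f x)).
Proof.
move=> hf [q [m' [c' hq]]]; have [d hd] := polytime_size hf.
case: hf => p [m [c hp]].
apply: (@polytimeI _ _ _ (maxn m m') (fun n => n.+2 ^ c + (n.+2 ^ d).+2 ^ c') (Seq p q)).
  by pbound_tac.
move=> s x s0 hs; apply: within_le; last first.
  apply: within_eq.
    apply: (within_seq (hp _ x s0 _)) => [r hr|]; first by apply: hs; lia.
    by apply: (hq _ (f x)) => [|r hr]; upd_tac; apply: hs; lia.
  state_tac.
by rewrite leq_add2l leq_expn // !ltnS hd.
Qed.

Lemma polytime_pair (A B C : codeType) (f : A -> B) (g : A -> C) :
  polytime f -> polytime g -> polytime (fun x => (f x, g x)).
Proof.
move=> hf; have [d hd] := polytime_size hf; case: hf => p [m [c hp]] [q [m' [c' hq]]].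
(* Above the scratch stacks of both programs: [M.+1] keeps the second copy of the input while [p]
   runs, and [M] keeps [f x] while [q] runs. *)
set M := (maxn m m').+2.
apply: (@polytimeI _ _ _ M.+2
  (fun n => (n * 5).+1 + (n * 4).+1 + n.+2 ^ c + (n.+2 ^ d * 4).+1 +
            (n * 4).+1 + n.+2 ^ c' + (n.+2 ^ d * 4).+1)
  (Seq (copy_stack 0 M M.+1) (Seq (move_stack M 0) (Seq p (Seq (move_stack 0 M)
    (Seq (move_stack M.+1 0) (Seq q (move_stack M 0)))))))).
  by pbound_tac.
move=> s x s0 hs; have [sM sM1] : s M = [::] /\ s M.+1 = [::] by split; apply: hs; lia.
have mM : m <= M by rewrite /M; lia.
have mM' : m' <= M by rewrite /M; lia.
have M0 : 0 < M by [].
clearbody M.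
set X := encode x; set FX := encode (f x).
pose s1 := upd s M.+1 (rev X).
apply: within_le; last first.
  apply: (within_step (copy_stackE _ _ _ s0 sM sM1) erefl); try by apply/eqP; lia.
  apply: (@within_step _ _ _ _ _ _ s1).
  - apply: (@move_stackE M 0 _ (rev X) [::]); upd_tac; by rewrite cats0.
  - rewrite /s1; state_tac; by rewrite ?cats0 ?revK.
  apply: (within_step (hp _ x _ _) erefl) => [|r hr|].
  - by rewrite /s1; upd_tac.
  - by rewrite /s1; upd_tac; apply: hs; lia.
  apply: within_step erefl _.
  - apply: (@move_stackE 0 M _ FX [::]); rewrite /s1; upd_tac.
  apply: (@within_step _ _ _ _ _ _ (upd s M (rev FX))).
  - apply: (@move_stackE _ _ _ (rev X) [::]); rewrite /s1; upd_tac.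
  - rewrite /s1; state_tac; by rewrite ?cats0 ?revK.
  apply: (within_step (hq _ x _ _) erefl) => [|r hr|].
  - by upd_tac.
  - by upd_tac; apply: hs; lia.
  apply: within_eq.
    apply: (@move_stackE _ _ _ (rev FX) (encode (g x))); upd_tac; apply/eqP; lia.
  by state_tac; rewrite revK.
have := hd x; rewrite !size_rev -/X -/FX /=.
set a := size X; move: (a.+2 ^ _) (a.+2 ^ _) (a.+2 ^ _) => *; lia.
Qed.

(* For types with the same codes, such as [nat] and [unit + nat]. *)
Lemma polytime_recode (A B : codeType) (f : A -> B) :
  (forall x, encode (f x) = encode x) -> polytime f.
Proof.
move=> hf; apply: (@polytimeI _ _ _ 0 (fun=> 1) Skip); first by pbound_tac.
move=> s x s0 _; apply: within_eq (within_skip _) _; state_tac.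
by rewrite hf.
Qed.

Lemma polytime_prefix (A B : codeType) (f : A -> B) b :
  (forall x, encode (f x) = b :: encode x) -> polytime f.
Proof.
move=> hf; apply: (@polytimeI _ _ _ 0 (fun=> 1) (Push 0 b)); first by pbound_tac.
move=> s x s0 _; apply: within_eq (within_push _ _ _) _; state_tac.
by rewrite hf s0.
Qed.

Lemma polytime_succn : polytime succn.
Proof. exact: (@polytime_prefix _ _ _ true). Qed.

Definition split_nat (n : nat) : unit + nat :=
  if n is m.+1 then inr m else inl tt.

Lemma polytime_split_nat : polytime split_nat.
Proof. by apply: polytime_recode; case. Qed.

Definition split_bool (b : bool) : unit + unit := if b then inr tt else inl tt.

Lemma polytime_split_bool : polytime split_bool.
Proof. by apply: polytime_recode; case. Qed.

Lemma polytime_const (A B : codeType) (b : B) : polytime (fun _ : A => b).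
Proof.
set w := encode b.
pose p := foldr (fun c q => Seq q (Push 0 c)) (clear_stack 0) w.
apply: (@polytimeI _ _ _ 0 (fun n => (n * 2).+1 + size w) p); first by pbound_tac.
move=> s x s0 _; rewrite -/w /p {p}; elim: w => [|c w IH] /=.
  by rewrite addn0; apply: clear_stackE.
apply: within_le; last first.
  apply: within_eq; first exact: (within_seq IH (within_push _ _ _)).
  by state_tac.
by lia.
Qed.

Lemma polytime_fst (A B : codeType) : polytime (@fst A B).
Proof.
have [p [m [c hp]]] := within_movable A.
apply: (@polytimeI _ _ _ m.+2 (fun n => n.+2 ^ c + (n * 2).+1 + (n * 4).+1)
  (Seq p (Seq (clear_stack 0) (move_stack 1 0)))); first by pbound_tac.
move=> s [a b]; rewrite [encode (a, b)]/(encode a ++ encode b) => s0 hs.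
apply: within_le; last first.
  apply: (within_step (hp _ _ _ s0 _) erefl) => [r hr|]; first by apply: hs; lia.
  apply: (within_step (@clear_stackE _ _ (encode b) _) erefl); first by upd_tac.
  apply: within_eq.
    by apply: (@move_stackE _ _ _ (rev (encode a)) [::]); upd_tac; rewrite hs ?cats0.
  by state_tac; rewrite ?cats0 ?revK ?hs.
rewrite size_rev size_cat; have : (size (encode a)).+2 ^ c <=
  (size (encode a) + size (encode b)).+2 ^ c by apply: leq_expn; lia.
lia.
Qed.

Lemma polytime_snd (A B : codeType) : polytime (@snd A B).
Proof.
have [p [m [c hp]]] := within_movable A.
apply: (@polytimeI _ _ _ m.+2 (fun n => n.+2 ^ c + (n * 2).+1)
  (Seq p (clear_stack 1))); first by pbound_tac.
move=> s [a b]; rewrite [encode (a, b)]/(encode a ++ encode b) => s0 hs.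
apply: within_le; last first.
  apply: (within_step (hp _ _ _ s0 _) erefl) => [r hr|]; first by apply: hs; lia.
  apply: within_eq.
    by apply: (@clear_stackE _ _ (rev (encode a))); upd_tac; rewrite hs ?cats0.
  by state_tac; rewrite hs.
rewrite size_rev size_cat; have : (size (encode a)).+2 ^ c <=
  (size (encode a) + size (encode b)).+2 ^ c by apply: leq_expn; lia.
lia.
Qed.

Lemma encode_pair (A B : codeType) (a : A) (b : B) :
  encode (a, b) = encode a ++ encode b.
Proof. by []. Qed.

Lemma polytime_sum_rect (A B X C : codeType) (f : A * X -> C) (g : B * X -> C) :
  polytime f -> polytime g ->
  polytime (fun p : (A + B) * X => match p.1 with
    | inl a => f (a, p.2) | inr b => g (b, p.2) end).
Proof.
move=> [p [m [c hp]]] [q [m' [c' hq]]].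
apply: (@polytimeI _ _ _ (maxn m m') (fun n => n.+2 ^ c + n.+2 ^ c' + 2)
  (Case 0 Skip (Seq (Pop 0) p) (Seq (Pop 0) q))); first by pbound_tac.
move=> s [[a|b] x] /= s0 hs; rewrite -/(encode _) in s0 *.
- have s0' : s 0 = false :: encode (a, x) by [].
  apply: within_le; last first.
    apply: within_case; rewrite s0'.
    apply: (within_step (within_pop _ _) erefl); apply: within_eq.
      by apply: (hp _ (a, x)) => [|r hr]; rewrite ?s0'; upd_tac; apply: hs; lia.
    by state_tac.
  rewrite !encode_pair; set N := size _; have : N.+2 ^ c <= N.+3 ^ c by apply: leq_expn.
  by move: (N.+2 ^ _) (N.+3 ^ _) (N.+3 ^ _) => *; lia.
- have s0' : s 0 = true :: encode (b, x) by [].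
  apply: within_le; last first.
    apply: within_case; rewrite s0'.
    apply: (within_step (within_pop _ _) erefl); apply: within_eq.
      by apply: (hq _ (b, x)) => [|r hr]; rewrite ?s0'; upd_tac; apply: hs; lia.
    by state_tac.
  rewrite !encode_pair; set N := size _; have : N.+2 ^ c' <= N.+3 ^ c' by apply: leq_expn.
  by move: (N.+2 ^ _) (N.+3 ^ _) (N.+3 ^ _) => *; lia.
Qed.

Definition uncons (A : Type) (s : seq A) : unit + A * seq A :=
  if s is x :: r then inr (x, r) else inl tt.

Lemma encode_seq (A : codeType) (l : seq A) :
  encode l = enc_unary (size l) ++ flatten [seq encode x | x <- l].
Proof. by []. Qed.

(** The code of a list starts with its length, so the new element has to be exchanged with this
    prefix; one more [true] in front then increments the length. *)
Lemma polytime_cons (A : codeType) : polytime (fun p : A * seq A => p.1 :: p.2).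
Proof.
have [p [m [c hp]]] := within_movable A.
set M := m.+4.
apply: (@polytimeI _ _ _ M.+2 (fun n => n.+2 ^ c + (n * 4).+1 + (n * 4).+1 +
    (n * 5 + 10) + (n * 2).+1 + (n * 4).+1 + (n * 4).+1 + 1)
  (Seq p (Seq (move_stack 1 M) (Seq (move_stack M M.+1) (Seq (move_unary 2 3)
    (Seq (clear_stack 3) (Seq (move_stack M.+1 0) (Seq (move_stack 1 0)
      (Push 0 true))))))))); first by pbound_tac.
move=> s [a l]; rewrite encode_pair encode_seq /= => s0 hs.
rewrite encode_seq /=.
set F := flatten _ in s0 *; set n := size l; set U := enc_unary n in s0 *.
have sz : size (encode a ++ U ++ F) = size (encode a) + n.+1 + size F.
  by rewrite !size_cat size_enc_unary addnA.
have Me : M = m.+4 by [].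
have hs' r : 0 < r -> r < m.+4.+2 -> s r = [::] by move=> *; apply: hs; lia.
clearbody M; apply: within_le; last first.
  apply: (within_step (hp _ _ _ s0 _) erefl) => [r hr|]; first by apply: hs; lia.
  apply: (within_step _ erefl).
    apply: (@move_stackE _ _ _ (rev (encode a)) [::]); upd_tac;
      by rewrite ?hs' ?cats0 //; lia.
  apply: (@within_step _ _ _ _ _ _ (upd (upd s 0 (U ++ F)) M.+1 (rev (encode a)))).
  - apply: (@move_stackE _ _ _ (encode a) [::]); upd_tac;
      by rewrite ?revK ?cats0 ?hs' //; lia.
  - by state_tac; rewrite ?cats0 ?hs' //; lia.
  apply: (within_step _ erefl).
    by apply: (@move_unaryP 2 3 n F) => //; upd_tac; rewrite ?hs' //; lia.
  apply: (within_step _ erefl).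
    by apply: (@clear_stackE _ _ (nseq n true)); upd_tac; rewrite ?hs' ?cats0 //; lia.
  apply: (@within_step _ _ _ _ _ _ (upd (upd s 0 (encode a ++ F)) 1 (rev U))).
  - by apply: (@move_stackE _ _ _ (rev (encode a)) F); upd_tac.
  - by state_tac; rewrite ?hs' ?cats0 ?revK //; lia.
  apply: (@within_step _ _ _ _ _ _ (upd s 0 (U ++ encode a ++ F))).
  - by apply: (@move_stackE _ _ _ (rev U) (encode a ++ F)); upd_tac.
  - by state_tac; rewrite ?hs' ?revK //; lia.
  by apply: within_eq (within_push _ _ _) _; state_tac.
rewrite !size_rev !size_nseq sz size_enc_unary.
have : (size (encode a)).+2 ^ c <= (size (encode a) + n.+1 + size F).+2 ^ c.
  by apply: leq_expn; lia.
lia.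
Qed.

(** The first bit of the code tells whether the list is empty and doubles as the tag of the sum. It
    remains to exchange the decremented length with the first element. *)
Lemma polytime_uncons (A : codeType) : polytime (@uncons A).
Proof.
have [p [m [c hp]]] := within_movable A.
set M := m.+4.
apply: (@polytimeI _ _ _ M.+2 (fun n => (1 + ((n * 5 + 10) + ((n * 2).+1 +
   ((n * 4).+1 + ((n * 4).+1 + (n.+2 ^ c + ((n * 4).+1 + ((n * 4).+1 + 1)))))))).+1)
  (Case 0 Skip Skip (Seq (Pop 0) (Seq (move_unary 2 3) (Seq (clear_stack 3)
     (Seq (move_stack 1 M) (Seq (move_stack M M.+1) (Seq p
       (Seq (move_stack M.+1 0) (Seq (move_stack 1 0) (Push 0 true))))))))))).
  by pbound_tac.
move=> s [|a l] s0 hs.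
  apply: within_le; last first.
    apply: within_case; rewrite s0; apply: within_eq (within_skip _) _.
    by state_tac.
  by [].
have {}s0 : s 0 = true :: enc_unary (size l) ++ encode a ++ flatten [seq encode x | x <- l].
  by [].
have -> : encode (uncons (a :: l)) = true :: encode a ++ enc_unary (size l) ++
  flatten [seq encode x | x <- l] by [].
have -> : encode (a :: l) = true :: enc_unary (size l) ++ encode a ++
  flatten [seq encode x | x <- l] by [].
set F := flatten _ in s0 *; set n := size l in s0 *; set U := enc_unary n in s0 *.
have sz : size (true :: U ++ encode a ++ F) = (size (encode a) + n.+1 + size F).+1.
  by rewrite /= !size_cat size_enc_unary; lia.
have Me : M = m.+4 by [].
have hs' r : 0 < r -> r < m.+4.+2 -> s r = [::] by move=> *; apply: hs; lia.
clearbody M; apply: within_le; last first.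
  apply: within_case; rewrite s0.
  apply: (within_step (within_pop _ _) erefl).
  apply: (within_step _ erefl).
    by apply: (@move_unaryP 2 3 n (encode a ++ F)) => //; rewrite ?s0; upd_tac; rewrite ?hs' //; lia.
  apply: (within_step _ erefl).
    by apply: (@clear_stackE _ _ (nseq n true)); upd_tac; rewrite ?hs' ?cats0 //; lia.
  apply: (within_step _ erefl).
    by apply: (@move_stackE _ _ _ (rev U) [::]); upd_tac; rewrite ?hs' ?cats0 //; lia.
  apply: (@within_step _ _ _ _ _ _ (upd (upd s 0 (encode a ++ F)) M.+1 (rev U))).
  - by apply: (@move_stackE _ _ _ U [::]); upd_tac; rewrite ?revK ?cats0 ?hs' //; lia.
  - by state_tac; rewrite ?cats0 ?hs' //; lia.
  apply: (within_step (hp _ a F _ _) erefl) => [|r hr|]; first by upd_tac.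
    by upd_tac; apply: hs'; lia.
  apply: (@within_step _ _ _ _ _ _ (upd (upd s 0 (U ++ F)) 1 (rev (encode a)))).
  - by apply: (@move_stackE _ _ _ (rev U) F); upd_tac.
  - by state_tac; rewrite ?hs' ?cats0 ?revK //; lia.
  apply: (@within_step _ _ _ _ _ _ (upd s 0 (encode a ++ U ++ F))).
  - by apply: (@move_stackE _ _ _ (rev (encode a)) (U ++ F)); upd_tac.
  - by state_tac; rewrite ?hs' ?revK //; lia.
  by apply: within_eq (within_push _ _ _) _; state_tac.
rewrite !size_rev !size_nseq sz size_enc_unary.
have : (size (encode a)).+2 ^ c <= (size (encode a) + n.+1 + size F).+1.+2 ^ c.
  by apply: leq_expn; lia.
lia.
Qed.

(* The bound is only required along the iterations that do occur. *)
Lemma polytime_iter (X A : codeType) (h : X -> nat * A) (g : A -> A) T :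
  pbound T -> polytime h -> polytime g ->
  (forall x j, j <= (h x).1 ->
     size (encode (iter j g (h x).2)) <= T (size (encode x))) ->
  polytime (fun x => iter (h x).1 g (h x).2).
Proof.
move=> hT hh [p [m [c hp]]] hg; have [d hd] := polytime_size hh.
case: hh => q [m' [c' hq]]; set M := (maxn m m').+4.
apply: (@polytimeI _ _ _ M.+2 (fun n => n.+2 ^ c' + ((n.+2 ^ d * 5 + 10) +
    ((n.+2 ^ d * 2).+1 + (n.+2 ^ d * ((1 + (T n).+2 ^ c)).+1).+1)))
  (Seq q (Seq (move_unary 2 M) (Seq (clear_stack 1) (While M (Seq (Pop M) p))))));
  first by pbound_tac.
move=> s x s0 hs; have := hd x; have := hg x; have := hq s x s0.
case: (h x) => n a /= {}hq {}hg {}hd; move: hd.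
set N := size (encode x); set N' := size (encode (n, a)) => hd.
have nN : n < N' by rewrite /N' encode_pair size_cat size_enc_unary; lia.
have hs' r : 0 < r -> r < (maxn m m').+4.+2 -> s r = [::].
  by move=> *; apply: hs; lia.
have Me : M = (maxn m m').+4 by []; clearbody M.
pose S j := upd (upd s M (nseq (n - j) true)) 0 (encode (iter j g a)).
apply: within_le; last first.
  apply: (within_step (hq _) erefl); first by move=> r hr; apply: hs'; lia.
  apply: (within_step _ erefl).
    apply: (@move_unaryP 2 M n (encode a)) => //; try (by apply/eqP; lia); try lia.
    by upd_tac; rewrite hs'; lia.
  apply: (@within_step _ _ _ _ _ _ (S 0)).
  - by apply: (@clear_stackE _ _ (rev (enc_unary n))); upd_tac; rewrite ?hs' ?cats0 //; lia.
  - by rewrite /S subn0; state_tac; rewrite ?hs' ?cats0 //; lia.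
  apply: within_eq.
    apply: (@within_loop M _ n (1 + (T N).+2 ^ c)) => [j jn|]; last first.
      by rewrite /S subnn; upd_tac.
    have Sj : S j M = true :: nseq (n - j.+1) true.
      by rewrite /S -[n - j]prednK ?subn_gt0 //= -subnS; upd_tac.
    split; first by rewrite Sj.
    apply: within_eq.
      apply: within_le; last first.
        apply: (within_step (within_pop _ _) erefl).
        apply: (hp _ (iter j g a)) => [|r hr]; rewrite Sj /S; upd_tac.
        by apply: hs'; lia.
      rewrite leq_add2l leq_expn // !ltnS; exact/hg/ltnW.
    by rewrite Sj /S; state_tac.
  by rewrite /S subnn; state_tac; rewrite ?hs' //; lia.
rewrite size_rev size_enc_unary -/N.
have : n * (1 + (T N).+2 ^ c).+1 <= N.+2 ^ d * (1 + (T N).+2 ^ c).+1.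
  by rewrite leq_mul //; lia.
lia.
Qed.

Lemma polytime_fst_of (X A B : codeType) (f : X -> A * B) :
  polytime f -> polytime (fun x => (f x).1).
Proof. by move=> hf; apply: (polytime_comp hf (@polytime_fst A B)). Qed.

Lemma polytime_snd_of (X A B : codeType) (f : X -> A * B) :
  polytime f -> polytime (fun x => (f x).2).
Proof. by move=> hf; apply: (polytime_comp hf (@polytime_snd A B)). Qed.

Lemma polytime_app2 (X A B C : codeType) (g : A -> B -> C)
    (f1 : X -> A) (f2 : X -> B) :
  polytime (fun p : A * B => g p.1 p.2) -> polytime f1 -> polytime f2 ->
  polytime (fun x => g (f1 x) (f2 x)).
Proof. by move=> hg h1 h2; apply: (polytime_comp (polytime_pair h1 h2) hg). Qed.

Lemma polytime_case_sum (X A B C : codeType) (s : X -> A + B)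
    (f : X -> A -> C) (g : X -> B -> C) :
  polytime s -> polytime (fun p : X * A => f p.1 p.2) ->
  polytime (fun p : X * B => g p.1 p.2) ->
  polytime (fun x => match s x with inl a => f x a | inr b => g x b end).
Proof.
move=> hs hf hg.
have swap (Y : codeType) : polytime (fun p : Y * X => (p.2, p.1)).
  by apply: polytime_pair; [apply: polytime_snd | apply: polytime_fst].
exact: (polytime_comp (polytime_pair hs (polytime_id X))
  (polytime_sum_rect (polytime_comp (swap A) hf) (polytime_comp (swap B) hg))).
Qed.

Lemma polytime_case_nat (X C : codeType) (n : X -> nat)
    (f : X -> C) (g : X -> nat -> C) :
  polytime n -> polytime f -> polytime (fun p : X * nat => g p.1 p.2) ->
  polytime (fun x => match n x with 0 => f x | m.+1 => g x m end).
Proof.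
move=> hn hf hg.
have := polytime_case_sum (f := fun x (_ : unit) => f x) (g := g) (polytime_comp hn polytime_split_nat)
  (polytime_comp (polytime_fst _ unit_codeType) hf) hg.
by apply: eq_polytime => x /=; case: (n x).
Qed.

Lemma polytime_if (X C : codeType) (b : X -> bool) (f g : X -> C) :
  polytime b -> polytime f -> polytime g ->
  polytime (fun x => if b x then f x else g x).
Proof.
move=> hb hf hg.
have := polytime_case_sum (f := fun x (_ : unit) => g x) (g := fun x (_ : unit) => f x)
  (polytime_comp hb polytime_split_bool)
  (polytime_comp (polytime_fst _ unit_codeType) hg)
  (polytime_comp (polytime_fst _ unit_codeType) hf).
by apply: eq_polytime => x /=; case: (b x).
Qed.

Lemma polytime_case_seq (X A C : codeType) (l : X -> seq A)
    (f : X -> C) (g : X -> A -> seq A -> C) :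
  polytime l -> polytime f ->
  polytime (fun p : X * (A * seq A) => g p.1 p.2.1 p.2.2) ->
  polytime (fun x => match l x with [::] => f x | y :: r => g x y r end).
Proof.
move=> hl hf hg.
have := polytime_case_sum (f := fun x (_ : unit) => f x) (g := fun x q => g x q.1 q.2)
  (polytime_comp hl (@polytime_uncons A))
  (polytime_comp (polytime_fst _ unit_codeType) hf)
  hg.
by apply: eq_polytime => x /=; case: (l x).
Qed.

Lemma polytime_cons_of (X A : codeType) (f : X -> A) (g : X -> seq A) :
  polytime f -> polytime g -> polytime (fun x => f x :: g x).
Proof. by move=> hf hg; apply: polytime_app2 hf hg; apply: polytime_cons. Qed.

Lemma polytime_succ_of (X : codeType) (f : X -> nat) :
  polytime f -> polytime (fun x => (f x).+1).
Proof. by move=> hf; apply: (polytime_comp hf polytime_succn). Qed.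

Lemma polytime_negb (X : codeType) (f : X -> bool) :
  polytime f -> polytime (fun x => ~~ f x).
Proof.
by move=> hf; apply: polytime_if hf _ _; apply: polytime_const.
Qed.

Ltac poly_tac_with t :=
  repeat first
    [ assumption | apply: polytime_const | apply: polytime_id
    | apply: polytime_fst | apply: polytime_snd | t
    | apply: polytime_fst_of | apply: polytime_snd_of
    | apply: polytime_pair | apply: polytime_cons_of | apply: polytime_succ_of
    | apply: polytime_if | apply: polytime_negb ].

Lemma polytime_iter_of (X A : codeType) (n : X -> nat) (g : X -> A -> A)
    (a : X -> A) T :
  pbound T -> polytime n -> polytime (fun p : X * A => g p.1 p.2) ->
  polytime a ->
  (forall x j, j <= n x -> size (encode (iter j (g x) (a x))) <= T (size (encode x))) ->
  polytime (fun x => iter (n x) (g x) (a x)).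
Proof.
move=> hT hn hg ha hb.
(* [polytime_iter] iterates a function of the accumulator alone, so [x] travels along with it. *)
pose G (p : X * A) := (p.1, g p.1 p.2).
have hG j x b : iter j G (x, b) = (x, iter j (g x) b).
  by elim: j => //= j ->.
have pG : polytime G by apply: polytime_pair hg; apply: polytime_fst.
have := polytime_iter (T := fun n => n + T n)
  (h := fun x => (n x, (x, a x))) (g := G).
move=> /(_ _ _ pG) h; apply: (@eq_polytime _ _ (fun x => (iter (n x) G (x, a x)).2)).
  by move=> x; rewrite hG.
apply: polytime_snd_of; apply: h => /=.
- by pbound_tac.
- by poly_tac_with fail.
- by move=> x j jn; rewrite hG encode_pair size_cat leq_add2l hb.
Qed.

(** * Lists and the sizes of their codes *)

Lemma size_encode_nat (n : nat) : size (encode n) = n.+1.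
Proof. exact: size_enc_unary. Qed.

Lemma size_encode_pair (A B : codeType) (p : A * B) :
  size (encode p) = size (encode p.1) + size (encode p.2).
Proof. by case: p => a b; rewrite encode_pair size_cat. Qed.

Lemma size_encode_seq (A : codeType) (l : seq A) :
  size (encode l) = (size l).+1 + \sum_(x <- l) size (encode x).
Proof.
rewrite encode_seq size_cat size_enc_unary size_flatten /shape -map_comp.
by rewrite sumnE big_map.
Qed.

Lemma size_encode_cat (A : codeType) (l1 l2 : seq A) :
  size (encode (l1 ++ l2)) <= size (encode l1) + size (encode l2).
Proof. by rewrite !size_encode_seq size_cat big_cat /=; lia. Qed.

Lemma size_encode_cons (A : codeType) (a : A) (l : seq A) :
  size (encode (a :: l)) = (size (encode a) + size (encode l)).+1.
Proof. by rewrite !size_encode_seq big_cons /=; lia. Qed.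

Lemma size_encode_take (A : codeType) (l : seq A) j :
  size (encode (take j l)) <= size (encode l).
Proof.
rewrite -{2}[l](cat_take_drop j) !size_encode_seq size_cat big_cat /=; lia.
Qed.

Lemma size_encode_drop (A : codeType) (l : seq A) j :
  size (encode (drop j l)) <= size (encode l).
Proof.
rewrite -{2}[l](cat_take_drop j) !size_encode_seq size_cat big_cat /=; lia.
Qed.

Lemma size_le_encode (A : codeType) (l : seq A) : size l < size (encode l).
Proof. by rewrite size_encode_seq; lia. Qed.

Lemma polytime_size_of (X A : codeType) (l : X -> seq A) :
  polytime l -> polytime (fun x => size (l x)).
Proof.
move=> hl; apply: (polytime_comp hl (g := size)) => {hl}.
apply: (@polytimeI _ _ _ 5 (fun n => (n * 5 + 10) + ((n * 2).+1 + ((n * 2).+1 + (n * 4).+1)))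
  (Seq (move_unary 2 3) (Seq (clear_stack 0) (Seq (clear_stack 3) (move_stack 1 0)))));
  first by pbound_tac.
clear l; move=> s l s0 hs; have hl := size_le_encode l; rewrite encode_seq in s0.
have hs' r : 0 < r -> r < 5 -> s r = [::] by move=> *; apply: hs; lia.
have hF : size (encode l) = (size l).+1 + size (flatten [seq encode x | x <- l]).
  by rewrite encode_seq size_cat size_enc_unary.
apply: within_le; last first.
  apply: (within_step (move_unaryP _ _ _ _ s0) erefl) => //; first by rewrite hs'.
  apply: (within_step _ erefl).
    by apply: (@clear_stackE _ _ (flatten [seq encode x | x <- l])); upd_tac.
  apply: (within_step _ erefl).
    by apply: (@clear_stackE _ _ (nseq (size l) true)); upd_tac; rewrite ?hs' ?cats0.
  apply: within_eq.
    by apply: (@move_stackE _ _ _ (rev (enc_unary (size l))) [::]); upd_tac; rewrite ?hs' ?cats0.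
  by state_tac; rewrite ?hs' ?cats0 ?revK.
by rewrite size_nseq size_rev size_enc_unary; lia.
Qed.

(** A polynomial-time step may still square the size of the accumulator at each turn; hence the size
    bound on the folds of all prefixes is a hypothesis. *)
Lemma polytime_foldl (X A B : codeType) (g : X -> B -> A -> B)
    (b : X -> B) (l : X -> seq A) T :
  pbound T -> polytime l -> polytime b ->
  polytime (fun p : X * (B * A) => g p.1 p.2.1 p.2.2) ->
  (forall x j, size (encode (foldl (g x) (b x) (take j (l x)))) <=
               T (size (encode x))) ->
  polytime (fun x => foldl (g x) (b x) (l x)).
Proof.
move=> hT hl hb hg hs; have [d hd] := polytime_size hl.
pose G x (p : seq A * B) :=
  match p.1 with [::] => p | y :: r => (r, g x p.2 y) end.
have hG x s c j : iter j (G x) (s, c) = (drop j s, foldl (g x) c (take j s)).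
  elim: j s c => [|j IH] s c; first by rewrite drop0 take0.
  rewrite iterSr; case: s => [|y r]; last by rewrite /G /= IH.
  by rewrite {2}/G IH.
apply: (@eq_polytime _ _ (fun x => (iter (size (l x)) (G x) (l x, b x)).2)).
  by move=> x; rewrite hG take_size.
apply: polytime_snd_of.
apply: (@polytime_iter_of _ _ _ _ _ (fun n => n.+2 ^ d + T n)).
- by pbound_tac.
- exact: polytime_size_of.
- apply: polytime_case_seq; [by poly_tac_with fail..|].
  apply: polytime_pair; first by poly_tac_with fail.
  apply: (@polytime_comp _ _ _
    (fun p : (X * (seq A * B)) * (A * seq A) => (p.1.1, (p.1.2.2, p.2.1))) _ _ hg).
  by poly_tac_with fail.
- by poly_tac_with fail.
move=> x j _; rewrite hG size_encode_pair /=.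
by apply: leq_add (hs x j); apply: leq_trans (size_encode_drop _ _) (hd x).
Qed.

Lemma size_encode_catrev (A : codeType) (l1 l2 : seq A) :
  size (encode (catrev l1 l2)) <= size (encode l1) + size (encode l2).
Proof.
elim: l1 l2 => [|a l1 IH] l2; first exact: leq_addl.
by apply: leq_trans (IH _) _; rewrite !size_encode_cons; lia.
Qed.

Lemma foldl_catrev (A : Type) (l1 l2 : seq A) :
  foldl (fun acc y => y :: acc) l2 l1 = catrev l1 l2.
Proof. by elim: l1 l2 => //= a l1 IH l2; rewrite IH. Qed.

Lemma polytime_catrev (X A : codeType) (f g : X -> seq A) :
  polytime f -> polytime g -> polytime (fun x => catrev (f x) (g x)).
Proof.
move=> hf hg; have [c hc] := polytime_size hf; have [d hd] := polytime_size hg.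
apply: (@eq_polytime _ _ (fun x => foldl (fun acc y => y :: acc) (g x) (f x))).
  by move=> x; rewrite foldl_catrev.
apply: (@polytime_foldl _ _ _ (fun _ acc y => y :: acc) _ _ (fun n => n.+2 ^ c + n.+2 ^ d)) => //.
- by pbound_tac.
- by poly_tac_with fail.
move=> x j; rewrite foldl_catrev; apply: leq_trans (size_encode_catrev _ _) _.
by apply: leq_add (hd x); apply: leq_trans (size_encode_take _ _) (hc x).
Qed.

Lemma polytime_rev (X A : codeType) (f : X -> seq A) :
  polytime f -> polytime (fun x => rev (f x)).
Proof. by move=> hf; apply: polytime_catrev hf (polytime_const _ _). Qed.

Lemma polytime_cat (X A : codeType) (f g : X -> seq A) :
  polytime f -> polytime g -> polytime (fun x => f x ++ g x).
Proof.
move=> hf hg; apply: eq_polytime (polytime_catrev (polytime_rev hf) hg) => x.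
by rewrite catrevE revK.
Qed.

Lemma polytime_map (X A B : codeType) (l : X -> seq A) (g : X -> A -> B) :
  polytime l -> polytime (fun p : X * A => g p.1 p.2) ->
  polytime (fun x => [seq g x y | y <- l x]).
Proof.
move=> hl hg; have [c hc] := polytime_size hl; have [d hd] := polytime_size hg.
have E x s acc : foldl (fun acc y => g x y :: acc) acc s = catrev [seq g x y | y <- s] acc.
  by elim: s acc => //= a s IH acc; rewrite IH.
apply: (@eq_polytime _ _ (fun x =>
    rev (foldl (fun acc y => g x y :: acc) [::] (l x)))) => [x|].
  by rewrite E -/(rev _) revK.
apply: polytime_rev.
apply: (@polytime_foldl _ _ _ (fun x acc y => g x y :: acc) _ _
  (fun n => n.+2 ^ c * (n + n.+2 ^ c).+2 ^ d + (n.+2 ^ c).+1 + 1)) => //.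
- by pbound_tac.
- by poly_tac_with fail.
- apply: polytime_cons_of; last by poly_tac_with fail.
  apply: (@polytime_comp _ _ _ (fun p : X * (seq B * A) => (p.1, p.2.2)) _ _ hg).
  by poly_tac_with fail.
move=> x j; rewrite E; apply: leq_trans (size_encode_catrev _ _) _.
have -> : size (encode ([::] : seq B)) = 1 by [].
rewrite leq_add2r size_encode_seq size_map big_map addnC.
have := leq_trans (size_le_encode (l x)) (hc x); set L := _ ^ c => hL.
have hj : size (take j (l x)) <= L by rewrite size_take_min; lia.
have -> : \sum_(y <- take j (l x)) size (encode (g x y)) =
  \sum_(y <- take j (l x)) size (encode (g (x, y).1 (x, y).2)) by [].
apply: leq_add; last by rewrite ltnS.
apply: leq_trans (_ : size (take j (l x)) * (size (encode x) + L).+2 ^ d <= _).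
  have : size (encode (take j (l x))) <= L.
    exact: leq_trans (size_encode_take _ _) (hc x).
  elim: (take _ _) => [|a s IH]; first by rewrite big_nil.
  rewrite size_encode_cons big_cons /= mulSn => hs; apply: leq_add.
    apply: leq_trans (hd (x, a)) _; apply: leq_expn.
    by rewrite !ltnS size_encode_pair /=; lia.
  by apply: IH; lia.
by rewrite leq_mul.
Qed.

Lemma size_encode_flatten (A : codeType) (l : seq (seq A)) :
  size (encode (flatten l)) <= size (encode l).
Proof.
elim: l => [|a l IH] //; apply: leq_trans (size_encode_cat a (flatten l)) _.
by rewrite size_encode_cons; lia.
Qed.

Lemma foldl_cat_flatten (A : Type) (l : seq (seq A)) acc :
  foldl cat acc l = acc ++ flatten l.
Proof. by elim: l acc => [|a l IH] acc /=; rewrite ?cats0 // IH catA. Qed.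

Lemma polytime_flatten (X A : codeType) (f : X -> seq (seq A)) :
  polytime f -> polytime (fun x => flatten (f x)).
Proof.
move=> hf; have [c hc] := polytime_size hf.
apply: (@eq_polytime _ _ (fun x => foldl cat [::] (f x))) => [x|].
  by rewrite foldl_cat_flatten.
apply: (@polytime_foldl _ _ _ (fun _ acc y => acc ++ y) _ _ (fun n => n.+2 ^ c)) => //.
- by pbound_tac.
- by poly_tac_with fail.
- by apply: polytime_cat; poly_tac_with fail.
move=> x j; rewrite foldl_cat_flatten /=.
apply: leq_trans (size_encode_flatten _) _.
exact: leq_trans (size_encode_take _ _) (hc x).
Qed.

Lemma polytime_filter (X A : codeType) (l : X -> seq A) (b : X -> A -> bool) :
  polytime l -> polytime (fun p : X * A => b p.1 p.2) ->
  polytime (fun x => [seq y <- l x | b x y]).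
Proof.
move=> hl hb; apply: (@eq_polytime _ _
  (fun x => flatten [seq if b x y then [:: y] else [::] | y <- l x])) => [x|].
  by elim: (l x) => //= a s ->; case: (b x a).
apply: polytime_flatten; apply: polytime_map hl _; by poly_tac_with fail.
Qed.

Lemma polytime_drop (X A : codeType) (n : X -> nat) (l : X -> seq A) :
  polytime n -> polytime l -> polytime (fun x => drop (n x) (l x)).
Proof.
move=> hn hl; have [c hc] := polytime_size hl.
have hi j (s : seq A) : iter j behead s = drop j s.
  elim: j s => [|j IH] s; first by rewrite drop0.
  by rewrite iterSr IH; case: s.
apply: (@eq_polytime _ _ (fun x => iter (n x) behead (l x))) => [x|].
  exact: hi.
apply: (@polytime_iter_of _ _ _ (fun _ => behead) _ (fun n => n.+2 ^ c)) => //.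
- by pbound_tac.
- apply: (@polytime_case_seq _ _ _ snd (fun _ => [::]) (fun _ _ r => r));
  by poly_tac_with fail.
by move=> x j _; rewrite hi; apply: leq_trans (size_encode_drop _ _) (hc x).
Qed.

Lemma polytime_nth (X A : codeType) (d : A) (l : X -> seq A) (n : X -> nat) :
  polytime l -> polytime n -> polytime (fun x => nth d (l x) (n x)).
Proof.
move=> hl hn; apply: (@eq_polytime _ _
  (fun x => match drop (n x) (l x) with [::] => d | y :: _ => y end)) => [x|].
  by rewrite -[n x in RHS]addn0 -nth_drop; case: (drop _ _).
apply: (@polytime_case_seq _ _ _ (fun x => drop (n x) (l x)) (fun _ => d) (fun _ y _ => y)).
- exact: polytime_drop.
- by poly_tac_with fail.
- by poly_tac_with fail.
Qed.

(** * Arithmetic on unary numbers *)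

Lemma polytime_addn (X : codeType) (f g : X -> nat) :
  polytime f -> polytime g -> polytime (fun x => f x + g x).
Proof.
move=> hf hg; have [c hc] := polytime_size hf; have [d hd] := polytime_size hg.
have hi a b : iter a succn b = a + b by rewrite iter_succn addnC.
apply: (@eq_polytime _ _ (fun x => iter (f x) succn (g x))) => [x|].
  exact: hi.
apply: (@polytime_iter_of _ _ _ (fun _ => succn) _ (fun n => n.+2 ^ c + n.+2 ^ d)) => //.
- by pbound_tac.
- by poly_tac_with fail.
move=> x j; rewrite hi size_encode_nat; move: (hc x) (hd x).
by rewrite !size_encode_nat; lia.
Qed.

Lemma polytime_muln (X : codeType) (f g : X -> nat) :
  polytime f -> polytime g -> polytime (fun x => f x * g x).
Proof.
move=> hf hg; have [c hc] := polytime_size hf; have [d hd] := polytime_size hg.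
have hi a b : iter a (addn b) 0 = a * b by rewrite iter_addn_0 mulnC.
apply: (@eq_polytime _ _ (fun x => iter (f x) (addn (g x)) 0)) => [x|].
  exact: hi.
apply: (@polytime_iter_of _ _ _ (fun x => addn (g x)) (fun=> 0)
  (fun n => (n.+2 ^ c * n.+2 ^ d).+1)) => //.
- by pbound_tac.
- apply: polytime_addn; last by poly_tac_with fail.
  by apply: (@polytime_comp _ _ _ fst _ _ hg); poly_tac_with fail.
- by poly_tac_with fail.
move=> x j; rewrite hi size_encode_nat ltnS; move: (hc x) (hd x).
by rewrite !size_encode_nat => h1 h2 h3; apply: leq_mul; lia.
Qed.

Lemma polytime_expn (X : codeType) (f : X -> nat) c :
  polytime f -> polytime (fun x => f x ^ c).
Proof.
move=> hf; elim: c => [|c IH]; first exact: polytime_const.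
by apply: (@eq_polytime _ _ (fun x => f x * f x ^ c));
  [move=> x; rewrite expnS | apply: polytime_muln].
Qed.

Lemma polytime_subn (X : codeType) (f g : X -> nat) :
  polytime f -> polytime g -> polytime (fun x => f x - g x).
Proof.
move=> hf hg; have [c hc] := polytime_size hf.
have hi a b : iter a predn b = b - a by rewrite iter_predn.
apply: (@eq_polytime _ _ (fun x => iter (g x) predn (f x))) => [x|].
  exact: hi.
apply: (@polytime_iter_of _ _ _ (fun x => predn) _ (fun n => n.+2 ^ c)) => //.
- by pbound_tac.
- apply: (@eq_polytime _ _ (fun p : X * nat => match p.2 with 0 => 0 | m.+1 => m end)).
    by case=> ? [].
  by apply: (@polytime_case_nat _ _ snd (fun _ => 0) (fun _ m => m)); poly_tac_with fail.
move=> x j; rewrite hi size_encode_nat; move: (hc x).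
by rewrite !size_encode_nat => h1 h2; lia.
Qed.

Lemma polytime_leq (X : codeType) (f g : X -> nat) :
  polytime f -> polytime g -> polytime (fun x => f x <= g x).
Proof.
move=> hf hg; apply: (@eq_polytime _ _
  (fun x => match f x - g x with 0 => true | _.+1 => false end)) => [x|].
  by rewrite /leq; case: (f x - g x).
by apply: (@polytime_case_nat _ _ (fun x => f x - g x) (fun _ => true) (fun _ _ => false));
  rewrite ?[X in _ X]/=; first [exact: polytime_subn | exact: polytime_const].
Qed.

Lemma polytime_eqn (X : codeType) (f g : X -> nat) :
  polytime f -> polytime g -> polytime (fun x => f x == g x).
Proof.
move=> hf hg; apply: (@eq_polytime _ _
  (fun x => if f x <= g x then g x <= f x else false)) => [x|].
  by rewrite eqn_leq; case: (f x <= g x).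
apply: polytime_if; [exact: polytime_leq | exact: polytime_leq | exact: polytime_const].
Qed.

Lemma polytime_iota0 (X : codeType) (n : X -> nat) :
  polytime n -> polytime (fun x => iota 0 (n x)).
Proof.
move=> hn; have [c hc] := polytime_size hn.
have hi a : iter a (fun l => 0 :: [seq i.+1 | i <- l]) [::] = iota 0 a.
  by elim: a => //= a ->; rewrite -[1]addn0 iotaDl.
apply: (@eq_polytime _ _
  (fun x => iter (n x) (fun l => 0 :: [seq i.+1 | i <- l]) [::])) => [x|].
  exact: hi.
apply: (@polytime_iter_of _ _ _ (fun _ l => 0 :: [seq i.+1 | i <- l]) _
  (fun n => (n.+2 ^ c).+1 + n.+2 ^ c * n.+2 ^ c)) => //.
- by pbound_tac.
- apply: polytime_cons_of; first by poly_tac_with fail.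
  by apply: (@polytime_map _ _ _ snd (fun _ i => i.+1)); poly_tac_with fail.
- by poly_tac_with fail.
move=> x j; rewrite hi size_encode_seq size_iota; move: (hc x).
rewrite size_encode_nat => h1 h2; apply: leq_add; first by lia.
have hle : forall i, i \in iota 0 j -> size (encode i) <= (size (encode x)).+2 ^ c.
  by move=> i; rewrite mem_iota size_encode_nat; lia.
apply: leq_trans (_ : j * (size (encode x)).+2 ^ c <= _); last by rewrite leq_mul; lia.
rewrite -[X in _ <= X * _](size_iota 0); elim: (iota 0 j) hle => [|a s IH] h.
  by rewrite big_nil.
rewrite big_cons /= mulSn; apply: leq_add; first by apply: h; rewrite mem_head.
by apply: IH => y ys; apply: h; rewrite inE ys orbT.
Qed.

Lemma polytime_nseq (X A : codeType) (n : X -> nat) (a : A) :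
  polytime n -> polytime (fun x => nseq (n x) a).
Proof.
move=> hn; apply: (@eq_polytime _ _ (fun x => [seq a | _ <- iota 0 (n x)])) => [x|].
  by elim: (n x) 0 => //= m IH i; rewrite IH.
by apply: polytime_map (polytime_iota0 hn) _; apply: polytime_const.
Qed.

(** Counts in halves, the boolean holding a pending odd unit: iterating it over a unary number
    divides by two. *)
Definition half_step (p : nat * bool) := (if p.2 then p.1.+1 else p.1, ~~ p.2).

Lemma iter_half_step n : iter n half_step (0, false) = (n./2, odd n).
Proof. by elim: n => //= n ->; rewrite /half_step /= uphalf_half; case: odd. Qed.

Lemma polytime_half_odd (X : codeType) (n : X -> nat) :
  polytime n -> polytime (fun x => ((n x)./2, odd (n x))).
Proof.
move=> hn; have [c hc] := polytime_size hn.
apply: (@eq_polytime _ _ (fun x => iter (n x) half_step (0, false))) => [x|].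
  exact: iter_half_step.
apply: (@polytime_iter_of _ _ _ (fun _ => half_step) _ (fun n => (n.+2 ^ c).+2)) => //.
- by pbound_tac.
- by poly_tac_with fail.
- by poly_tac_with fail.
move=> x j; rewrite iter_half_step size_encode_pair => hj.
rewrite [_.1]/= [_.2]/= size_encode_nat addn1.
by move: (hc x); rewrite size_encode_nat; lia.
Qed.

Lemma iter_half n : iter n half 0 = 0.
Proof. by elim: n => //= n ->. Qed.

Lemma iter_half_le p n : iter p half n <= n.
Proof. by elim: p => //= p IH; lia. Qed.

Lemma polytime_iter_half (X : codeType) (p n : X -> nat) :
  polytime p -> polytime n -> polytime (fun x => iter (p x) half (n x)).
Proof.
move=> hp hn; have [c hc] := polytime_size hn.
apply: (@polytime_iter_of _ _ _ (fun _ => half) _ (fun n => n.+2 ^ c)) => //.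
- by pbound_tac.
- exact: polytime_fst_of (polytime_half_odd (polytime_snd _ _)).
move=> x j _; move: (hc x); rewrite !size_encode_nat.
by apply: leq_trans; rewrite ltnS iter_half_le.
Qed.

Lemma polytime_odd (X : codeType) (n : X -> nat) :
  polytime n -> polytime (fun x => odd (n x)).
Proof. by move=> hn; apply: (polytime_snd_of (polytime_half_odd hn)). Qed.

(** * Trees and words *)

(* Trees all of whose leaves are at depth [l].  A leaf is a propositional
   variable given by two numbers; a node is the disjunction of its children,
   negated if its boolean is [true]. *)
Fixpoint tree (l : nat) : codeType :=
  if l is l'.+1 then prod_codeType bool_codeType (seq_codeType (tree l'))
  else prod_codeType nat_codeType nat_codeType.

Fixpoint eval (x : nat -> nat -> bool) (l : nat) : tree l -> bool :=
  match l with
  | 0 => fun t => x t.1 t.2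
  | l'.+1 => fun t => t.1 (+) has (@eval x l') t.2
  end.

Fixpoint all_leaves (P : nat -> nat -> bool) (l : nat) : tree l -> bool :=
  match l with
  | 0 => fun t => P t.1 t.2
  | l'.+1 => fun t => all (@all_leaves P l') t.2
  end.

Lemma has_split (A : Type) (a : pred A) (s : seq A) :
  has a s <-> exists s1 y s2, s = s1 ++ y :: s2 /\ a y.
Proof.
split=> [|[s1 [y [s2 [-> ay]]]]]; last by rewrite has_cat /= ay orbT.
elim: s => //= z s IH /orP[az|/IH[s1 [y [s2 [-> ay]]]]].
- by exists [::], z, s.
- by exists (z :: s1), y, s2.
Qed.

Section Words.

Variable D : nat.

(* Letters: 0 fills the segments of the leaves; for 1 <= l <= D, [3l] precedes
   the children of a node of level l, and [3l + 1], [3l + 2] start the nodes of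
   level l; [base + i] starts the segment of a leaf [(i, q)], of length [q]. *)
Definition base := 3 * D + 3.

Fixpoint word (l : nat) : tree l -> seq nat :=
  match l with
  | 0 => fun t => base + t.1 :: nseq t.2.-1 0
  | l'.+1 => fun t => 3 * l'.+1 + 1 + t.1 ::
      flatten [seq 3 * l'.+1 :: @word l' c | c <- t.2]
  end.

(** The separators [3 * j] of the levels [j > l]: they never occur inside the word of a tree of
    level [l], but they delimit it. *)
Definition sep (l a : nat) : bool := (3 %| a) && (3 * l < a <= 3 * D).

(** What may stand to the left of a subtree of level [l]: nothing, at the border of the whole word,
    or a word ending with a separator of a higher level. [rsep] is the mirror image. *)
Definition lsep l (u : seq nat) := (u == [::]) || sep l (last 0 u).
Definition rsep l (u : seq nat) := (u == [::]) || sep l (head 0 u).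

Definition is_head (l a : nat) : bool :=
  if l is 0 then base <= a else (a == 3 * l + 1) || (a == 3 * l + 2).

Lemma sep_le l m a : l <= m -> sep m a -> sep l a.
Proof. by move=> lm /and3P[h1 h2 h3]; apply/and3P; split=> //; lia. Qed.

Lemma rsep_le l m u : l <= m -> rsep m u -> rsep l u.
Proof. by move=> lm /orP[h|/(sep_le lm) h]; rewrite /rsep h ?orbT. Qed.

Lemma word_letters l (t : tree l) a :
  a \in word t -> (a < 3 * l.+1) || (base <= a).
Proof.
elim: l t a => [|l IH] [x s] a /=; rewrite inE => /predU1P[->|].
- by rewrite leq_addr orbT.
- by rewrite mem_nseq => /andP[_ /eqP->].
- by case: x; lia.
- elim: s => //= c s IHs; rewrite inE mem_cat => /predU1P[->|]; first by lia.
  case/orP => [/IH|/IHs //].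
  by case/orP => h; apply/orP; [left; lia | right].
Qed.

Lemma word_not_sep l (t : tree l) : all (fun a => ~~ sep l a) (word t).
Proof.
suff h m : l <= m -> all (fun a => ~~ sep m a) (word t) by exact: h.
elim: l t m => [|l IH] [x s] m lm /=.
- rewrite /sep /base; apply/andP; split; first by lia.
  by apply/allP => a; rewrite mem_nseq => /andP[_ /eqP->].
- apply/andP; split; first by rewrite /sep; case: x; lia.
  elim: s => //= c s IHs; rewrite all_cat /= IHs IH ?andbT; last by lia.
  by rewrite /sep; lia.
Qed.

Lemma word_head l (t : tree l) : l <= D -> is_head l (head 0 (word t)).
Proof. case: l t => [|l] [x s] lD /=; first exact: leq_addr. case: x; lia. Qed.

Lemma size_word l (t : tree l) : 0 < size (word t).
Proof. by case: l t. Qed.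

(** The head is followed only by separators and letters of the levels below, or by zeros in a leaf.
    A head letter therefore pins down the start of a node. *)
Lemma word_tail l (t : tree l) a :
  l <= D -> a \in behead (word t) -> ~~ is_head l a.
Proof.
case: l t => [|l] [x s] lD /=.
  by rewrite mem_nseq => /andP[_ /eqP->]; rewrite /base; lia.
elim: s => //= c s IHs; rewrite inE mem_cat => /predU1P[->|]; first by lia.
case/orP => [/word_letters|/IHs //].
by rewrite /base; lia.
Qed.

(** Turns a position found by a quantifier into a child: by [word_tail], a head of level [l] can
    only be the first letter of a child. *)
Lemma children_head l (s : seq (tree l)) j : l < D ->
  j < size (flatten [seq 3 * l.+1 :: word c | c <- s]) ->
  is_head l (nth 0 (flatten [seq 3 * l.+1 :: word c | c <- s]) j) ->
  exists s1 c s2, s = s1 ++ c :: s2 /\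
    j = (size (flatten [seq 3 * l.+1 :: word c | c <- s1])).+1.
Proof.
move=> lD; elim: s j => //= c s IH [_|j] /=.
  by case: l lD c s IH => [|l] lD c s _ /=; rewrite /base; lia.
rewrite size_cat ltnS nth_cat; case: (ltnP j (size (word c))) => jc; last first.
  move=> h1 hh; case: (IH (j - size (word c)) _ hh) => [|s1 [c' [s2 [-> e]]]].
    by lia.
  by exists (c :: s1), c', s2; split=> //=; rewrite size_cat; lia.
case: j jc => [|j] jc _ hh; first by exists [::], c, s.
suff : ~~ is_head l (nth 0 (word c) j.+1) by rewrite hh.
apply: (@word_tail _ c _ (ltnW lD)); rewrite -nth_behead; rewrite mem_nth //.
by move: jc; case: (word c).
Qed.

(** The descent from a node to a child. The separator [3 * l.+1] closes the left context; on the
    right comes that of the next sibling, or else the old context, which is delimited at a higher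
    level. *)
Lemma child_context l u u' (x : bool) (s1 : seq (tree l)) c s2 : l < D ->
  rsep l.+1 u' ->
  let v := u ++ 3 * l.+1 + 1 + x ::
     flatten [seq 3 * l.+1 :: word c | c <- s1] ++ [:: 3 * l.+1] in
  let v' := flatten [seq 3 * l.+1 :: word c | c <- s2] ++ u' in
  [/\ u ++ @word l.+1 (x, s1 ++ c :: s2) ++ u' = v ++ word c ++ v',
      lsep l v, rsep l v' &
      size v = size u + (size (flatten [seq 3 * l.+1 :: word c | c <- s1])).+2].
Proof.
move=> lD hu' v v'; split.
- rewrite /v /v' /= map_cat flatten_cat /= -!catA /=.
  by congr (_ ++ _ :: _); rewrite -!catA.
- rewrite /lsep /v last_cat /= last_cat /= /sep; apply/orP; right; lia.
- rewrite /v' /rsep; case: s2 {v'} => [|c' s2] /=; first exact: rsep_le hu'.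
  by rewrite /sep; lia.
- by rewrite /v !(size_cat, size_rcons) /= size_cat /=; lia.
Qed.

(** Recovers from a mere position the leaf whose segment starts there, by descending through the
    child contexts; letters from [base] on occur nowhere else. *)
Lemma leaf_factor (P : nat -> nat -> bool) l (t : tree l) u u' j :
  l <= D -> all_leaves P t -> lsep l u -> rsep l u' ->
  j < size (word t) -> base <= nth 0 (word t) j ->
  exists v i q v', [/\ u ++ word t ++ u' = v ++ @word 0 (i, q) ++ v',
    size v = size u + j, lsep 0 v /\ rsep 0 v' & P i q].
Proof.
elim: l t u u' j => [|l IH] t u u' j lD ht hu hu'.
  case: t ht => i q /= ht; case: j => [_ _|j] /=.
    by exists u, i, q, u'; split=> //; rewrite addn0.
  by rewrite nth_nseq /base; case: ifP => // _; lia.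
case: t ht => x s /= hs; case: j => [_|j] /=; first by rewrite /base; case: x; lia.
rewrite ltnS => js hj.
suff [s1 [c [s2 [i [es hi hb e]]]]] : exists s1 c s2 i,
  [/\ s = s1 ++ c :: s2, i < size (word c), base <= nth 0 (word c) i &
   j = (size (flatten [seq 3 * l.+1 :: word c | c <- s1])).+1 + i].
  have [e1 h1 h2 h3] := @child_context l u u' x s1 c s2 lD hu'.
  have hc : all_leaves P c by move: hs; rewrite es all_cat /= => /and3P[].
  rewrite -cat_cons -[_ :: flatten _]/(@word l.+1 (x, s)) es e1.
  have [v [i' [q [v' [-> hv hv' pq]]]]] := IH c _ _ i (ltnW lD) hc h1 h2 hi hb.
  by exists v, i', q, v'; split=> //; rewrite hv h3 e; lia.
elim: s j js hj {hs} => //= c s IHs [|j] /=; first by rewrite /base; lia.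
rewrite size_cat ltnS nth_cat; case: (ltnP j (size (word c))) => jc.
  by move=> _ hj; exists [::], c, s, j.
move=> h1 hh; case: (IHs (j - size (word c)) _ hh) => [|s1 [c' [s2 [i [-> h2 h3 e]]]]].
  by lia.
by exists (c :: s1), c', s2, i; split=> //=; rewrite size_cat; lia.
Qed.

End Words.

(** * Formulas on words *)

Section SatEquations.

Variables (G : cgraph) (ev : nat -> vertex G) (es : nat -> {set vertex G}).
Implicit Types f g : formula rat.

Lemma sat_and f g : sat ev es (FAnd f g) = sat ev es f && sat ev es g.
Proof. by []. Qed.
Lemma sat_or f g : sat ev es (FOr f g) = sat ev es f || sat ev es g.
Proof. by []. Qed.
Lemma sat_not f : sat ev es (FNot f) = ~~ sat ev es f.
Proof. by []. Qed.
Lemma sat_mem x X : sat ev es (FMem rat x X) = (ev x \in es X).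
Proof. by []. Qed.
Lemma sat_adj x y : sat ev es (FAdj rat x y) = gadj G (ev x) (ev y).
Proof. by []. Qed.
Definition satE := (sat_and, sat_or, sat_not, sat_mem, sat_adj).

Lemma sat_allvP x f :
  reflect (forall v, sat (override ev x v) es f) (sat ev es (FAllV x f)).
Proof. exact: forallP. Qed.
Lemma sat_allsP X f :
  reflect (forall A, sat ev (override es X A) f) (sat ev es (FAllS X f)).
Proof. exact: forallP. Qed.
Lemma sat_exvP x f :
  reflect (exists v, sat (override ev x v) es f) (sat ev es (FExV x f)).
Proof. exact: existsP. Qed.

End SatEquations.

(* The colours of the vertices are the letters of the word. *)
Definition word_graph (nc : nat) (w : seq nat) : cgraph :=
  @CGraph (size w).-1
    (\matrix_(i, j) ((i.+1 == j :> nat) || (j.+1 == i :> nat)))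
    [seq [set v : 'I_(size w).-1.+1 | nth 0 w v == c] | c <- iota 0 nc] [::].

Lemma word_graph_path nc w : is_path (word_graph nc w).
Proof. by exists 1%g => u v; rewrite mxE !perm1. Qed.

Section Formulas.

Variable D : nat.
Local Notation form := (formula rat).

(** The disjunction ends with the false formula [FNot (FEq rat x x)]. *)
Definition among (cs : seq nat) (x : nat) : form :=
  foldr (fun c f => FOr (FColor rat c x) f) (FNot (FEq rat x x)) cs.

Definition FIff (f g : form) : form := FOr (FAnd f g) (FAnd (FNot f) (FNot g)).

Definition seps (l : nat) : seq nat := [seq 3 * j | j <- iota l.+1 (D - l)].

(* [b] is reachable from [a] without passing through a separator of a level
   higher than [l]; the set variables 0, 1, 2 are X, Y1, Y2. *)
Definition same_part (l a b : nat) : form :=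
  let u := a + b + 1 in let v := a + b + 2 in
  FAllS 3 (FOr (FNot (FMem rat a 3)) (FOr (FNot (FAllV u (FAllV v
    (FOr (FNot (FMem rat u 3)) (FOr (FNot (FAdj rat u v))
      (FOr (among (seps l) v) (FMem rat v 3)))))))
    (FMem rat b 3))).

(** At level 0 the complement is listed: there are [base D] other letters, a constant number,
    whereas the heads of leaves are as many as the variables. *)
Definition head_formula (l x : nat) : form :=
  if l is 0 then FNot (among (iota 0 (base D)) x)
  else among [:: 3 * l + 1; 3 * l + 2] x.

(** Vertex variable [l] denotes the head of a node of level [l], so that nested quantifiers do not
    collide. The negated equivalence is the [(+)] of [eval], the letter [3 * l + 2] marking the
    negated nodes. *)
Fixpoint value_formula (l : nat) : form :=
  if l is l'.+1 then
    FNot (FIff (FColor rat (3 * l + 2) l)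
      (FExV l' (FAnd (head_formula l' l')
        (FAnd (same_part l l l') (value_formula l')))))
  else FMem rat 0 0.

Definition segment_formula (Y h : nat) : form :=
  FAllV 2 (FIff (FMem rat 2 Y) (same_part 0 h 2)).

(** The one place where the size of the formula depends on [k]. *)
Definition same_index (k : nat) : form :=
  foldr (fun i f => FOr (FAnd (FColor rat (base D + i) 0) (FColor rat (base D + i) 1)) f)
    (FNot (FEq rat 0 0)) (iota 0 k).

Definition root_formula : form :=
  FExV D (FAnd (head_formula D D) (value_formula D)).

Definition agree_formula : form :=
  FOr (FNot (FAnd (segment_formula 1 0) (segment_formula 2 1)))
      (FIff (FMem rat 0 0) (FMem rat 1 0)).

Definition psi (k : nat) : form :=
  FAnd root_formula (FAllV 0 (FAllV 1 (FOr (FNot (same_index k)) agree_formula))).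

Lemma mem_seps l a : l <= D -> (a \in seps l) = sep D l a.
Proof.
move=> lD; apply/mapP/idP => [[j]|].
  by rewrite mem_iota /sep => h ->; lia.
move=> /and3P[/dvdnP[j ->] h1 h2]; exists j; last by rewrite mulnC.
by rewrite mem_iota; lia.
Qed.

Lemma all_seps nc l : base D <= nc -> l <= D -> all (fun c => c < nc) (seps l).
Proof.
rewrite /base => hb lD; apply/allP => a; rewrite mem_seps // /sep; lia.
Qed.

(** * Meaning of the formulas on the path of a word *)

Section Sat.

Variables (nc : nat) (w : seq nat).
Hypothesis w0 : 0 < size w.
Hypothesis nc_base : base D <= nc.
Let G := word_graph nc w.
Implicit Types (ev : nat -> vertex G) (es : nat -> {set vertex G}).

Lemma vertex_lt (v : vertex G) : v < size w.
Proof. by rewrite -[size w]prednK // ltn_ord. Qed.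

Lemma vertexP i : i < size w -> exists v : vertex G, v = i :> nat.
Proof. by rewrite -[size w]prednK // => h; exists (Ordinal h). Qed.

Lemma sat_color ev es c x : c < nc ->
  sat ev es (FColor rat c x) = (nth 0 w (ev x) == c).
Proof.
by move=> h /=; rewrite (nth_map 0) ?size_iota // inE nth_iota.
Qed.

Lemma sat_among ev es cs x : all (fun c => c < nc) cs ->
  sat ev es (among cs x) = (nth 0 w (ev x) \in cs).
Proof.
elim: cs => [|c cs IH] /=; first by rewrite eqxx.
by case/andP => hc hcs; rewrite IH // -/(sat ev es (FColor rat c x)) sat_color // inE.
Qed.

Lemma sat_iff ev es f g :
  sat ev es (FIff f g) = (sat ev es f == sat ev es g).
Proof. by rewrite /=; case: (sat ev es f); case: (sat ev es g). Qed.

Lemma sat_head ev es l x : l <= D ->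
  sat ev es (head_formula l x) = is_head D l (nth 0 w (ev x)).
Proof.
move: nc_base; rewrite /base => hb; case: l => [|l] lD.
  rewrite [sat _ _ _]/= sat_among ?mem_iota -?leqNgt //.
  by apply/allP => c; rewrite mem_iota /base; lia.
rewrite sat_among ?inE //=; rewrite andbT; apply/andP; split; lia.
Qed.

Definition separated l (u m u' : seq nat) :=
  [/\ w = u ++ m ++ u', lsep D l u, rsep D l u' & all (fun a => ~~ sep D l a) m].

(** [m] is a maximal stretch without separators above level [l], and walking without entering such a
    separator neither leaves it nor misses a part of it. For one implication the stretch itself is
    the quantified set; for the other, closure is followed from [a] in both directions. *)
Lemma sat_same_part ev es l a b u m u' : l <= D -> separated l u m u' ->
  size u <= ev a < size u + size m ->
  sat ev es (same_part l a b) = (size u <= ev b < size u + size m).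
Proof.
move=> lD [ew hu hu' hm] ha.
have cl Z : sat ev (override es 3 Z) (FAllV (a + b + 1) (FAllV (a + b + 2)
    (FOr (FNot (FMem rat (a + b + 1) 3)) (FOr (FNot (FAdj rat (a + b + 1) (a + b + 2)))
      (FOr (among (seps l) (a + b + 2)) (FMem rat (a + b + 2) 3)))))) <->
    (forall p q : vertex G, p \in Z -> (p.+1 == q :> nat) || (q.+1 == p :> nat) ->
       sep D l (nth 0 w q) || (q \in Z)).
  have e p q : override (override ev (a + b + 1) p) (a + b + 2) q (a + b + 1) = p.
    by rewrite /override eqn_add2l eqxx.
  have e' p q : override (override ev (a + b + 1) p) (a + b + 2) q (a + b + 2) = q.
    by rewrite /override eqxx.
  split=> [/sat_allvP h p q pZ pq|h].
    have := sat_allvP _ _ _ _ (h p) q; rewrite !satE sat_among ?all_seps //.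
    by rewrite !e !e' mxE pq /override /= pZ /= mem_seps.
  apply/sat_allvP => p; apply/sat_allvP => q; rewrite !satE sat_among ?all_seps //.
  rewrite !e !e' mxE mem_seps // /override /=.
  case: (boolP (p \in Z)) => //= pZ.
  case pq : ((p.+1 == q :> nat) || (q.+1 == p :> nat)) => //=; exact: h pZ pq.
have wm i : size u <= i < size u + size m -> ~~ sep D l (nth 0 w i).
  move=> hi; rewrite ew nth_cat; case: ltnP; first by lia.
  move=> _; rewrite nth_cat; case: ltnP => [h|]; last by lia.
  exact: (allP hm _ (mem_nth 0 h)).
apply/sat_allsP/idP => [h|hb Z].
  pose Z := [set v : vertex G | size u <= v < size u + size m].
  have := h Z; rewrite !satE.
  have -> : ev a \in override es 3 Z 3 by rewrite /override /= inE.
  set B := sat _ _ _; suff -> : B by rewrite /override /= inE.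
  apply/cl => p q; rewrite !inE => pZ pq.
  case: (boolP (size u <= q < _)) => [_|hq]; first by rewrite orbT.
  rewrite orbF; have qw := vertex_lt q.
  (* A neighbour outside the stretch is the last letter of [u] or the first of [u'], a separator in
     both cases. *)
  have [qu|qm] : (q.+1 == size u) \/ (q == size u + size m :> nat) by lia.
  - rewrite ew nth_cat -(eqP qu) ltnSn.
    move: hu; rewrite /lsep -size_eq0 -(eqP qu) /=.
    by rewrite -nth_last -(eqP qu).
  - move: qw; rewrite ew catA (eqP qm) nth_cat !size_cat ltnn subnn nth0.
    by move: hu'; rewrite /rsep -size_eq0 => /orP[/eqP->|//]; lia.
rewrite !satE; case: (boolP (ev a \in _)) => // aZ.
have {}aZ : ev a \in Z by [].
set B := sat _ _ _; have [/cl hZ|//] := boolP B; rewrite /override /=.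
(* Induction on the distance from [a]: the next letter of the stretch is no separator, so closure
   puts its vertex into [Z]. *)
have up d : ev a + d < size u + size m -> forall v : vertex G, v = ev a + d :> nat -> v \in Z.
  elim: d => [_ v e|d IH hd v e].
    by have -> : v = ev a by apply: val_inj; rewrite /= e addn0.
  have [p hp] : exists p : vertex G, p = ev a + d :> nat.
    by apply: vertexP; have := vertex_lt v; lia.
  have pZ : p \in Z by apply: IH hp; lia.
  have := hZ p v pZ; rewrite hp e addnS eqxx.
  by have /negbTE-> : ~~ sep D l (nth 0 w (ev a + d).+1); [apply: wm; lia | exact].
have down d : size u + d <= ev a -> forall v : vertex G, v + d = ev a :> nat -> v \in Z.
  elim: d => [_ v e|d IH hd v e].
    by have -> : v = ev a by apply: val_inj; rewrite /= -e addn0.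
  have [p hp] : exists p : vertex G, p = v.+1 :> nat.
    by apply: vertexP; have := vertex_lt (ev a); lia.
  have pZ : p \in Z by apply: IH; lia.
  have := hZ p v pZ; rewrite hp eqxx orbT.
  by have /negbTE-> : ~~ sep D l (nth 0 w v); [apply: wm; lia | exact].
case: (leqP (ev a) (ev b)) => hab.
  by apply: (up (ev b - ev a)); lia.
by apply: (down (ev a - ev b)); lia.
Qed.


(* The heads of the segments in X define the valuation [x]. *)
Definition leaf_at (X : {set vertex G}) (x : nat -> nat -> bool) :=
  forall u i q u', w = u ++ word D ((i, q) : tree 0) ++ u' ->
    lsep D 0 u -> rsep D 0 u' ->
    forall v : vertex G, v = size u :> nat -> (v \in X) = x i q.

Lemma separated_word l (t : tree l) u u' :
  w = u ++ word D t ++ u' -> lsep D l u -> rsep D l u' ->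
  separated l u (word D t) u'.
Proof. by move=> ew hu hu'; split=> //; apply: word_not_sep. Qed.

Lemma nth_word l (t : tree l) u u' i :
  w = u ++ word D t ++ u' -> i < size (word D t) ->
  nth 0 w (size u + i) = nth 0 (word D t) i.
Proof.
move=> -> h; rewrite nth_cat ifN; last by rewrite -leqNgt leq_addr.
by rewrite addKn nth_cat h.
Qed.

(** Within the part of a node, the heads of the level below are precisely those of its children, so
    the existential quantifier ranges over the children as [has] does in [eval]. *)
Lemma sat_value x ev es l (t : tree l) u u' : leaf_at (es 0) x -> l <= D ->
  w = u ++ word D t ++ u' -> lsep D l u -> rsep D l u' ->
  ev l = size u :> nat -> sat ev es (value_formula l) = eval x t.
Proof.
move=> hX; elim: l t ev u u' => [|l IH] t ev u u' lD ew hu hu' eu.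
  by case: t ew => i q ew; apply: (hX _ _ _ _ ew).
have hsep := separated_word ew hu hu'.
have w0' : nth 0 w (ev l.+1) = head 0 (word D t).
  by rewrite eu -[size u]addn0 (nth_word ew) ?nth0 ?size_word.
case: t ew hsep w0' => b s ew hsep w0'.
have hnc : 3 * l.+1 + 2 < nc by move: nc_base; rewrite /base; lia.
rewrite [value_formula _]/= sat_not sat_iff sat_color // w0' [head _ _]/=.
have -> : (3 * l.+1 + 1 + b == 3 * l.+1 + 2) = b by case: (b); lia.
rewrite [RHS]/= -negb_eqb; congr (~~ (_ == _)).
have evl v : override ev l v l.+1 = ev l.+1 /\ override ev l v l = v.
  by rewrite /override eqxx gtn_eqF.
have ev_range : size u <= ev l.+1 < size u + size (@word D l.+1 (b, s)).
  by rewrite eu leqnn -addn1 leq_add2l size_word.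
apply/sat_exvP/idP => [[v]|/has_split[s1 [c [s2 [es12 hc]]]]].
- have [ev1 ev2] := evl v.
  rewrite !sat_and sat_head ?(ltnW lD) // (sat_same_part _ _ lD hsep) ?ev1 //.
  rewrite ev2 => /and3P[hh hv sv].
  have [j hj] : exists j, v = size u + j :> nat by exists (v - size u); lia.
  have js : j < size (@word D l.+1 (b, s)) by lia.
  move: hh; rewrite hj (nth_word ew js); case: j hj js => [_ _|j hj] /=.
    (* Offset 0 is the head of the node itself, which is no head of the level below. *)
    by move=> hh; exfalso; move: hh lD; clear; case: l => [|l]; rewrite /is_head /base; case: b; lia.
  rewrite ltnS => js hh; have [s1 [c [s2 [es12 ej]]]] := children_head lD js hh.
  apply/has_split; exists s1, c, s2; split=> //.
  have [e1 h1 h2 h3] := child_context u b s1 c s2 lD hu'.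
  rewrite -(IH c (override ev l v) _ _ (ltnW lD) _ h1 h2) //.
  + by rewrite ew es12 e1.
  + by rewrite ev2 h3 hj ej; lia.
- have [e1 h1 h2 h3] := child_context u b s1 c s2 lD hu'.
  move: h1 h2 h3 e1; set u1 := u ++ _; set u2 := _ ++ u' => h1 h2 h3 e1.
  have ew1 : w = u1 ++ word D c ++ u2 by rewrite ew es12 e1.
  have sz : size u1 + size (word D c) <= size u + size (@word D l.+1 (b, s)).
    rewrite h3 es12 /= map_cat flatten_cat size_cat /= size_cat /=; lia.
  have := size_word D c => szc.
  have [v ev'] : exists v : vertex G, v = size u1 :> nat.
    apply: vertexP; rewrite ew1 !size_cat; lia.
  have [ev1 ev2] := evl v; exists v.
  rewrite !sat_and sat_head ?(ltnW lD) // (sat_same_part _ _ lD hsep) ?ev1 //.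
  rewrite ev2 ev' -{1}[size u1]addn0 (nth_word ew1) // nth0 word_head ?(ltnW lD) // andTb.
  apply/andP; split; first by lia.
  by rewrite (IH c _ _ _ (ltnW lD) ew1 h1 h2) // ev2.
Qed.

(** A head letter of level [D] occurs at position 0 only, so the quantifier of [root_formula] has to
    pick the root. *)
Lemma sat_root x ev es (t : tree D) : leaf_at (es 0) x -> w = word D t ->
  sat ev es root_formula = eval x t.
Proof.
move=> hX ew; have ew' : w = [::] ++ word D t ++ [::] by rewrite cats0.
have evD v : override ev D v D = v by rewrite /override eqxx.
apply/sat_exvP/idP => [[v]|ht].
  rewrite sat_and sat_head // evD => /andP[hv].
  suff v0 : v = 0 :> nat by rewrite (sat_value (t := t) hX _ ew') // evD.
  case: (posnP v) => // vpos; move: hv; rewrite ew.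
  have vw : v < size (word D t) by rewrite -ew vertex_lt.
  rewrite -(prednK vpos) -nth_behead => hv.
  suff : ~~ is_head D D (nth 0 (behead (word D t)) v.-1) by rewrite hv.
  apply: (@word_tail _ _ t) => //; apply: mem_nth; move: vw; rewrite -{1}(prednK vpos).
  by case: (word D t).
have [v v0] := vertexP w0; exists v.
rewrite sat_and sat_head // evD v0 ew nth0 word_head //=.
by rewrite (sat_value (t := t) hX _ ew') // evD.
Qed.

Lemma sat_segment ev es u i q u' Y h : 0 < q -> Y != 3 -> h != 2 ->
  w = u ++ word D ((i, q) : tree 0) ++ u' -> lsep D 0 u -> rsep D 0 u' ->
  ev h = size u :> nat ->
  sat ev es (segment_formula Y h) =
    (es Y == [set v : vertex G | size u <= v < size u + q]).
Proof.
move=> q0 Y3 /negbTE h2 ew hu hu' eh.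
have hsep := separated_word ew hu hu'.
have sz : size (word D ((i, q) : tree 0)) = q by rewrite /= size_nseq prednK.
have e v : override ev 2 v 2 = v /\ override ev 2 v h = ev h.
  by rewrite /override eqxx h2.
have sp v : sat (override ev 2 v) es (same_part 0 h 2) = (size u <= v < size u + q).
  rewrite (sat_same_part _ _ _ hsep) ?(e v).1 ?(e v).2 ?sz //.
  by rewrite eh leqnn -addn1 leq_add2l.
apply/sat_allvP/eqP => [hY|hY v]; last first.
  by rewrite sat_iff sp sat_mem (e v).1 hY inE eqxx.
apply/setP => v; have := hY v; rewrite sat_iff sp sat_mem (e v).1 inE.
by move/eqP.
Qed.

Lemma sat_same_index ev es k :
  base D + k <= nc ->
  sat ev es (same_index k) =
   [exists i : 'I_k, (nth 0 w (ev 0) == base D + i) && (nth 0 w (ev 1) == base D + i)].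
Proof.
move=> hk.
have -> : sat ev es (same_index k) = has (fun i => (nth 0 w (ev 0) == base D + i) &&
    (nth 0 w (ev 1) == base D + i)) (iota 0 k).
  rewrite /same_index; have : all (fun i => i < k) (iota 0 k).
    by apply/allP => i; rewrite mem_iota.
  elim: (iota 0 k) => [|i s IH] /=; first by rewrite eqxx.
  case/andP => ik /IH ->.
  rewrite -/(sat ev es (FColor rat (base D + i) 0)).
  rewrite -/(sat ev es (FColor rat (base D + i) 1)).
  by rewrite !sat_color //; lia.
apply/hasP/existsP => [[i]|[i hi]]; first by rewrite mem_iota => ik hi; exists (Ordinal ik).
by exists (i : nat); rewrite ?mem_iota /=.
Qed.

End Sat.
End Formulas.

Lemma card_interval n a q : a + q <= n ->
  #|[set v : 'I_n | a <= v < a + q]| = q.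
Proof.
move=> h; have lt (i : 'I_q) : a + i < n by apply: leq_trans h; rewrite ltn_add2l.
pose f (i : 'I_q) := Ordinal (lt i).
have -> : [set v : 'I_n | a <= v < a + q] = f @: setT.
  apply/setP => v; rewrite inE; apply/idP/imsetP => [hv|[i _ ->] /=]; last first.
    by rewrite leq_addr ltn_add2l ltn_ord.
  have iq : v - a < q by lia.
  by exists (Ordinal iq) => //; apply: val_inj => /=; lia.
rewrite card_imset ?cardsT ?card_ord // => i j /(congr1 val) /= /addnI.
exact: val_inj.
Qed.

Lemma eq_eval (x y : nat -> nat -> bool) l (t : tree l) :
  all_leaves (fun i q => x i q == y i q) t -> eval x t = eval y t.
Proof.
elim: l t => [|l IH] [b s] /=; first by move/eqP.
move=> h; congr (_ (+) _); elim: s h => //= c s IHs /andP[/IH-> /IHs->].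
by [].
Qed.

Lemma all_leaves_sub (P Q : nat -> nat -> bool) l (t : tree l) :
  (forall i q, P i q -> Q i q) -> all_leaves P t -> all_leaves Q t.
Proof.
move=> PQ; elim: l t => [|l IH] [b s] /=; first exact: PQ.
by elim: s => //= c s IHs /andP[/IH-> /IHs->].
Qed.

(** * Models of the formula and valuations of the leaves *)

Section WordModels.

Variables (D k beta rho : nat) (t : tree D) (P : nat -> nat -> bool).
Hypothesis beta1 : 1 < beta.
Hypothesis P_index : forall i q, P i q -> i < k.
Hypothesis P_pow : forall i q, P i q -> exists p, q = beta ^ p.
Hypothesis leaves : all_leaves P t.

Let w := word D t.
Let nc := base D + k.
Let G := word_graph nc w.

Let w0 : 0 < size w := size_word D t.
Let hnc : base D <= nc := leq_addr _ _.

(** The distance to the next separator of any level, or to the end of the word: at the head of a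
    leaf, the number of letters in its segment. *)
Definition segment_length (v : nat) := find (sep D 0) (drop v w).

(** The head takes up one position even for [q = 0], whence [q.-1.+1]. *)
Lemma segment_lengthE u i q u' : w = u ++ word D ((i, q) : tree 0) ++ u' ->
  rsep D 0 u' -> segment_length (size u) = q.-1.+1.
Proof.
move=> ew hu'; rewrite /segment_length ew drop_size_cat // find_cat.
have -> : has (sep D 0) (word D ((i, q) : tree 0)) = false.
  apply/negP => /hasP[a ha]; apply/negP.
  exact: (allP (word_not_sep D ((i, q) : tree 0))).
rewrite /= size_nseq; case: u' hu' {ew} => [|a u'] /=; first by rewrite addn0.
by rewrite /rsep /= => ->; rewrite addn0.
Qed.

Lemma occurrence (v : vertex G) : base D <= nth 0 w v ->
  exists u i q u', [/\ w = u ++ word D ((i, q) : tree 0) ++ u',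
    size u = v, lsep D 0 u /\ rsep D 0 u', P i q
    & nth 0 w v = base D + i /\ segment_length v = q].
Proof.
move=> hv; have vw := vertex_lt w0 v.
have [u [i [q [u' [e1 e2 [hu hu'] pq]]]]] :=
  @leaf_factor D P D t [::] [::] v (leqnn D) leaves isT isT vw hv.
have ew : w = u ++ word D ((i, q) : tree 0) ++ u' by rewrite -e1 cats0.
have q0 : 0 < q by have [p ->] := P_pow pq; rewrite expn_gt0 ltnW.
exists u, i, q, u'; split=> //.
by rewrite -[v : nat]e2 (segment_lengthE ew hu') prednK // ew nth_cat ltnn subnn.
Qed.

Lemma card_segment u i q u' : 0 < q -> w = u ++ word D ((i, q) : tree 0) ++ u' ->
  #|[set v : vertex G | size u <= v < size u + q]| = q.
Proof.
move=> q0 ew; apply: card_interval; rewrite prednK //.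
by rewrite -/w ew !size_cat /= size_nseq prednK //; lia.
Qed.

(** Occurrences of the same bit have segments of the same size, so pairs of equal cardinality
    already force [X] to be consistent; the loosened comparisons leave no other pairs. *)
Lemma psi_sound (X : {set vertex G}) (e0 : nat -> {set vertex G}) ev :
  e0 0 = X ->
  (forall Y1 Y2 : {set vertex G}, #|Y1| = #|Y2| ->
     sat ev (override (override e0 1 Y1) 2 Y2) (psi D k)) ->
  exists x, eval x t.
Proof.
move=> eX h.
(* The value is read off from any occurrence of the leaf; consistency makes the choice
   immaterial. *)
pose x i q := [exists v : vertex G, [&& nth 0 w v == base D + i,
  segment_length v == q.-1.+1 & v \in X]].
exists x.
have hX : leaf_at D X x.
  move=> u i q u' ew hu hu' v ev'.
  have sv : segment_length v = q.-1.+1 by rewrite ev' (segment_lengthE ew hu').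
  have nv : nth 0 w v = base D + i by rewrite ev' ew nth_cat ltnn subnn.
  apply/idP/existsP => [vX|[v' /and3P[/eqP n' /eqP s' vX']]].
    by exists v; rewrite nv sv vX !eqxx.
  suff -> : (v \in X) = (v' \in X) by [].
  have [|u1 [i1 [q1 [u1' [e1 z1 [h1 h1'] p1 [n1 s1]]]]]] := @occurrence v.
    by rewrite nv leq_addr.
  have [|u2 [i2 [q2 [u2' [e2 z2 [h2 h2'] p2 [n2 s2]]]]]] := @occurrence v'.
    by rewrite n' leq_addr.
  have ei1 : i1 = i by apply/eqP; rewrite -(eqn_add2l (base D)) -n1 nv.
  have ei2 : i2 = i by apply/eqP; rewrite -(eqn_add2l (base D)) -n2 n'.
  have eq12 : q1 = q2 by rewrite -s1 -s2 sv s'.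
  have q0 : 0 < q1 by have [p ->] := P_pow p1; rewrite expn_gt0 ltnW.
  have q0' : 0 < q2 by rewrite -eq12.
  pose Y1 := [set v : vertex G | size u1 <= v < size u1 + q1].
  pose Y2 := [set v : vertex G | size u2 <= v < size u2 + q2].
  have := h Y1 Y2; rewrite (card_segment q0 e1) (card_segment q0' e2).
  move=> /(_ eq12); rewrite sat_and => /andP[_ /sat_allvP/(_ v)/sat_allvP/(_ v')].
  rewrite sat_or sat_not (sat_same_index w0 hnc) // => /orP[/negP[]|].
    have ik : i < k by rewrite -ei1 (P_index p1).
    by apply/existsP; exists (Ordinal ik); rewrite /override /= n' nv !eqxx.
  rewrite /agree_formula sat_or sat_not sat_and => /orP[/negP[]|].
    rewrite (sat_segment (Y := 1) (h := 0) w0 hnc _ q0 isT isT e1 h1 h1') ?z1 //.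
    rewrite (sat_segment (Y := 2) (h := 1) w0 hnc _ q0' isT isT e2 h2 h2') ?z2 //.
    by rewrite /override /= /Y1 /Y2 z1 z2 !eqxx.
  by rewrite sat_iff !sat_mem /override /= eX => /eqP.
(* Any pair of equal size would do: [root_formula] does not mention [Y1] and [Y2]. *)
have := h set0 set0 erefl; rewrite sat_and => /andP[+ _].
by rewrite (@sat_root D nc w w0 hnc x _ _ t) // /override /= eX.
Qed.

(** [X] marks the heads of the true leaves. Two segments of the same variable that escape both
    comparisons have lengths within the factor [rho < beta] of each other; being powers of [beta],
    these are equal, and so are the marks. *)
Lemma psi_complete (x : nat -> nat -> bool) : 0 < rho < beta -> eval x t ->
  exists X : {set vertex G}, forall ev (es : nat -> {set vertex G}), es 0 = X ->
    [|| rho * #|es 2| < #|es 1|, rho * #|es 1| < #|es 2| | sat ev es (psi D k)].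
Proof.
move=> /andP[rho0 rhob] hx.
pose X := [set v : vertex G | (base D <= nth 0 w v) &&
  x (nth 0 w v - base D) (segment_length v)].
(* [leaf_at] also covers a length 0, whose segment has one letter; on the leaves of [t] the lengths
   are positive and [x'] agrees with [x]. *)
pose x' i q := x i q.-1.+1.
exists X => ev es eX.
case: ltnP => // c1; case: ltnP => // c2; rewrite !orFb.
have hX : leaf_at D (es 0) x'.
  move=> u i q u' ew hu hu' v ev'; rewrite eX inE ev' (segment_lengthE ew hu').
  have -> : nth 0 w (size u) = base D + i by rewrite ew nth_cat ltnn subnn.
  by rewrite leq_addr addKn.
rewrite sat_and; apply/andP; split.
  rewrite (@sat_root D nc w w0 hnc x' _ _ t) //.
  rewrite (@eq_eval x' x) //; apply: all_leaves_sub leaves => i q /P_pow[p ->].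
  by rewrite /x' prednK // expn_gt0 ltnW.
apply/sat_allvP => v1; apply/sat_allvP => v2; rewrite sat_or sat_not.
rewrite (sat_same_index w0 hnc) // -implybE; apply/implyP.
case/existsP => i /andP[/eqP n1 /eqP n2].
have {}n1 : nth 0 w v1 = base D + i := n1.
have {}n2 : nth 0 w v2 = base D + i := n2.
have [|u1 [i1 [q1 [u1' [e1 z1 [h1 h1'] p1 [m1 s1]]]]]] := @occurrence v1.
  by rewrite n1 leq_addr.
have [|u2 [i2 [q2 [u2' [e2 z2 [h2 h2'] p2 [m2 s2]]]]]] := @occurrence v2.
  by rewrite n2 leq_addr.
have q0 : 0 < q1 by have [p ->] := P_pow p1; rewrite expn_gt0 ltnW.
have q0' : 0 < q2 by have [p ->] := P_pow p2; rewrite expn_gt0 ltnW.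
rewrite sat_or sat_not sat_and -implybE.
rewrite (sat_segment (Y := 1) (h := 0) w0 hnc _ q0 isT isT e1 h1 h1') ?z1 //.
rewrite (sat_segment (Y := 2) (h := 1) w0 hnc _ q0' isT isT e2 h2 h2') ?z2 //.
apply/implyP => /andP[/eqP y1 /eqP y2]; rewrite sat_iff !sat_mem /=.
rewrite eX !inE n1 n2 s1 s2; suff -> : q1 = q2 by [].
move: c1 c2; rewrite y1 y2 -z1 -z2 (card_segment q0 e1) (card_segment q0' e2).
have [p ->] := P_pow p1; have [p' ->] := P_pow p2 => c1 c2; congr (_ ^ _).
have lt a b : a < b -> beta ^ b <= rho * beta ^ a -> False.
  move=> ab h; have : beta * beta ^ a <= beta ^ b by rewrite -expnS leq_exp2l.
  have : rho * beta ^ a < beta * beta ^ a by rewrite ltn_pmul2r // expn_gt0 ltnW.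
  lia.
by case: (ltngtP p p') => // h; [case: (lt _ _ h) | case: (lt _ _ h)].
Qed.

End WordModels.

(** * Circuits as trees *)

Section NodeValues.

Variables (T : Type) (d : T) (step : seq T -> gate -> T) (inputs : seq T).

Lemma size_node_values gs :
  size (node_values step inputs gs) = size inputs + size gs.
Proof.
elim/last_ind: gs => [|gs g IH]; first by rewrite addn0.
by rewrite /node_values foldl_rcons !size_rcons -/(node_values _ _ _) IH addnS.
Qed.

Lemma nth_node_values_input gs i : i < size inputs ->
  nth d (node_values step inputs gs) i = nth d inputs i.
Proof.
move=> h; elim/last_ind: gs => [|gs g IH] //.
rewrite /node_values foldl_rcons -/(node_values _ _ _) nth_rcons.
by rewrite size_node_values (leq_trans h) ?leq_addr.
Qed.

Lemma nth_node_values_gate g0 gs i : i < size gs ->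
  nth d (node_values step inputs gs) (size inputs + i) =
  step (take (size inputs + i) (node_values step inputs gs)) (nth g0 gs i).
Proof.
elim/last_ind: gs => [|gs g IH] //.
rewrite size_rcons ltnS leq_eqVlt /node_values foldl_rcons -/(node_values _ _ _).
have sz := size_node_values gs => /predU1P[->|h].
  by rewrite -sz nth_rcons ltnn eqxx -cats1 take_size_cat // nth_rcons ltnn eqxx.
rewrite nth_rcons sz ltn_add2l h IH // -cats1 takel_cat; last by rewrite sz leq_add2l ltnW.
by rewrite nth_rcons h.
Qed.

End NodeValues.

(** Kept in the form of the step function inside [depth], so that [depth_last] holds by
    unfolding. *)
Definition gate_depth (ds : seq nat) (g : gate) : nat :=
  xpredT g + \max_(i <- gate_preds g) nth 0 ds i.

Definition node_depth n gs j := nth 0 (node_values gate_depth (nseq n 0) gs) j.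

Lemma depth_last C : depth C = node_depth (cinputs C) (cgates C)
  (cinputs C + size (cgates C)).-1.
Proof.
by rewrite /depth /longest -nth_last size_node_values size_nseq.
Qed.

Lemma wf_gate_preds m g : wf_gate m g -> all (fun i => i < m) (gate_preds g).
Proof. by case: g => [i|l|l] /=; rewrite ?andbT // => /and3P[]. Qed.

Definition wf_gates n gs := forall i, i < size gs -> wf_gate (n + i) (nth (GNot 0) gs i).

Lemma wf_circuit_gates C : wf_circuit C -> wf_gates (cinputs C) (cgates C).
Proof. by move=> /andP[_ /forallP h] i ig; apply: (h (Ordinal ig)). Qed.

Section Nodes.

Variables (n : nat) (gs : seq gate) (inputs : seq bool).
Hypothesis wf : wf_gates n gs.
Hypothesis inputs_size : size inputs = n.

Let vs := node_values gate_val inputs gs.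

(** A well-formed gate reads earlier nodes only, so the values computed so far may be replaced by
    all the values. *)
Lemma node_val_gate i : i < size gs ->
  nth false vs (n + i) = gate_val vs (nth (GNot 0) gs i).
Proof.
move=> ig; rewrite -{1}inputs_size (nth_node_values_gate _ _ _ (GNot 0)) //.
rewrite inputs_size -/vs; have := wf_gate_preds (wf ig).
have e a : a < n + i -> nth false (take (n + i) vs) a = nth false vs a.
  by move=> h; rewrite nth_take.
case: (nth _ _ _) => [a|l|l] /=.
- by rewrite andbT => /e->.
- by move/allP => h; apply: eq_in_all => a /h /e.
- by move/allP => h; apply: eq_in_has => a /h /e.
Qed.

Lemma node_depth_gate i a : i < size gs ->
  a \in gate_preds (nth (GNot 0) gs i) -> node_depth n gs a < node_depth n gs (n + i).
Proof.
move=> ig ha; rewrite /node_depth -{3}(size_nseq n 0).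
rewrite (nth_node_values_gate _ _ _ (GNot 0)) // size_nseq.
have /allP/(_ _ ha) an := wf_gate_preds (wf ig).
rewrite [X in _ < X]/gate_depth /= add1n ltnS.
have -> : nth 0 (node_values gate_depth (nseq n 0) gs) a =
  nth 0 (take (n + i) (node_values gate_depth (nseq n 0) gs)) a by rewrite nth_take.
by apply: (@leq_bigmax_seq _ (gate_preds _) xpredT (nth 0 (take (n + i) _)) a).
Qed.

Lemma node_depth_gate_gt0 i : i < size gs -> 0 < node_depth n gs (n + i).
Proof.
move=> ig; rewrite /node_depth -{2}(size_nseq n 0).
by rewrite (nth_node_values_gate _ _ _ (GNot 0)).
Qed.

End Nodes.

(** * Binary digits *)

Definition bit (p v : nat) : bool := odd (iter p half v).

Lemma iter_half_mono p v v' : v <= v' -> iter p half v <= iter p half v'.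
Proof. by move=> h; elim: p => //= p IH; apply: half_leq. Qed.

Lemma iter_half_gt0 p v : 0 < iter p half v -> 2 ^ p <= v.
Proof.
elim: p v => // p IH v; rewrite iterSr => /IH; rewrite expnS.
by have := odd_double_half v; rewrite -muln2; lia.
Qed.

Lemma bit_inj v v' : (forall p, bit p v = bit p v') -> v = v'.
Proof.
move: {2}v (leqnn v) => N; elim: N v v' => [|N IH] v v' hv h.
  move: hv; rewrite leqn0 => /eqP v0; move: h; rewrite v0 => {v0 v} h.
  case: (posnP v') => // v'0.
  have hh m : 0 < m -> exists p, bit p m.
    elim/ltn_ind: m => m IHm m0; case om : (odd m); first by exists 0.
    have [||p hp] := IHm m./2; [lia | lia |].
    by exists p.+1; rewrite /bit iterSr.
  have [p hp] := hh v' v'0; move: (h p); rewrite hp /bit.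
  by elim: p {hp} => //= p; rewrite iter_half.
have h0 := h 0; rewrite /bit /= in h0.
have : v./2 = v'./2.
  case: v hv h {h0} => [|v] hv h; last first.
    by apply: IH => [|p]; [lia | move: (h p.+1); rewrite /bit !iterSr].
  by apply: IH => // p; move: (h p.+1); rewrite /bit !iterSr.
by move=> e; rewrite -[LHS]odd_double_half -[RHS]odd_double_half h0 e.
Qed.

(** The [p] with $2^p \le n$. They suffice for the digits of all numbers below [n] and keep
    $\beta^p$ polynomial. *)
Definition positions (n : nat) : seq nat :=
  [seq p <- iota 0 n | 0 < iter p half n].

(** At every other position the numbers below [n] have digit 0. *)
Lemma bit_inj_positions n v v' : v < n -> v' < n ->
  {in positions n, forall p, bit p v = bit p v'} -> v = v'.
Proof.
move=> vn vn' h; apply: bit_inj => p; case: (boolP (p \in positions n)) => [/h //|hp].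
suff z u : u < n -> iter p half u = 0 by rewrite /bit !z.
move=> un; case: (posnP (iter p half u)) => // u0; case/negP: hp.
rewrite mem_filter mem_iota /= add0n (leq_trans u0) ?iter_half_mono 1?ltnW //=.
by have := iter_half_gt0 u0; have := ltn_expl p (ltnSn 1); lia.
Qed.

(** * The tree of a circuit *)

Section CircuitTree.

Variable B : nat.
Let beta := 2 ^ B.

(* [beta ^ p], computed with numbers of polynomial size. *)
Definition seg_len (n p : nat) : nat :=
  iter p (fun q => if q <= n ^ B then beta * q else q) 1.

(** The cap is not hit before [p] multiplications: for [j < p] one has $\beta^j = (2^j)^B \le n^B$,
    because $2^p \le n$. *)
Lemma seg_lenE n p : p \in positions n -> seg_len n p = beta ^ p.
Proof.
rewrite mem_filter => /andP[/iter_half_gt0 hp _].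
rewrite /seg_len; have : p <= p by []; elim: {1 3 4}p => //= j IH jp.
rewrite (IH (ltnW jp)) expnS ifT // /beta -expnM mulnC expnM; apply: leq_expn.
by apply: leq_trans hp; rewrite leq_exp2l // ltnW.
Qed.

(** A node [(bit p v, [:: leaf])] is true when the leaf differs from that bit. With [s = false] the
    tree is thus the disjunction saying that the [i]-th variable differs from [v], and with
    [s = true] it says that they are equal. *)
Definition literal (n v i : nat) (s : bool) : tree 2 :=
  (s, [seq (bit p v, [:: (i, seg_len n p)]) | p <- positions n]).

Definition input_tree (k n v : nat) (s : bool) : tree 3 :=
  (s, [seq literal n v i true | i <- iota 0 k]).

(** [m] is any bound on the depth of the node and fixes the height, so inputs met early are passed
    down through one-child disjunctions. The sign [s] negates the node, which turns a conjunction
    into a negated disjunction of negated children. *)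
Fixpoint node_tree (k n : nat) (gs : seq gate) (m j : nat) (s : bool) : tree m.+3 :=
  match m with
  | 0 => input_tree k n j s
  | m'.+1 =>
    if j < n then (s, [:: node_tree k n gs m' j false]) else
    match nth (GNot 0) gs (j - n) with
    | GNot a => (~~ s, [:: node_tree k n gs m' a false])
    | GAnd l => (~~ s, [seq node_tree k n gs m' a true | a <- l])
    | GOr l => (s, [seq node_tree k n gs m' a false | a <- l])
    end
  end.

(* True if and only if the i-th variable takes no value other than those of the
   variables before it. *)
Definition fresh_tree (n i : nat) : tree 4 :=
  (true, [seq (true, literal n v i false :: [seq literal n v j true | j <- iota 0 i])
         | v <- iota 0 n]).

Fixpoint pad (m : nat) (t : tree 4) : tree m.+4 :=
  if m is m'.+1 then (false, [:: pad m' t]) else t.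

(** A conjunction as a negated disjunction: the negated output, or some variable that brings no new
    value. The output gets height [d.+1] to match the padded [fresh_tree]s. *)
Definition circuit_tree (d k n : nat) (gs : seq gate) : tree d.+4.+1 :=
  (true, node_tree k n gs d.+1 (n + size gs).-1 true ::
         [seq pad d (fresh_tree n i) | i <- iota 0 k]).

Section Eval.

Variable x : nat -> nat -> bool.

(** Under an arbitrary valuation the bits of a variable may spell no number below [n]; [fresh_tree]
    excludes this along with repetitions. *)
Definition takes (n i v : nat) : bool :=
  ~~ has (fun p => bit p v (+) x i (seg_len n p)) (positions n).

Lemma eval_literal n v i s : eval x (literal n v i s) = s (+) ~~ takes n i v.
Proof.
rewrite /takes negbK /=; congr (_ (+) _); rewrite has_map.
by apply: eq_has => p /=; rewrite orbF.
Qed.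

Lemma eval_input k n v s :
  eval x (input_tree k n v s) = s (+) has (fun i => takes n i v) (iota 0 k).
Proof.
rewrite [LHS]/= has_map; congr (_ (+) _); apply: eq_has => i.
by rewrite -[LHS]/(eval x (literal n v i true)) eval_literal /= negbK.
Qed.

Lemma eval_fresh n i : eval x (fresh_tree n i) =
  ~~ has (fun v => takes n i v && ~~ has (fun j => takes n j v) (iota 0 i)) (iota 0 n).
Proof.
rewrite [LHS]/= has_map; congr (~~ _); apply: eq_has => v.
rewrite -[LHS]/(~~ (eval x (literal n v i false) ||
  has (eval x (l:=2)) [seq literal n v j true | j <- iota 0 i])).
rewrite eval_literal negb_or /= negbK; congr (_ && ~~ _); rewrite has_map.
apply: eq_has => j.
by rewrite -[LHS]/(eval x (literal n v j true)) eval_literal /= negbK.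
Qed.

Lemma eval_pad m t : eval x (pad m t) = eval x t.
Proof. by elim: m => //= m ->; rewrite orbF. Qed.

Lemma eval_node k n gs (S : {set 'I_n}) : wf_gates n gs ->
  (forall v : 'I_n, (v \in S) = has (fun i => takes n i v) (iota 0 k)) ->
  forall m j s, j < n + size gs -> node_depth n gs j <= m ->
  eval x (node_tree k n gs m j s) =
    s (+) nth false (node_values gate_val [seq i \in S | i <- enum 'I_n] gs) j.
Proof.
move=> wf hS; set inp := [seq _ | _ <- _].
have sz : size inp = n by rewrite size_map size_enum_ord.
have hin j : j < n -> nth false (node_values gate_val inp gs) j =
    has (fun i => takes n i j) (iota 0 k).
  move=> jn; rewrite nth_node_values_input ?sz //.
  by rewrite (nth_map (Ordinal jn)) ?size_enum_ord // hS nth_enum_ord.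
elim=> [|m IH] j s jn hd.
  rewrite eval_input; case: (ltnP j n) => [/hin->//|nj].
  (* Gates have positive depth, so a node of depth 0 is an input. *)
  have := @node_depth_gate_gt0 n gs (j - n).
  by rewrite subnKC // => /(_ ltac:(lia)); lia.
rewrite [node_tree _ _ _ _ _ _]/=; case: ltnP => [jn'|nj].
  rewrite -[LHS]/(s (+) (eval x (node_tree k n gs m j false) || false)) orbF.
  (* An input is unchanged along the chain of one-child disjunctions that leads it to the bottom. *)
  elim: (m) => [|m' IHm]; first by rewrite eval_input hin.
  rewrite [node_tree _ _ _ _ _ _]/= jn'.
  rewrite -[eval _ _]/(eval x (node_tree k n gs m' j false) || false) orbF.
  exact: IHm.
have ig : j - n < size gs by lia.
have := node_val_gate wf sz ig; have := node_depth_gate wf ig.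
have := wf_gate_preds (wf _ ig); rewrite subnKC //.
set vs := node_values _ _ _ in IH *.
case: (nth _ _ _) => [a|l|l] /allP hl hdep ->.
- rewrite -[LHS]/(~~ s (+) (eval x (node_tree k n gs m a false) || false)) orbF IH.
  + by case: s; rewrite /= ?negbK.
  + by have := hl a (mem_head _ _); lia.
  + by have := hdep a (mem_head _ _); lia.
- rewrite -[LHS]/(~~ s (+) has (eval x (l:=m.+3)) [seq node_tree k n gs m a true | a <- l]).
  rewrite has_map.
  have -> : has (preim (fun a => node_tree k n gs m a true) (eval x (l:=m.+3))) l =
    has (predC (nth false vs)) l.
    apply: eq_in_has => a al; rewrite -[LHS]/(eval x (node_tree k n gs m a true)) IH //.
    + by have := hl a al; lia.
    + by have := hdep a al; lia.
  by rewrite has_predC /=; case: s; case: (all _ _).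
- rewrite -[LHS]/(s (+) has (eval x (l:=m.+3)) [seq node_tree k n gs m a false | a <- l]).
  rewrite has_map; congr (_ (+) _).
  apply: eq_in_has => a al; rewrite -[LHS]/(eval x (node_tree k n gs m a false)) IH //.
  + by have := hl a al; lia.
  + by have := hdep a al; lia.
Qed.

Lemma eval_circuit d k n gs (S : {set 'I_n}) : wf_gates n gs ->
  0 < n + size gs -> node_depth n gs (n + size gs).-1 <= d ->
  (forall v : 'I_n, (v \in S) = has (fun i => takes n i v) (iota 0 k)) ->
  eval x (circuit_tree d k n gs) = @circuit_val (Circuit n gs) S &&
    all (fun i => has (fun v => takes n i v &&
      ~~ has (fun j => takes n j v) (iota 0 i)) (iota 0 n)) (iota 0 k).
Proof.
move=> wf ngs hd hS.
rewrite -[LHS]/(~~ (eval x (node_tree k n gs d.+1 (n + size gs).-1 true) ||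
  has (eval x (l:=d.+4)) [seq pad d (fresh_tree n i) | i <- iota 0 k])).
rewrite negb_or (eval_node wf hS) ?prednK //; last exact: leqW.
congr (_ && _).
  rewrite /circuit_val /= negbK -nth_last size_node_values size_map size_enum_ord.
  by [].
rewrite has_map -all_predC; apply: eq_all => i.
by rewrite -[LHS]/(~~ eval x (pad d (fresh_tree n i))) eval_pad eval_fresh negbK.
Qed.

End Eval.

End CircuitTree.

(** * Satisfying valuations of the tree and assignments of weight [k] *)

Section CircuitTreeSat.

Variable B : nat.
Hypothesis B0 : 0 < B.
Let beta := 2 ^ B.

(** Supplies [P_index] and [P_pow] for the leaves of the circuit tree; bounding the exponent by [n]
    makes the property boolean. *)
Definition leaf_ok (k n i q : nat) : bool :=
  (i < k) && has (fun p => q == (2 ^ B) ^ p) (iota 0 n).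

Lemma literal_leaves k n v i s : i < k ->
  all_leaves (leaf_ok k n) (literal B n v i s).
Proof.
move=> ik; rewrite [all_leaves _ _]/= all_map; apply/allP => p hp /=.
rewrite andbT /leaf_ok ik; apply/hasP; exists p.
  by move: hp; rewrite mem_filter => /andP[].
by rewrite seg_lenE.
Qed.

Lemma input_leaves k n v s : all_leaves (leaf_ok k n) (input_tree B k n v s).
Proof.
rewrite [all_leaves _ _]/= all_map; apply/allP => i; rewrite mem_iota => ik.
exact: (@literal_leaves k n v i true).
Qed.

Lemma node_leaves k n gs m j s :
  all_leaves (leaf_ok k n) (node_tree B k n gs m j s).
Proof.
elim: m j s => [|m IH] j s; first exact: input_leaves.
rewrite [node_tree _ _ _ _ _ _ _]/=; case: ltnP => _; first by apply/andP; split=> //; apply: IH.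
have h (l : seq nat) b :
    all (@all_leaves (leaf_ok k n) m.+3) [seq node_tree B k n gs m a b | a <- l].
  by elim: l => //= a l ->; rewrite andbT; apply: IH.
by case: (nth _ _ _) => [a|l|l]; [apply/andP; split=> //; apply: IH | apply: h | apply: h].
Qed.

Lemma fresh_leaves k n i : i < k -> all_leaves (leaf_ok k n) (fresh_tree B n i).
Proof.
move=> ik; rewrite [all_leaves _ _]/= all_map; apply/allP => v _.
apply/andP; split; first exact: (@literal_leaves k n v i false).
change (all (@all_leaves (leaf_ok k n) 2) [seq literal B n v j true | j <- iota 0 i]).
rewrite all_map; apply/allP => j; rewrite mem_iota => ji.
by apply: (@literal_leaves k n v j true); lia.
Qed.

Lemma pad_leaves P m t : all_leaves P t -> all_leaves P (pad m t).
Proof. by move=> h; elim: m => //= m ->. Qed.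

Lemma circuit_leaves d k n gs : all_leaves (leaf_ok k n) (circuit_tree B d k n gs).
Proof.
apply/andP; split; first exact: node_leaves.
change (all (@all_leaves (leaf_ok k n) d.+4) [seq pad d (fresh_tree B n i) | i <- iota 0 k]).
rewrite all_map; apply/allP => i; rewrite mem_iota => ik.
by apply: pad_leaves; apply: fresh_leaves; lia.
Qed.

Lemma takes_bits x n i (v v0 : nat) : v < n -> v0 < n ->
  {in positions n, forall p, x i ((2 ^ B) ^ p) = bit p v0} ->
  takes B x n i v = (v == v0).
Proof.
move=> vn v0n hx; rewrite /takes -all_predC.
apply/allP/eqP => [h|-> p hp]; last by rewrite /= seg_lenE // hx // addbb.
apply: bit_inj_positions vn v0n _ => p hp; apply/eqP; have := h p hp.
by rewrite /= seg_lenE // hx // negb_add.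
Qed.

Lemma takes_inj x n i v v' : v < n -> v' < n ->
  takes B x n i v -> takes B x n i v' -> v = v'.
Proof.
move=> vn vn'; rewrite /takes -!all_predC => /allP h /allP h'.
apply: bit_inj_positions vn vn' _ => p hp.
move: (h p hp) (h' p hp); rewrite /= !negb_add => /eqP-> /eqP->; by [].
Qed.

(** Mapping each variable to a value that no earlier one takes is injective, and it exhausts the
    true inputs because a variable takes at most one value; so exactly [k] inputs are true.
    Conversely, the variables enumerate the true inputs. *)
Lemma circuit_tree_sat d k n gs : wf_gates n gs -> 0 < n + size gs ->
  node_depth n gs (n + size gs).-1 <= d ->
  (exists x, eval x (circuit_tree B d k n gs)) <->
  (exists2 S : {set 'I_n}, #|S| = k & @circuit_val (Circuit n gs) S).
Proof.
move=> wf ngs hd; split=> [[x]|[S Sk hS]].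
- pose S := [set v : 'I_n | has (fun i => takes B x n i v) (iota 0 k)].
  rewrite (@eval_circuit B x d k n gs S) // => [/andP[hS /allP hv]|v]; last by rewrite inE.
  exists S => //.
  have hf (i : 'I_k) : exists v : 'I_n, takes B x n i v &&
      ~~ has (fun j => takes B x n j v) (iota 0 i).
    have /hv/hasP[v] : (i : nat) \in iota 0 k by rewrite mem_iota /=.
    by rewrite mem_iota => vn hi; exists (Ordinal vn).
  pose f i := xchoose (hf i); have fP i := xchooseP (hf i).
  have finj : injective f.
    have h (i j : 'I_k) : j < i -> f i = f j -> False.
      move=> ji e; have /andP[_ /hasP[]] := fP i; exists (j : nat).
        by rewrite mem_iota.
      by rewrite -/(f i) e; case/andP: (fP j).
    move=> i j e; apply: val_inj => /=; case: (ltngtP i j) => // ij.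
      by case: (h _ _ ij).
    by case: (h _ _ ij).
  have -> : S = f @: setT.
    apply/setP => v; rewrite inE; apply/hasP/imsetP => [[i]|[i _ ->]].
      rewrite mem_iota /= => ik hi; exists (Ordinal ik) => //; apply: val_inj.
      apply: takes_inj hi _ => //; first exact: ltn_ord.
      by have /andP[] := fP (Ordinal ik).
    by exists (i : nat); [rewrite mem_iota /= | have /andP[] := fP i].
  by rewrite card_imset // cardsT card_ord.
- pose vs := [seq val v | v <- enum S].
  have szv : size vs = k by rewrite size_map -cardE.
  (* A leaf knows its position [p] only through its length, whose logarithm to base [beta] is
     [p]. *)
  pose x i q := bit (trunc_log beta q) (nth 0 vs i).
  exists x.
  have beta1 : 1 < beta by rewrite -[1]/(2 ^ 0) ltn_exp2l.
  have vsn i : i < k -> nth 0 vs i < n.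
    move=> ik; have : nth 0 vs i \in vs by rewrite mem_nth ?szv.
    by case/mapP => v _ ->; apply: ltn_ord.
  have tk i v : i < k -> v < n -> takes B x n i v = (v == nth 0 vs i).
    move=> ik vn; apply: takes_bits => //; first exact: vsn.
    by move=> p _; rewrite /x trunc_expnK.
  have hh i v : i <= k -> v < n ->
      has (fun j => takes B x n j v) (iota 0 i) = (v \in take i vs).
    move=> ik vn; apply/hasP/(nthP 0) => [[j]|[j]].
      rewrite mem_iota /= add0n => ji; rewrite tk ?(leq_trans ji) // => /eqP e.
      by exists j; rewrite ?nth_take // size_takel ?szv.
    rewrite size_takel ?szv // => ji; rewrite nth_take // => e.
    by exists j; rewrite ?mem_iota ?tk ?e ?eqxx // (leq_trans ji).
  rewrite (@eval_circuit B x d k n gs S) // => [|v]; last first.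
    by rewrite hh // -szv take_size (mem_map val_inj) mem_enum.
  rewrite hS; apply/allP => i; rewrite mem_iota /= add0n => ik.
  apply/hasP; exists (nth 0 vs i); first by rewrite mem_iota /= vsn.
  rewrite tk ?vsn // eqxx hh ?vsn ?(ltnW ik) //=.
  have : uniq vs by rewrite (map_inj_uniq val_inj) enum_uniq.
  rewrite -{1}(cat_take_drop i vs) (drop_nth 0) ?szv // cat_uniq.
  by case/and3P => _ /=; rewrite negb_or => /andP[].
Qed.

End CircuitTreeSat.

(** * Computing the instance *)

(** The codes of gates are bit for bit those of this sum type, which makes the case analysis of sums
    available for gates. *)
Definition gate_sum (g : gate) : nat + nat * seq nat :=
  match g with GNot i => inl i | GAnd l => inr (0, l) | GOr l => inr (1, l) end.

Lemma encode_gate_sum g : encode (gate_sum g) = enc_gate g.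
Proof. by case: g. Qed.

Lemma movable_gate : movable enc_gate.
Proof.
have [p [m [c h]]] := within_movable (sum_codeType nat_codeType
  (prod_codeType nat_codeType (seq_codeType nat_codeType))).
exists p, m, c => s g rest; rewrite -encode_gate_sum; exact: h.
Qed.
Canonical gate_codeType := CodeType movable_gate.

Ltac poly_lift :=
  match goal with h : polytime ?f |- _ => is_var f; apply: (polytime_comp _ h) end.

Ltac poly_tac := poly_tac_with ltac:(first
  [ poly_lift | apply: polytime_flatten | apply: polytime_cat
  | apply: polytime_addn | apply: polytime_muln | apply: polytime_subn
  | apply: polytime_iota0 | apply: polytime_eqn | apply: polytime_leq
  | apply: polytime_odd | apply: polytime_iter_half | apply: polytime_expn
  | apply: polytime_nseq | apply: polytime_size_of | apply: polytime_nth]).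

Lemma polytime_gate_sum : polytime gate_sum.
Proof. by apply: polytime_recode => g; rewrite encode_gate_sum. Qed.

Section Generator.

Variable B : nat.

Lemma polytime_positions (X : codeType) (n : X -> nat) :
  polytime n -> polytime (fun x => positions (n x)).
Proof.
move=> hn.
by apply: (@polytime_filter _ _ _ (fun x p => 0 < iter p half (n x))); poly_tac.
Qed.

(** At most one multiplication carries the value past $n^B$. The bound holds for every [j], as the
    iteration must stay small on all inputs and not only on [positions n]. *)
Lemma seg_len_le j n : iter j (fun q => if q <= n ^ B then 2 ^ B * q else q) 1 <=
  2 ^ B * n ^ B + 1.
Proof.
elim: j => [|j IH]; first by rewrite addn1.
rewrite iterS; set q := iter j _ _ in IH *; case: ifP => // h.
by rewrite (leq_trans (leq_mul (leqnn _) h)) // leq_addr.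
Qed.

Lemma polytime_seg_len (X : codeType) (n p : X -> nat) :
  polytime n -> polytime p -> polytime (fun x => seg_len B (n x) (p x)).
Proof.
move=> hn hp; have [c hc] := polytime_size hn.
apply: (@polytime_iter_of _ _ _ (fun x q => if q <= n x ^ B then 2 ^ B * q else q) _
  (fun m => (2 ^ B * (m.+2 ^ c) ^ B + 1).+1)).
- by pbound_tac.
- by [].
- by poly_tac.
- by poly_tac.
move=> x j _; rewrite size_encode_nat ltnS; apply: leq_trans (seg_len_le _ _) _.
rewrite leq_add2r leq_mul2l leq_expn ?orbT //.
by apply: leq_trans (hc x); rewrite size_encode_nat.
Qed.

Lemma polytime_literal (X : codeType) (n v i : X -> nat) (s : X -> bool) :
  polytime n -> polytime v -> polytime i -> polytime s ->
  polytime (fun x => literal B (n x) (v x) (i x) (s x)).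
Proof.
move=> hn hv hi hs; apply: polytime_pair hs _.
apply: (@polytime_map _ _ (prod_codeType bool_codeType (seq_codeType (tree 0))) _
  (fun x p => (bit p (v x), [:: (i x, seg_len B (n x) p)]))).
  exact: polytime_positions.
apply: polytime_pair; first by rewrite /bit; poly_tac.
apply: polytime_cons_of; last exact: polytime_const.
apply: polytime_pair; first by poly_tac.
by apply: polytime_seg_len; poly_tac.
Qed.

Lemma polytime_input_tree (X : codeType) (k n v : X -> nat) (s : X -> bool) :
  polytime k -> polytime n -> polytime v -> polytime s ->
  polytime (fun x => input_tree B (k x) (n x) (v x) (s x)).
Proof.
move=> hk hn hv hs; apply: polytime_pair hs _.
apply: (@polytime_map _ _ (tree 2) _ (fun x i => literal B (n x) (v x) i true)).
  by poly_tac.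
by apply: polytime_literal; poly_tac.
Qed.

(** [m] belongs to the program and not to its input: each level is unfolded into program text, and
    the type of the result changes with it. *)
Lemma polytime_node_tree m (X : codeType) (k n j : X -> nat) (gs : X -> seq gate)
    (s : X -> bool) :
  polytime k -> polytime n -> polytime j -> polytime gs -> polytime s ->
  polytime (fun x => node_tree B (k x) (n x) (gs x) m (j x) (s x)).
Proof.
elim: m X k n j gs s => [|m IH] X k n j gs s hk hn hj hgs hs.
  exact: polytime_input_tree.
apply: (@eq_polytime _ (tree m.+4) (fun x =>
   if j x < n x then (s x, [:: node_tree B (k x) (n x) (gs x) m (j x) false]) else
   match gate_sum (nth (GNot 0) (gs x) (j x - n x)) with
   | inl a => (~~ s x, [:: node_tree B (k x) (n x) (gs x) m a false])
   | inr p => if p.1 == 0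
       then (~~ s x, [seq node_tree B (k x) (n x) (gs x) m a true | a <- p.2])
       else (s x, [seq node_tree B (k x) (n x) (gs x) m a false | a <- p.2])
   end)).
  by move=> x /=; case: ltnP => // _; case: (nth _ _ _).
apply: polytime_if.
- by apply: polytime_leq; poly_tac.
- apply: polytime_pair hs _; apply: polytime_cons_of (polytime_const _ _).
  by apply: IH; poly_tac.
apply: (@polytime_case_sum X nat_codeType
  (prod_codeType nat_codeType (seq_codeType nat_codeType)) (tree m.+4) _
  (fun x a => (~~ s x, [:: node_tree B (k x) (n x) (gs x) m a false]))
  (fun x p => if p.1 == 0
       then (~~ s x, [seq node_tree B (k x) (n x) (gs x) m a true | a <- p.2])
       else (s x, [seq node_tree B (k x) (n x) (gs x) m a false | a <- p.2]))).
- by apply: polytime_comp polytime_gate_sum; poly_tac.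
- apply: polytime_pair; first by poly_tac.
  by apply: polytime_cons_of (polytime_const _ _); apply: IH; poly_tac.
apply: polytime_if; first by poly_tac.
- apply: polytime_pair; first by poly_tac.
  apply: (@polytime_map _ nat_codeType _ (fun q : X * (nat * seq nat) => q.2.2)
    (fun q a => node_tree B (k q.1) (n q.1) (gs q.1) m a true)).
    by poly_tac.
  by apply: IH; poly_tac.
- apply: polytime_pair; first by poly_tac.
  apply: (@polytime_map _ nat_codeType _ (fun q : X * (nat * seq nat) => q.2.2)
    (fun q a => node_tree B (k q.1) (n q.1) (gs q.1) m a false)).
    by poly_tac.
  by apply: IH; poly_tac.
Qed.

Lemma polytime_fresh_tree (X : codeType) (n i : X -> nat) :
  polytime n -> polytime i -> polytime (fun x => fresh_tree B (n x) (i x)).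
Proof.
move=> hn hi; apply: polytime_pair (polytime_const _ _) _.
apply: (@polytime_map _ _ (tree 3) _ (fun x v =>
  (true, literal B (n x) v (i x) false ::
     [seq literal B (n x) v j true | j <- iota 0 (i x)]))); first by poly_tac.
apply: polytime_pair (polytime_const _ _) _; apply: polytime_cons_of.
  by apply: polytime_literal; poly_tac.
apply: (@polytime_map _ _ (tree 2) _ (fun q j => literal B (n q.1) q.2 j true)).
  by poly_tac.
by apply: polytime_literal; poly_tac.
Qed.

Lemma polytime_pad m (X : codeType) (t : X -> tree 4) :
  polytime t -> polytime (fun x => pad m (t x)).
Proof.
move=> ht; elim: m => //= m IH; apply: polytime_pair (polytime_const _ _) _.
exact: polytime_cons_of IH (polytime_const _ _).
Qed.

Lemma polytime_circuit_tree d (X : codeType) (k n : X -> nat) (gs : X -> seq gate) :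
  polytime k -> polytime n -> polytime gs ->
  polytime (fun x => circuit_tree B d (k x) (n x) (gs x)).
Proof.
move=> hk hn hgs; apply: polytime_pair (polytime_const _ _) _; apply: polytime_cons_of.
  apply: polytime_node_tree; poly_tac.
  apply: (@eq_polytime _ _ (fun x => n x + size (gs x) - 1)) => [x|].
    by rewrite subn1.
  by poly_tac.
apply: (@polytime_map _ _ (tree d.+4) _ (fun x i => pad d (fresh_tree B (n x) i))).
  by poly_tac.
by apply: polytime_pad; apply: polytime_fresh_tree; poly_tac.
Qed.

End Generator.

Lemma polytime_word D l (X : codeType) (t : X -> tree l) :
  polytime t -> polytime (fun x => word D (t x)).
Proof.
elim: l X t => [|l IH] X t ht.
  apply: polytime_cons_of; first by poly_tac.
  apply: polytime_nseq.
  apply: (@eq_polytime _ _ (fun x => (t x).2 - 1)) => [x|]; first by rewrite subn1.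
  by poly_tac.
apply: polytime_cons_of.
  apply: polytime_addn; first exact: polytime_const.
  apply: polytime_if; poly_tac.
apply: polytime_flatten.
apply: (@polytime_map X (tree l) _ (fun x => (t x).2) (fun x c => 3 * l.+1 :: word D c)).
  by apply: polytime_snd_of.
by apply: polytime_cons_of (polytime_const _ _) _; apply: IH; apply: polytime_snd.
Qed.

Lemma polytime_unary (X : codeType) (n : X -> nat) :
  polytime n -> polytime (fun x => enc_unary (n x)).
Proof.
move=> hn; apply: (@eq_polytime X (seq_codeType bool_codeType)
  (fun x => nseq (n x) true ++ [:: false])) => [x|]; first by rewrite cats1.
by poly_tac.
Qed.

(** The code of [word_graph] by lists instead of matrices and finite sets; the last bit is the code
    of the empty list of weights. *)
Definition graph_code (nc : nat) (w : seq nat) : seq bool :=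
  enc_unary (size w).-1 ++
  flatten [seq [seq (i.+1 == j) || (j.+1 == i) | j <- iota 0 (size w)]
          | i <- iota 0 (size w)] ++
  (enc_unary nc ++ flatten [seq [seq a == c | a <- w] | c <- iota 0 nc]) ++
  [:: false].

Lemma enc_word_graph nc w : 0 < size w ->
  enc_graph (word_graph nc w) = graph_code nc w.
Proof.
move=> w0; have ew : (size w).-1.+1 = size w by rewrite prednK.
have he (T : Type) (f : nat -> T) :
    [seq f (val v) | v <- enum 'I_(size w).-1.+1] = [seq f i | i <- iota 0 (size w)].
  by rewrite (map_comp f val) val_enum_ord ew.
rewrite /enc_graph /graph_code; congr (_ ++ (_ ++ (_ ++ _))).
- congr flatten; rewrite -[RHS](he _ (fun i => [seq (i.+1 == j) || (j.+1 == i) | j <- iota 0 (size w)])).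
  apply: eq_map => i; rewrite -he.
  by apply: eq_map => j; rewrite mxE.
- rewrite /enc_seq size_map size_iota; congr (_ ++ flatten _).
  rewrite -map_comp; apply: eq_map => c /=; rewrite /enc_set.
  rewrite -[in RHS](mkseq_nth 0 w) /mkseq -map_comp -he.
  by apply: eq_map => v; rewrite inE.
Qed.

Lemma polytime_graph_code (X : codeType) (nc : X -> nat) (w : X -> seq nat) :
  polytime nc -> polytime w -> polytime (fun x => graph_code (nc x) (w x)).
Proof.
move=> hnc hw; apply: polytime_cat; last apply: polytime_cat; last apply: polytime_cat;
  last exact: polytime_const.
- apply: polytime_unary; apply: (@eq_polytime _ _ (fun x => size (w x) - 1)) => [x|].
    by rewrite subn1.
  by poly_tac.
- apply: polytime_flatten.
  apply: (@polytime_map _ _ (seq_codeType bool_codeType) _ (fun x i =>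
    [seq (i.+1 == j) || (j.+1 == i) | j <- iota 0 (size (w x))])); first by poly_tac.
  apply: (@polytime_map _ _ _ _ (fun q j => (q.2.+1 == j) || (j.+1 == q.2))).
    by poly_tac.
  by apply: (polytime_if (f := fun=> true)); poly_tac.
apply: polytime_cat; first exact: polytime_unary.
apply: polytime_flatten.
apply: (@polytime_map X nat_codeType (seq_codeType bool_codeType) _ (fun x c => [seq a == c | a <- w x])).
  by poly_tac.
apply: (@polytime_map _ nat_codeType bool_codeType _ (fun q a => a == q.2)); by poly_tac.
Qed.

Definition phi (alpha D k : nat) : formula rat := hard_form alpha%:R%R (psi D k).

(** Codes are in prefix notation, so a disjunct with its [FOr] is a self-contained string, and a
    disjunction is coded by concatenating such strings. *)
Definition index_code (D i : nat) : seq bool :=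
  enc_unary 8 ++ enc_unary 7 ++
    (enc_unary 3 ++ enc_unary (base D + i) ++ enc_unary 0) ++
    (enc_unary 3 ++ enc_unary (base D + i) ++ enc_unary 1).

Lemma enc_same_index D k : enc_formula (same_index D k) =
  flatten [seq index_code D i | i <- iota 0 k] ++ enc_formula (FNot (FEq rat 0 0)).
Proof.
rewrite /same_index; elim: (iota 0 k) => // i s IH.
by rewrite [LHS]/= IH /index_code -!catA.
Qed.

Lemma enc_phi alpha D : exists s1 s2, forall k, enc_formula (phi alpha D k) =
  s1 ++ flatten [seq index_code D i | i <- iota 0 k] ++ s2.
Proof.
(* All that precedes the code of [same_index]; the subformulas are abstracted so that only the
   connectives around it get unfolded. *)
pose H (c1 c2 r : formula rat) := enc_unary 12 ++ enc_unary 1 ++ enc_unary 12 ++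
  enc_unary 2 ++ enc_unary 8 ++ enc_formula c1 ++ enc_unary 8 ++ enc_formula c2 ++
  enc_unary 7 ++ enc_formula r ++ enc_unary 10 ++ enc_unary 0 ++
  enc_unary 10 ++ enc_unary 1 ++ enc_unary 8 ++ enc_unary 6.
have E c1 c2 r f g : enc_formula (FAllS 1 (FAllS 2 (FOr c1 (FOr c2
    (FAnd r (FAllV 0 (FAllV 1 (FOr (FNot f) g)))))))) =
    H c1 c2 r ++ enc_formula f ++ enc_formula g.
  by rewrite [LHS]/= /H -!catA.
exists (H (FCmp Gt (tcard _ 1) (scale (alpha%:R ^+ 2)%R (tcard _ 2)))
          (FCmp Gt (tcard _ 2) (scale (alpha%:R ^+ 2)%R (tcard _ 1))) (root_formula D)),
  (enc_formula (FNot (FEq rat 0 0)) ++ enc_formula (agree_formula D)) => k.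
rewrite [LHS]E.
by rewrite enc_same_index -!catA.
Qed.

Lemma symbols_phi alpha D : exists a b, forall k, symbols (phi alpha D k) = a + b * k.
Proof.
have e k : symbols (same_index D k) = 6 * k + 4.
  rewrite /same_index -[k in RHS](size_iota 0); elim: (iota 0 k) => //= i s ->; lia.
exists (symbols (phi alpha D 0)), 6 => k.
rewrite /phi /hard_form /psi [LHS]/= [symbols _ in RHS]/= !e; lia.
Qed.

(** * The query and its answers *)

Section FormulaShape.

Variables (D nc nw : nat).
Hypothesis nc_base : base D <= nc.
Local Notation wf := (wf_formula nc nw).

Lemma among_mso cs x : is_mso (among cs x).
Proof. by elim: cs. Qed.

Lemma head_mso l x : is_mso (head_formula D l x).
Proof. by case: l => [|l]; apply: among_mso. Qed.

Lemma same_part_mso l a b : is_mso (same_part D l a b).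
Proof. by rewrite /= among_mso. Qed.

Lemma value_mso l : is_mso (value_formula D l).
Proof. by elim: l => //= l ->; rewrite head_mso among_mso. Qed.

Lemma same_index_mso k : is_mso (same_index D k).
Proof. by rewrite /same_index; elim: (iota 0 k). Qed.

Lemma psi_mso k : is_mso (psi D k).
Proof.
have seg Y h : is_mso (segment_formula D Y h).
  by apply/andP; split; apply: same_part_mso.
have root : is_mso (root_formula D).
  by apply/andP; split; [apply: head_mso | apply: value_mso].
apply/andP; split=> //; apply/andP; split; first exact: same_index_mso.
by apply/andP; split=> //; apply/andP; split; apply: seg.
Qed.

Lemma among_wf ve vs cs x : all (fun c => c < nc) cs -> x \in ve ->
  wf ve vs (among cs x).
Proof.
by move=> + xv; elim: cs => [|c cs IH] /=; rewrite ?xv // => /andP[-> /IH].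
Qed.

Lemma head_wf ve vs l x : l <= D -> x \in ve -> wf ve vs (head_formula D l x).
Proof.
move: nc_base; rewrite /base; case: l => [|l] hb lD xv; apply: among_wf => //.
  by apply/allP => c; rewrite mem_iota /base; lia.
by rewrite /=; lia.
Qed.

Lemma same_part_wf ve vs l a b : l <= D -> a \in ve -> b \in ve ->
  wf ve vs (same_part D l a b).
Proof.
move=> lD av bv; rewrite /= av bv !inE !eqxx ?orbT ?andbT /=.
by apply: among_wf; [exact: all_seps | rewrite inE eqxx].
Qed.

Lemma value_wf ve vs l : l <= D -> l \in ve -> 0 \in vs ->
  wf ve vs (value_formula D l).
Proof.
elim: l ve => [|l IH] ve lD lv zv; first by rewrite /= lv zv.
have hnc : 3 * l.+1 + 2 < nc by move: nc_base; rewrite /base; lia.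
have h : wf ve vs (FExV l (FAnd (head_formula D l l)
    (FAnd (same_part D l.+1 l.+1 l) (value_formula D l)))).
  apply/and3P; split.
  - by apply: head_wf; rewrite ?mem_head // ltnW.
  - by apply: same_part_wf => //; [rewrite in_cons lv orbT | rewrite mem_head].
  - by apply: IH; rewrite ?mem_head // ltnW.
by apply/andP; split; apply/andP; split=> //; apply/andP; split.
Qed.

Lemma segment_wf ve vs Y h : Y \in vs -> h \in ve -> wf ve vs (segment_formula D Y h).
Proof.
move=> Yv hv; have hp : wf (2 :: ve) vs (same_part D 0 h 2).
  by apply: same_part_wf => //; rewrite in_cons ?hv ?orbT.
have hm : wf (2 :: ve) vs (FMem rat 2 Y) by rewrite /= Yv.
by apply/andP; split; apply/andP; split.
Qed.

Lemma same_index_wf ve vs k : base D + k <= nc -> 0 \in ve -> 1 \in ve ->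
  wf ve vs (same_index D k).
Proof.
move=> hk h0 h1; rewrite /same_index; have : all (fun i => i < k) (iota 0 k).
  by apply/allP => i; rewrite mem_iota.
elim: (iota 0 k) => [|i s IH] /=; first by rewrite h0.
by case/andP => ik /IH->; rewrite h0 h1 !andbT andbb; lia.
Qed.

Lemma psi_wf vs k : base D + k <= nc -> 0 \in vs -> 1 \in vs -> 2 \in vs ->
  wf [::] vs (psi D k).
Proof.
move=> hk h0 h1 h2; apply/andP; split.
  by apply/andP; split; [apply: head_wf | apply: value_wf]; rewrite ?mem_head.
have si : wf [:: 1; 0] vs (same_index D k) by apply: same_index_wf.
have s1 : wf [:: 1; 0] vs (segment_formula D 1 0) by apply: segment_wf.
have s2 : wf [:: 1; 0] vs (segment_formula D 2 1) by apply: segment_wf.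
apply/andP; split=> //; apply/andP; split; first by apply/andP; split.
by rewrite /= h0.
Qed.

End FormulaShape.

Lemma mso_no_cmp (f : formula rat) : is_mso f -> ~~ has_cmp f && neg_normal f.
Proof.
elim: f => //= [f IH /IH/andP[-> //]|f IHf g IHg|f IHf g IHg].
- by case/andP => /IHf/andP[/negbTE-> ->] /IHg/andP[/negbTE-> ->].
- by case/andP => /IHf/andP[/negbTE-> ->] /IHg/andP[/negbTE-> ->].
Qed.

Lemma mso_map_cmp F (f : formula rat) : is_mso f -> map_cmp F f = f.
Proof.
elim: f => //= [f IH /IH->|f IHf g IHg|f IHf g IHg|x f IH /IH->|x f IH /IH->
  |x f IH /IH->|x f IH /IH->] //; by case/andP => /IHf-> /IHg->.
Qed.

Lemma phi_wf alpha D k : wf_formula (base D + k) 0 [::] [:: 0] (phi alpha D k).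
Proof.
have h := psi_wf (D := D) 0 (leq_addr k (base D)) (leqnn _)
  (isT : 0 \in [:: 2; 1; 0]) isT isT.
by apply/andP; split=> //; apply/andP; split.
Qed.

Lemma phi_nnf alpha D k : neg_normal (phi alpha D k).
Proof. by have /andP[_ h] := mso_no_cmp (psi_mso D k). Qed.

Section Comparisons.

Variables (G : cgraph) (es : nat -> {set vertex G}).
Import GRing.Theory Num.Theory.
Local Open Scope ring_scope.

Lemma tval_scale a (t : wterm rat) : Defs.tval es (scale a t) = a * Defs.tval es t.
Proof.
rewrite /Defs.tval /= mulrDr big_map mulr_sumr; congr (_ + _).
by apply: eq_bigr => m _; rewrite mulrA.
Qed.

Lemma tval_card X : Defs.tval es (tcard rat X) = #|es X|%:R.
Proof. by rewrite /Defs.tval /= big_seq1 add0r mul1r /set_weight sum1_card. Qed.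

Variable alpha : nat.
Hypothesis alpha0 : (0 < alpha)%N.
Let a0 : 0 < alpha%:R :> rat.
Proof. by rewrite ltr0n. Qed.

Lemma cmp_plain X Y :
  cmp_val Gt (Defs.tval es (tcard rat X)) (Defs.tval es (scale (alpha%:R ^+ 2) (tcard rat Y))) =
  (alpha ^ 2 * #|es Y| < #|es X|)%N.
Proof. by rewrite /= tval_scale !tval_card -natrX -natrM ltr_nat. Qed.

(** Tightening gives $\frac1\alpha|X| > \alpha\cdot\alpha^2|Y|$; multiplying by $\alpha$ makes the
    factor $\alpha^4$. *)
Lemma cmp_tight X Y :
  cmp_val Gt (Defs.tval es (scale alpha%:R^-1 (tcard rat X)))
    (Defs.tval es (scale alpha%:R (scale (alpha%:R ^+ 2) (tcard rat Y)))) =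
  (alpha ^ 4 * #|es Y| < #|es X|)%N.
Proof.
rewrite -[RHS](ltr_nat rat) natrM natrX /= !tval_scale !tval_card -(ltr_pM2l a0).
by rewrite !mulrA mulfV ?lt0r_neq0 // mul1r !exprS expr0 mulr1 !mulrA.
Qed.

(** Loosening gives $\alpha|X| > \frac1\alpha\alpha^2|Y|$, and the factor cancels to 1. *)
Lemma cmp_loose X Y :
  cmp_val Gt (Defs.tval es (scale alpha%:R (tcard rat X)))
    (Defs.tval es (scale alpha%:R^-1 (scale (alpha%:R ^+ 2) (tcard rat Y)))) =
  (1 * #|es Y| < #|es X|)%N.
Proof.
rewrite /= !tval_scale !tval_card [alpha%:R ^+ 2]expr2 !mulrA mulVf ?lt0r_neq0 // mul1r.
by rewrite ltr_pM2l // ltr_nat mul1n.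
Qed.

End Comparisons.

Lemma sat_hard (G : cgraph) ev es (c1 c2 f : formula rat) rho :
  (forall ev (es : nat -> {set vertex G}), sat ev es c1 = (rho * #|es 2| < #|es 1|)) ->
  (forall ev (es : nat -> {set vertex G}), sat ev es c2 = (rho * #|es 1| < #|es 2|)) ->
  sat ev es (FAllS 1 (FAllS 2 (FOr c1 (FOr c2 f)))) <->
  (forall Y1 Y2 : {set vertex G}, [|| rho * #|Y2| < #|Y1|, rho * #|Y1| < #|Y2| |
     sat ev (override (override es 1 Y1) 2 Y2) f]).
Proof.
move=> h1 h2; split=> [/sat_allsP h Y1 Y2|h].
  by have /sat_allsP/(_ Y2) := h Y1; rewrite !sat_or h1 h2.
by apply/sat_allsP => Y1; apply/sat_allsP => Y2; rewrite !sat_or h1 h2; apply: h.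
Qed.

(** * Satisfiability of the three formulas and the answers to the query *)

Section Answers.

Variables (D k B alpha : nat) (t : tree D) (P : nat -> nat -> bool).
Hypothesis alpha1 : 1 < alpha.
Hypothesis alphaB : alpha ^ 4 < 2 ^ B.
Hypothesis P_index : forall i q, P i q -> i < k.
Hypothesis P_pow : forall i q, P i q -> exists p, q = (2 ^ B) ^ p.
Hypothesis leaves : all_leaves P t.

Let w := word D t.
Let G := word_graph (base D + k) w.

Definition satisfiable (f : formula rat) := [exists W : 1.-tuple {set vertex G}, models f W].

(** The original, tightened and loosened formulas differ only in the factor [rho], which is
    $\alpha^2$, $\alpha^4$ and 1; all three are positive and below $2^B$, so one proof covers
    them. *)
Lemma satisfiable_hard c1 c2 rho : 0 < rho < 2 ^ B ->
  (forall ev (es : nat -> {set vertex G}), sat ev es c1 = (rho * #|es 2| < #|es 1|)) ->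
  (forall ev (es : nat -> {set vertex G}), sat ev es c2 = (rho * #|es 1| < #|es 2|)) ->
  satisfiable (FAllS 1 (FAllS 2 (FOr c1 (FOr c2 (psi D k))))) <-> exists x, eval x t.
Proof.
move=> hrho h1 h2; have beta1 : 1 < 2 ^ B by case/andP: hrho; lia.
split=> [/existsP[W]|[x hx]].
  rewrite /models => hW; have {hW}h := (sat_hard _ _ _ h1 h2).1 hW.
  apply: (@psi_sound D k (2 ^ B) t P beta1 P_index P_pow leaves (assign W 0) (assign W)
     (fun=> ord0) erefl) => Y1 Y2 e.
  (* For sets of equal size and positive [rho], both comparisons fail. *)
  have := h Y1 Y2; rewrite e !ltnNge leq_pmull ?orbF //; by case/andP: hrho.
have [X hX] := @psi_complete D k (2 ^ B) rho t P beta1 P_pow leaves x hrho hx.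
apply/existsP; exists [tuple X]; apply: (sat_hard _ _ _ h1 h2).2 => Y1 Y2.
exact: (hX (fun=> ord0) (override (override (assign [tuple X]) 1 Y1) 2 Y2)).
Qed.

Local Notation a := (alpha%:R%R : rat).

Lemma tighten_phi : tighten a (phi alpha D k) =
  FAllS 1 (FAllS 2 (FOr
    (FCmp Gt (scale a^-1 (tcard rat 1)) (scale a (scale (a ^+ 2) (tcard rat 2))))
    (FOr (FCmp Gt (scale a^-1 (tcard rat 2)) (scale a (scale (a ^+ 2) (tcard rat 1))))
    (psi D k))))%R.
Proof.
by congr (FAllS 1 (FAllS 2 (FOr _ (FOr _ _)))); apply: mso_map_cmp (psi_mso D k).
Qed.

Lemma loosen_phi : loosen a (phi alpha D k) =
  FAllS 1 (FAllS 2 (FOr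
    (FCmp Gt (scale a (tcard rat 1)) (scale a^-1 (scale (a ^+ 2) (tcard rat 2))))
    (FOr (FCmp Gt (scale a (tcard rat 2)) (scale a^-1 (scale (a ^+ 2) (tcard rat 1))))
    (psi D k))))%R.
Proof.
by congr (FAllS 1 (FAllS 2 (FOr _ (FOr _ _)))); apply: mso_map_cmp (psi_mso D k).
Qed.

Let alpha0 : 0 < alpha := ltnW alpha1.

Lemma satisfiable_tight : satisfiable (tighten a (phi alpha D k)) <-> exists x, eval x t.
Proof.
rewrite tighten_phi; apply: (@satisfiable_hard _ _ (alpha ^ 4)) => [|ev es|ev es].
- by rewrite expn_gt0 alpha0.
- exact: cmp_tight.
- exact: cmp_tight.
Qed.

Lemma satisfiable_loose : satisfiable (loosen a (phi alpha D k)) <-> exists x, eval x t.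
Proof.
rewrite loosen_phi; apply: (@satisfiable_hard _ _ 1) => [|ev es|ev es].
- by apply: leq_ltn_trans alphaB; rewrite expn_gt0 alpha0.
- exact: cmp_loose.
- exact: cmp_loose.
Qed.

Lemma satisfiable_plain : satisfiable (phi alpha D k) <-> exists x, eval x t.
Proof.
apply: (@satisfiable_hard _ _ (alpha ^ 2)) => [|ev es|ev es].
- rewrite expn_gt0 alpha0; apply: leq_ltn_trans alphaB.
  by rewrite leq_exp2l.
- exact: cmp_plain.
- exact: cmp_plain.
Qed.

(** The target is the constant 0, so one model already attains the maximum. *)
Lemma opt_max_zero f : opt_max G 1 f (WTerm 0%R [::]) =
  if satisfiable f then Some (0%R : rat) else None.
Proof.
rewrite /opt_max; have t0 W : Some (Defs.tval (assign W) (WTerm (0%R : rat) [::])) = Some 0%R :> option rat.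
  by rewrite /Defs.tval /= big_nil GRing.addr0.
under eq_bigr do rewrite t0.
have -> r : \big[@omax rat/None]_(W <- r | models f W) Some (0%R : rat) =
    if has (fun W : 1.-tuple {set vertex G} => models f W) r then Some 0%R else None.
  elim: r => [|W r IH]; first by rewrite big_nil.
  by rewrite big_cons IH /=; case: (models f W) => //=; case: (has _ _).
congr (if _ then _ else _); apply/hasP/existsP => [[W _ hW]|[W hW]]; exists W => //.
by rewrite mem_index_enum.
Qed.

Let ans (s : seq bool) := exists2 r : bound G 1 * bound G 1,
  s = enc_bound r.1 ++ enc_bound r.2
  & approx_answer (phi alpha D k) (WTerm 0%R [::]) a r.

(** A solver is only constrained on instances that have a correct answer. *)
Lemma answer_exists : exists s, ans s.
Proof.
have e1 : satisfiable (tighten a (phi alpha D k)) = satisfiable (phi alpha D k).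
  by apply/idP/idP => [/satisfiable_tight/satisfiable_plain|/satisfiable_plain/satisfiable_tight].
have e2 : satisfiable (loosen a (phi alpha D k)) = satisfiable (phi alpha D k).
  by apply/idP/idP => [/satisfiable_loose/satisfiable_plain|/satisfiable_plain/satisfiable_loose].
suff [r hr] : exists r : bound G 1 * bound G 1,
    approx_answer (phi alpha D k) (WTerm 0%R [::]) a r.
  by exists (enc_bound r.1 ++ enc_bound r.2), r.
have t0 (W : 1.-tuple {set vertex G}) :
    (Defs.tval (assign W) (WTerm (0%R : rat) [::]) == 0%:R)%R.
  by rewrite /Defs.tval /= big_nil GRing.addr0.
rewrite /approx_answer /oversatisfy /undersatisfy.
case hs : (satisfiable (phi alpha D k)); rewrite hs in e1 e2.
  have /existsP[W1 h1] := hs; have /existsP[W2 h2] := e2.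
  exists (Some (0, W1), Some (0, W2)); rewrite !opt_max_zero e1 e2 hs.
  by split=> //; split; rewrite /bound_wit ?h1 ?h2; apply: t0.
by exists (None, None); rewrite !opt_max_zero e1 e2 hs.
Qed.

(** The head of the answer is the tag of $\max^-$, which is squeezed between the tightened and the
    original optimum, both finite for the same trees. The size bound limits the time needed to erase
    the answer. *)
Lemma answer_spec s : ans s ->
  (head false s <-> exists x, eval x t) /\ size s <= 2 * (1 + size (enc_nat 0) + size w).
Proof.
have ew : (size w).-1.+1 = size w by rewrite prednK // size_word.
case=> -[lo hi] -> [h1 h2 h3 h4 [h5 h6]]; split.
  have -> : head false (enc_bound lo ++ enc_bound hi) = (lo : bool) by case: lo {h1 h2 h3 h5}.
  move: h1 h2; rewrite /oversatisfy !opt_max_zero.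
  split=> [hl|/[dup]/satisfiable_tight ht _].
    by apply/satisfiable_plain; move: h2; case: lo hl {h1 h5} => //= p _; case: satisfiable.
  by move: h1; rewrite ht; case: lo {h2 h5}.
have hb f (b : bound G 1) : bound_wit f (WTerm (0%R : rat) [::]) b ->
    size (enc_bound b) <= 1 + size (enc_nat 0) + size w.
  case: b => [[v W]|_]; last by rewrite add1n addSn.
  have t0 : (Defs.tval (assign W) (WTerm (0%R : rat) [::]) = 0)%R.
    by rewrite /Defs.tval /= big_nil GRing.addr0.
  (* The witness condition forces the reported value to be 0, so its code has constant size. *)
  case/andP => _; rewrite t0 eq_sym Num.Theory.pnatr_eq0 => /eqP->.
  have hw : size (flatten [seq enc_set A | A <- W]) = size w.
    case: W {t0} => -[|A [|? ?]] //= _; rewrite cats0 size_map size_enum_ord.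
    exact: ew.
  have -> : size (enc_bound (Some (0, W))) =
      1 + (size (enc_nat 0) + size (flatten [seq enc_set A | A <- W])).
    by rewrite -size_cat.
  by rewrite hw addnA.
by rewrite size_cat mul2n -addnn; apply: leq_add; [exact: hb h5 | exact: hb h6].
Qed.

End Answers.

(** * The reduction *)

(** As a list of booleans, a string is coded behind its length; a query to the oracle must not
    contain this prefix, so it is removed at the end. *)
Lemma polytime_raw (X : codeType) (f : X -> seq bool) :
  polytime f -> exists p m c, forall (s : state) x, s 0 = encode x ->
    (forall r, 0 < r < m -> s r = [::]) ->
    within ((size (encode x)).+2 ^ c) p s (upd s 0 (f x)).
Proof.
move=> hf; have [d hd] := polytime_size hf; case: hf => p [m [c hp]].
have [e he] : pbound (fun n => n.+2 ^ c + ((n.+2 ^ d * 5 + 10) +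
   ((n.+2 ^ d * 2).+1 + (n.+2 ^ d * 2).+1))) by pbound_tac.
exists (Seq p (Seq (move_unary 2 3) (Seq (clear_stack 1) (clear_stack 3)))), m.+4, e.
move=> s x s0 hs; apply: within_le (he _) _.
have hs' r : 0 < r -> r < m.+4 -> s r = [::] by move=> *; apply: hs; lia.
have ef : encode (f x) = enc_unary (size (f x)) ++ f x.
  rewrite encode_seq; congr (_ ++ _); elim: (f x) => [|b l IH] //.
  by rewrite [LHS]/= -/(flatten _) IH.
have sz : size (f x) < (size (encode x)).+2 ^ d.
  by apply: leq_trans (hd x); exact: size_le_encode.
apply: within_le; last first.
  apply: (within_step (hp _ x s0 _) erefl) => [r hr|]; first by apply: hs'; lia.
  apply: (within_step _ erefl).
    by apply: (@move_unaryP 2 3 (size (f x)) (f x)) => //; upd_tac; rewrite hs'.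
  apply: (within_step _ erefl).
    by apply: (@clear_stackE _ _ (rev (enc_unary (size (f x))))); upd_tac; rewrite ?hs' ?cats0.
  apply: within_eq.
    by apply: (@clear_stackE _ _ (nseq (size (f x)) true)); upd_tac; rewrite ?hs' ?cats0.
  by state_tac; rewrite ?hs' ?cats0.
rewrite size_rev size_nseq size_enc_unary; lia.
Qed.

(** * Stacks out of reach of a program *)

Fixpoint stacks (p : cmd) : nat :=
  match p with
  | Skip => 0
  | Push r _ | Pop r | Query r => r.+1
  | Seq p q => maxn (stacks p) (stacks q)
  | Case r p0 pF pT => maxn r.+1 (maxn (stacks p0) (maxn (stacks pF) (stacks pT)))
  | While r p => maxn r.+1 (stacks p)
  end.

(** A program given by [computable] is specified on [init] only. This lets it run while other data
    are kept on the stacks beyond its reach. *)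
Lemma exec_frame O p s s' t qs m : exec O p s s' t qs -> stacks p <= m ->
  forall s1 : state, (forall r, r < m -> s1 r = s r) ->
  exec O p s1 (fun r => if r < m then s' r else s1 r) t qs.
Proof.
elim=> {p s s' t qs}.
- move=> s _ s1 h; have -> : (fun r => if r < m then s r else s1 r) = s1.
    by apply: functional_extensionality => r; case: ltnP => // /h.
  exact: exec_skip.
- move=> r b s /= rm s1 h.
  have -> : (fun r' => if r' < m then upd s r (b :: s r) r' else s1 r') = upd s1 r (b :: s1 r).
    apply: functional_extensionality => r'; rewrite /upd (h _ rm).
    by case: eqP => [->|_]; rewrite ?rm //; case: ltnP => // /h.
  exact: exec_push.
- move=> r s /= rm s1 h.
  have -> : (fun r' => if r' < m then upd s r (behead (s r)) r' else s1 r') =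
      upd s1 r (behead (s1 r)).
    apply: functional_extensionality => r'; rewrite /upd (h _ rm).
    by case: eqP => [->|_]; rewrite ?rm //; case: ltnP => // /h.
  exact: exec_pop.
- move=> p1 p2 s s1 s2 t1 t2 q1 q2 _ IH1 _ IH2 /=; rewrite geq_max => /andP[h1 h2] s3 h.
  apply: (exec_seq (IH1 h1 _ h)).
  have -> : (fun r => if r < m then s2 r else s3 r) =
    (fun r => if r < m then s2 r else (if r < m then s1 r else s3 r)).
    by apply: functional_extensionality => r; case: ltnP.
  by apply: (IH2 h2) => r ->.
- move=> r p0 pF pT s s' t qs _ IH /=; rewrite !geq_max => /and4P[rm h0 hF hT] s1 h.
  apply: exec_case; rewrite (h _ rm); apply: IH h.
  by case: (s r) => [|[]].
- move=> r p s sr /=; rewrite geq_max => /andP[rm _] s1 h.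
  have -> : (fun r => if r < m then s r else s1 r) = s1.
    by apply: functional_extensionality => r'; case: ltnP => // /h.
  by apply: exec_while_stop; rewrite h.
- move=> r p s s1 s2 t1 t2 q1 q2 sr _ IH1 _ IH2 hm s3 h.
  move: (hm) => /=; rewrite geq_max => /andP[rm pm].
  apply: (exec_while_loop _ (IH1 pm _ h)); first by rewrite h.
  have -> : (fun r => if r < m then s2 r else s3 r) =
    (fun r => if r < m then s2 r else (if r < m then s1 r else s3 r)).
    by apply: functional_extensionality => r'; case: ltnP.
  by apply: (IH2 hm) => r' ->.
- move=> r s /= rm s1 h.
  have -> : (fun r' => if r' < m then upd s r (O (s r)) r' else s1 r') =
      upd s1 r (O (s1 r)).
    apply: functional_extensionality => r'; rewrite /upd (h _ rm).
    by case: eqP => [->|_]; rewrite ?rm //; case: ltnP => // /h.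
  by rewrite -(h _ rm); apply: exec_query.
Qed.

Lemma exec_above O p s s' t qs : exec O p s s' t qs ->
  forall r, stacks p <= r -> s' r = s r.
Proof.
elim=> {p s s' t qs} //=.
- by move=> r b s r'; rewrite /upd; case: eqP => // ->; rewrite ltnn.
- by move=> r s r'; rewrite /upd; case: eqP => // ->; rewrite ltnn.
- move=> p1 p2 s s1 s2 t1 t2 q1 q2 _ IH1 _ IH2 r; rewrite geq_max => /andP[h1 h2].
  by rewrite IH2 // IH1.
- move=> r p0 pF pT s s' t qs _ IH r'; rewrite !geq_max => /and4P[_ h0 hF hT].
  by apply: IH; case: (s r) => [|[]].
- move=> r p s s1 s2 t1 t2 q1 q2 _ _ IH1 _ IH2 r' h.
  by rewrite IH2 // IH1 //; move: h; rewrite geq_max => /andP[].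
- by move=> r s r'; rewrite /upd; case: eqP => // ->; rewrite ltnn.
Qed.

Lemma run_exec O p s s' t : run p s s' t -> exec O p s s' t [::].
Proof.
rewrite /run; set O' := (fun=> _); set qs := [::] => h.
have : qs = [::] by []; elim: h => {p s s' t qs} //.
- by move=> *; apply: exec_skip.
- by move=> *; apply: exec_push.
- by move=> *; apply: exec_pop.
- move=> p1 p2 s s1 s2 t1 t2 [|//] [|//] _ IH1 _ IH2 _.
  exact: (exec_seq (IH1 erefl) (IH2 erefl)).
- by move=> r p0 pF pT s s' t qs _ IH e; apply: exec_case; apply: IH.
- by move=> r p s sr _; apply: exec_while_stop.
- move=> r p s s1 s2 t1 t2 [|//] [|//] sr _ IH1 _ IH2 _.
  exact: (exec_while_loop sr (IH1 erefl) (IH2 erefl)).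
Qed.

Definition clear_stacks (rs : seq nat) : cmd :=
  foldr (fun r q => Seq (clear_stack r) q) Skip rs.

Lemma clear_stacksP rs N (s : state) : (forall r, size (s r) <= N) ->
  within (size rs * (N * 2).+1).+1 (clear_stacks rs) s
    (fun r => if r \in rs then [::] else s r).
Proof.
elim: rs s => [|r rs IH] s hs.
  exact: within_eq (within_skip _) _.
apply: within_le; last first.
  apply: (within_step (clear_stackP _ _) erefl); apply: within_eq.
    by apply: IH => r'; rewrite /upd; case: eqP.
  apply: functional_extensionality => r'; rewrite inE /upd.
  by case: eqP => //= _; case: (r' \in rs).
by rewrite /= mulSn; have := hs r; lia.
Qed.

Lemma within_frame n p s s' m (s1 : state) : within n p s s' -> stacks p <= m ->
  (forall r, r < m -> s1 r = s r) ->
  within n p s1 (fun r => if r < m then s' r else s1 r).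
Proof. by move=> [t tn h] pm hs; exists t => //; exact: (exec_frame (O := fun=> [::]) h pm hs). Qed.

Lemma within_bounded n p s s' N : within n p s s' -> (forall r, size (s r) <= N) ->
  forall r, size (s' r) <= N + n.
Proof. by move=> [t tn h] hs r; have := run_size h r; have := hs r; lia. Qed.

(** Serves for the time and parameter bounds of the reduction, polynomial expressions in given
    computable functions. The number [k] waits on stack [M.+1] while [p] computes [f k], and the
    code of the pair is then assembled for [q]. *)
Lemma computable_polytime f (h : nat -> nat -> nat) :
  computable f -> polytime (fun p : nat * nat => h p.1 p.2) ->
  computable (fun k => h k (f k)).
Proof.
move=> [p hp] [q [m [c hq]]]; set M := maxn 4 (stacks p).
exists (Seq (copy_stack 1 M M.+1) (Seq (move_stack M 1) (Seq p
  (Seq (move_stack 1 M) (Seq (clear_stacks (iota 0 M)) (Seq (Push 0 false)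
  (Seq (move_stack M 0) (Seq (Push 0 false) (Seq (move_stack M.+1 0)
  (Seq q (Seq (move_unary 2 3) (Seq (clear_stack 1) (move_stack 3 1))))))))))))) => k.
have [s' [t [rp s1]]] := hp k.
have M4 : 4 <= M by rewrite leq_maxl.
have pM : stacks p <= M by rewrite leq_maxr.
clearbody M.
suff [n [sf [hn hsf]]] : exists n sf, within n (Seq (copy_stack 1 M M.+1)
    (Seq (move_stack M 1) (Seq p
  (Seq (move_stack 1 M) (Seq (clear_stacks (iota 0 M)) (Seq (Push 0 false)
  (Seq (move_stack M 0) (Seq (Push 0 false) (Seq (move_stack M.+1 0)
  (Seq q (Seq (move_unary 2 3) (Seq (clear_stack 1) (move_stack 3 1)))))))))))))
    (init [::] k) sf /\ sf 1 = nseq (h k (f k)) true.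
  by case: hn => t' _ r; exists sf, t'.
pose U n := nseq n true.
pose a0 := upd (init [::] k) M.+1 (U k).
pose a1 : state := fun r => if r < M then s' r else a0 r.
pose a2 := upd (upd a1 1 [::]) M (U (f k)).
pose a3 := upd (upd (fun=> [::]) M.+1 (U k)) M (U (f k)).
pose a4 := upd a3 0 [:: false].
pose a5 := upd (upd (fun=> [::]) M.+1 (U k)) 0 (encode (f k)).
pose a6 := upd (fun=> [::]) 0 (encode (k, f k)).
pose a7 := upd (fun=> [::]) 0 (encode (h k (f k))).
have init0 r : 1 < r -> init [::] k r = [::] by case: r => [|[|r]].
have enc n : U n ++ [:: false] = encode n.
  by rewrite -[encode n]cats0 [encode n]/(enc_unary n) enc_unary_cat.
have sz1 : forall r, size (a0 r) <= k.
  move=> r; rewrite /a0 /upd; case: eqP => [_|_]; first by rewrite size_nseq.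
  by case: r => [|[|r]] //=; rewrite size_nseq.
have w1 : within t p a0 a1.
  apply: (@within_frame _ _ (init [::] k) _ M) => //; first by exists t.
  by move=> r rM; rewrite /a0 /upd ltn_eqF // ltnW.
have sz2 r : size (a2 r) <= k + t + f k.
  have := within_bounded w1 sz1 r; rewrite /a2 /upd.
  by case: eqP => _; [rewrite size_nseq; lia | case: eqP => _ //=; lia].
do 2!eexists; split.
  apply: (within_step _ erefl).
    apply: (@copy_stackE 1 M M.+1 _ (U k) [::] [::]) => //;
      first [by apply/eqP; lia | by rewrite init0 //; lia].
  apply: (@within_step _ _ _ _ _ _ a0).
  - by apply: (@move_stackE _ _ _ (U k) [::]); rewrite /U; upd_tac; rewrite ?rev_nseq ?cats0.
  - by rewrite /a0 /U; state_tac; rewrite ?rev_nseq ?cats0 //; rewrite init0 //; lia.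
  apply: (within_step w1 erefl).
  apply: (@within_step _ _ _ _ _ _ a2).
  - apply: (@move_stackE _ _ _ (U (f k)) [::]); rewrite /a1 /a0 /U.
    + by apply/eqP; lia.
    + by rewrite ifT //; lia.
    + by rewrite ltnn /upd ltn_eqF // init0 //; lia.
  - by rewrite /a2 /a1 /U rev_nseq cats0.
  apply: (@within_step _ _ _ _ _ _ a3).
  - exact: clear_stacksP sz2.
  - rewrite /a3 /a2 /a1 /a0; apply: functional_extensionality => r.
    rewrite mem_iota /= add0n /upd; case: (ltnP r M) => [rM|rM].
      by rewrite !ltn_eqF //; lia.
    case: eqP => // _; rewrite gtn_eqF; last by lia.
    by case: eqP => // _; rewrite init0 //; lia.
  apply: (@within_step _ _ _ _ _ _ a4); first exact: within_push.
    by rewrite /a4 /a3; state_tac.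
  apply: (@within_step _ _ _ _ _ _ a5).
  - by apply: (@move_stackE _ _ _ (U (f k)) [:: false]); rewrite /a4 /a3; upd_tac.
  - by rewrite /a5 /a4 /a3 /U rev_nseq enc; state_tac.
  apply: (within_step (within_push _ _ _) erefl).
  apply: (@within_step _ _ _ _ _ _ a6).
  - by apply: (@move_stackE _ _ _ (U k) (false :: encode (f k))); rewrite /a5; upd_tac.
  - rewrite /a6 /a5 /U rev_nseq encode_pair -(enc k) -catA; state_tac.
  apply: (@within_step _ _ _ _ _ _ a7).
  - by apply: (hq a6 (k, f k)) => [|r /andP[r0 _]]; rewrite /a6 /upd // gtn_eqF.
  - by rewrite /a7 /a6; state_tac.
  apply: (within_step (@move_unaryP 2 3 (h k (f k)) [::] _ _ _ _ _ _) erefl) => //.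
    by rewrite /a7 upd_eq cats0.
  apply: (within_step (clear_stackP _ _) erefl).
  by apply: (@move_stackE 3 1 _ (U (h k (f k))) [::]); rewrite /a7; upd_tac; rewrite ?cats0.
by rewrite upd_eq /U rev_nseq cats0.
Qed.

(** A witness set has one bit per letter of the word, so this bounds the answers in terms of the
    query. *)
Lemma size_graph_code nc w : size w <= size (graph_code nc w).
Proof.
rewrite /graph_code size_cat size_enc_unary; case: w => //= *; exact: leq_addr.
Qed.

Section Reduction.

Variables (alpha d : nat) (Pform : formula rat -> Prop).
Hypothesis alpha1 : 1 < alpha.
Hypothesis Pform_phi : forall k, Pform (phi alpha d.+4.+1 k).

(** From $\alpha < 2^\alpha$ one gets $\alpha^4 < 2^{4\alpha}$, so $\beta = 2^B$ exceeds the largest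
    factor. A power of two makes $\beta^p = (2^p)^B$ visibly polynomial. *)
Let B := 4 * alpha.
Let D := d.+4.+1.

Definition instance_word (k n : nat) (gs : seq gate) : seq nat :=
  word D (circuit_tree B d k n gs).

Definition query_instance (k n : nat) (gs : seq gate) : path_instance Pform.
Proof.
refine (@PathInstance Pform (word_graph (base D + k) (instance_word k n gs))
  (phi alpha D k) (word_graph_path _ _) erefl _ (phi_nnf _ _ _) (Pform_phi k)).
rewrite size_map size_iota; exact: phi_wf.
Defined.

Let S := approx_path_query alpha Pform.

Definition query_code (k n : nat) (gs : seq gate) : seq bool :=
  @senc S (query_instance k n gs).

Lemma query_codeE k n gs : query_code k n gs =
  graph_code (base D + k) (instance_word k n gs) ++ enc_formula (phi alpha D k).
Proof. by rewrite -enc_word_graph // size_word. Qed.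

Lemma polytime_query_code :
  polytime (fun p : nat * (nat * seq gate) => query_code p.1 p.2.1 p.2.2).
Proof.
have [s1 [s2 e]] := enc_phi alpha D.
apply: (@eq_polytime _ _ (fun p : nat * (nat * seq gate) =>
  graph_code (base D + p.1) (instance_word p.1 p.2.1 p.2.2) ++
  s1 ++ flatten [seq index_code D i | i <- iota 0 p.1] ++ s2)) => [p|].
  by rewrite query_codeE e.
apply: polytime_cat.
  apply: polytime_graph_code; first by poly_tac.
  by apply: polytime_word; apply: polytime_circuit_tree; poly_tac.
apply: polytime_cat; first exact: polytime_const.
apply: polytime_cat; last exact: polytime_const.
apply: polytime_flatten.
apply: (@polytime_map _ nat_codeType (seq_codeType bool_codeType) _ (fun _ i => index_code D i)).
  by poly_tac.
rewrite /index_code; apply: polytime_cat; first exact: polytime_const.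
apply: polytime_cat; first exact: polytime_const.
have h (v : seq bool) : polytime (fun p : (nat * (nat * seq gate)) * nat =>
    enc_unary 3 ++ enc_unary (base D + p.2) ++ v).
  apply: polytime_cat; first exact: polytime_const.
  apply: polytime_cat; last exact: polytime_const.
  by apply: polytime_unary; poly_tac.
by apply: polytime_cat; apply: h.
Qed.

Lemma query_answer k n gs (O : seq bool -> seq bool) :
  wf_gates n gs -> 0 < n + size gs -> node_depth n gs (n + size gs).-1 <= d ->
  solves S O ->
  let a := O (query_code k n gs) in
  (head false a <->
     exists2 X : {set 'I_n}, #|X| = k & @circuit_val (Circuit n gs) X) /\
  size a <= 2 * (1 + size (enc_nat 0) + size (query_code k n gs)).
Proof.
move=> wf ngs hd hO a.
have alphaB : alpha ^ 4 < 2 ^ B by rewrite /B mulnC expnM ltn_exp2r // ltn_expl.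
have B0 : 0 < B by rewrite /B; lia.
have P_index i q : leaf_ok B k n i q -> i < k by case/andP.
have P_pow i q : leaf_ok B k n i q -> exists p, q = (2 ^ B) ^ p.
  by case/andP => _ /hasP[p _ /eqP->]; exists p.
have leaves := circuit_leaves B0 d k n gs.
have ex := @answer_exists D k B alpha _ _ alpha1 alphaB P_index P_pow leaves.
have := hO (query_instance k n gs) ex.
move=> /(@answer_spec D k B alpha _ _ alpha1 alphaB P_index P_pow leaves).
rewrite -/(query_code k n gs) -/a => -[ha sa]; split.
  exact: iff_trans ha (circuit_tree_sat B0 k wf ngs hd).
have hw : size (instance_word k n gs) <= size (query_code k n gs).
  rewrite query_codeE size_cat; apply: leq_trans (leq_addr _ _).
  exact: size_graph_code.
move: sa hw; rewrite -/(instance_word k n gs).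
move: (size (enc_nat 0)) (size (instance_word k n gs)) (size (query_code k n gs)) (size a).
by move=> *; lia.
Qed.

Variable L : plang.
Hypothesis hL : fpt_reducible L (WCS 1 d).

Lemma turing_reduction : fpt_turing_reducible L S.
Proof.
have [p [f [g [c [hf hg hp]]]]] := hL.
have [q [m [e hq]]] := polytime_raw polytime_query_code.
have [a [b hab]] := symbols_phi alpha D.
set M := stacks p.
set z := size (enc_nat 0).
(* The first summand is the time to run [p], erase its garbage and generate the query; the second is
   the time to ask it and to erase the answer, whose size [query_answer] bounds. *)
pose T N := (N + ((M * (N * 2).+1).+1 + (1 + ((N * 4).+1 + (N * 2 + 1).+2 ^ e)))) +
  (1 + (((2 * (1 + z + (N * 2 + 1 + (N * 2 + 1).+2 ^ e))) * 2).+1 + 1).+1).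
have [c3 hT] : pbound T by rewrite /T; pbound_tac.
pose finish (b : bool) := Seq (clear_stack 0) (Push 0 b).
(* Stacks 0 and 1 hold the circuit and [k']. Moving the latter in front of the former, over a pushed
   [false], yields the code of [(k', (n, gs))]; stacks beyond the reach of [p] are still empty. *)
exists (Seq (Seq p (Seq (clear_stacks (iota 2 M)) (Seq (Push 0 false)
  (Seq (move_stack 1 0) q))))
  (Seq (Query 0) (Case 0 (finish false) (finish false) (finish true)))).
(* [T N] is at most [N.+2 ^ c3], and [N.+2] is at most [(f k + k + 3) * (size x).+1 ^ c.+1], which
   separates the parameter from the size of the input. *)
exists (fun k => (f k + k + 3) ^ c3), (fun k => a + b * g k), (c.+1 * c3); split.
- by apply: (@computable_polytime f (fun x y => (y + x + 3) ^ c3) hf); poly_tac.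
- by apply: (@computable_polytime g (fun _ y => a + b * y) hg); poly_tac.
move=> O hO x k; have [[[[n gs] k'] hj] [s' [t [rp ht [s0 s1] hk hLx]]]] := hp x k.
rewrite /= in s0 s1 hk hLx; case/and3P: hj => /= wfC _ hd.
have wf := wf_circuit_gates wfC; have /andP[ngs _] := wfC.
rewrite depth_last /= in wf ngs hd.
have [hans hsz] := query_answer k' wf ngs hd hO.
pose N := k + size x + f k * (size x).+1 ^ c.
set Q := query_code k' n gs in hans hsz; set A := O Q in hans hsz.
pose W := encode (k', (n, gs)).
have hs0 r : size (init x k r) <= k + size x.
  by case: r => [|[|r]] //=; rewrite ?size_nseq ?leq_addl ?leq_addr.
have hs r : size (s' r) <= N.
  by apply: leq_trans (run_size rp r) _; apply: leq_add.
have hk' : k' <= N by have := hs 1; rewrite s1 size_nseq.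
have hW : size W <= N * 2 + 1.
  rewrite /W encode_pair size_cat size_encode_nat.
  by have := hs 0; rewrite s0 -[enc_circuit _]/(encode (n, gs)); lia.
pose b0 := upd (upd (fun=> [::]) 1 (nseq k' true)) 0 (encode (n, gs)).
pose b1 := upd b0 0 (false :: encode (n, gs)).
pose b2 := upd (fun=> [::]) 0 W.
pose b3 := upd (fun=> [::]) 0 Q.
have hpre : within (N + ((M * (N * 2).+1).+1 + (1 + ((N * 4).+1 + (N * 2 + 1).+2 ^ e))))
  (Seq p (Seq (clear_stacks (iota 2 M)) (Seq (Push 0 false)
  (Seq (move_stack 1 0) q)))) (init x k) b3.
  apply: (@within_step _ _ _ _ _ s' s') => //.
    by exists t => //; apply: leq_trans ht _; rewrite leq_addl.
  apply: (@within_step _ _ _ _ _ _ b0).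
  - by rewrite -{1}[M](size_iota 2); apply: clear_stacksP hs.
  - apply: functional_extensionality => r; rewrite mem_iota /b0 /upd.
    case: r => [|[|r]]; [exact: s0 | exact: s1 |].
    rewrite /=; case: (ltnP r.+2 (2 + M)) => //= h.
    by rewrite (exec_above rp) // -/M; lia.
  apply: (@within_step _ _ _ _ _ _ b1); [exact: within_push|by []|].
  apply: (@within_step _ _ _ _ _ _ b2).
  - apply: (@within_le ((size (nseq k' true)) * 4).+1); first by rewrite size_nseq; lia.
    by apply: (@move_stackE _ _ _ (nseq k' true) (false :: encode (n, gs)));
      rewrite /b1 /b0; upd_tac.
  - have eW : W = enc_unary k' ++ encode (n, gs) by [].
    rewrite /b2 eW enc_unary_cat rev_nseq /b1 /b0.
    by state_tac.
  apply: (@within_le ((size W).+2 ^ e)); first by apply: leq_expn; rewrite !ltnS.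
  apply: within_eq; first by apply: (hq b2 (k', (n, gs))) => [|[|r]].
  by rewrite /b3 /b2 /Q; state_tac.
have hQ : size Q <= N * 2 + 1 + (N * 2 + 1).+2 ^ e.
  have hw : within ((size W).+2 ^ e) q b2 (upd b2 0 Q).
    by apply: (hq b2 (k', (n, gs))) => [|[|r]].
  have := within_bounded hw (N := N * 2 + 1) _ 0; rewrite upd_eq => h.
  apply: leq_trans (h _) _; first by move=> r; rewrite /b2 /upd; case: eqP.
  by rewrite leq_add2l leq_expn // !ltnS.
have hA : size A <= 2 * (1 + z + (N * 2 + 1 + (N * 2 + 1).+2 ^ e)).
  by apply: leq_trans hsz _; rewrite leq_mul2l leq_add2l.
pose b4 := upd (fun=> [::]) 0 A.
pose b5 := upd (fun=> [::]) 0 [:: head false A].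
have hfin : within ((size A * 2).+1 + 1) (finish (head false A)) b4 b5.
  apply: (within_step (@clear_stackE _ _ A _) erefl); first by rewrite /b4 upd_eq.
  by apply: within_eq (within_push _ _ _) _; rewrite /b5 /b4; state_tac.
have [t1 ht1 r1] := hpre; have [t2 ht2 r2] := hfin.
exists (head false A), b5, (t1 + (1 + t2.+1)), [:: Q]; split.
- rewrite -[[:: Q]]/([::] ++ ([:: b3 0] ++ [::])).
  apply: (exec_seq (run_exec O r1)); apply: exec_seq (exec_query _ _ _) _.
  have -> : upd b3 0 (O (b3 0)) = b4 by rewrite /b4 /b3; state_tac.
  apply: exec_case; have := run_exec O r2; rewrite /b4 upd_eq.
  by case: (A) => [|[]].
- apply: (@leq_trans (T N)).
    rewrite /T leq_add // leq_add2l ltnS; apply: leq_trans ht2 _; lia.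
  apply: leq_trans (hT N) _; rewrite expnM -expnMn; apply: leq_expn.
  have X0 : 0 < (size x).+1 ^ c by rewrite expn_gt0.
  rewrite /N expnS; nia.
- by rewrite /b5 upd_eq.
- move=> q'; rewrite inE => /eqP->; exists (query_instance k' n gs) => //.
  change (symbols (phi alpha D k') <= a + b * g k).
  by rewrite hab leq_add2l leq_mul2l hk orbT.
- by rewrite hLx.
Qed.

End Reduction.

Theorem theorem11p1 (alpha : nat) (halpha : 1 < alpha) :
  W1_hard (approx_path_query alpha (fun _ => True)) /\
  W1_hard (approx_path_query alpha (fun phi =>
    exists2 psi : formula rat,
      is_mso psi & phi = hard_form alpha%:R%R psi)).
Proof.
(* The reduction only asks that the class of formulas contains every [phi alpha d.+4.+1 k], so both
   claims are instances of it. *)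
split=> L [d hL]; apply: turing_reduction hL => // k.
by exists (psi d.+4.+1 k); first exact: psi_mso.
Qed.
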